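(* Let $n \in \mathbb{N}$ and let $f$ be a transcendental entire function of order $\rho < \frac12$. Set $$G(z) = \frac{\Delta^n f(z)}{f(z)}.$$ If $G$ is transcendental (i.e. not a rational function), then $G$ has infinitely many zeros. In particular, if $f$ has order less than $\min\{\frac1n, \frac12\}$, then $G$ is transcendental and has infinitely many zeros.
   Context: For a function $f$ meromorphic in the plane, the forward differences are defined by $\Delta f(z) = f(z+1) - f(z)$ and $\Delta^{n+1} f(z) = \Delta^n f(z+1) - \Delta^n f(z)$ for $n = 0,1,2,\ldots$ (with $\Delta^0 f = f$, $\Delta^1 f = \Delta f$). The order of an entire function is $\limsup_{r\to\infty} \frac{\log\log M(r,f)}{\log r}$ where $M(r,f)=\max_{|z|=r}|f(z)|$. *)

(* Defs.v *)
From Stdlib Require Import Reals List.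
From Coquelicot Require Export Coquelicot.
Open Scope R_scope.

Definition entire (f : C -> C) : Prop :=
  forall z : C, @ex_derive C_AbsRing C_NormedModule f z.

Definition poly_eval (l : list C) (z : C) : C :=
  fold_right (fun a acc => Cplus a (Cmult z acc)) (RtoC 0) l.

Definition is_polynomial_fun (f : C -> C) : Prop :=
  exists l : list C, forall z, f z = poly_eval l z.

Definition transcendental_entire (f : C -> C) : Prop :=
  entire f /\ ~ is_polynomial_fun f.

Definition Delta (f : C -> C) : C -> C := fun z => Cminus (f (Cplus z (RtoC 1))) (f z).
Fixpoint Delta_n (n : nat) (f : C -> C) : C -> C :=
  match n with
  | O => f
  | S m => Delta (Delta_n m f)
  end.

(* maximum modulus M(r,f) = max_{|z| = r} |f z|  (sup, attained for continuous f) *)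
Definition max_modulus (f : C -> C) (r : R) : R :=
  real (Lub_Rbar (fun x => exists z : C, Cmod z = r /\ x = Cmod (f z))).

Definition limsup_infty (g : R -> R) : Rbar :=
  Rbar_glb (fun y => exists r0 : R, y = Lub_Rbar (fun x => exists r, r0 < r /\ x = g r)).

Definition order (f : C -> C) : Rbar :=
  limsup_infty (fun r => ln (ln (max_modulus f r)) / ln r).

(* G is a rational function: G = P/Q for polynomials P, Q with Q not identically 0,
   on the points where G is given by its defining formula (f z <> 0) and Q z <> 0 *)
Definition rational_on (D : C -> Prop) (G : C -> C) : Prop :=
  exists P Q : list C, (exists z, poly_eval Q z <> RtoC 0) /\
    forall z, D z -> poly_eval Q z <> RtoC 0 -> G z = Cdiv (poly_eval P z) (poly_eval Q z).

Definition mero_zero (G : C -> C) (z0 : C) : Prop :=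
  filterlim G (locally' z0) (locally (RtoC 0)).

Definition infinitely_many (P : C -> Prop) : Prop :=
  forall l : list C, exists z, P z /\ ~ In z l.

(* Main.v *)
Require Import Defs.
From Stdlib Require Import Reals List.
From Coquelicot Require Import Coquelicot.
From Stdlib Require Import ZArith Lra Lia ClassicalEpsilon.
(* Reals also exports a constant named Delta. *)
Import Defs.
Open Scope R_scope.
Open Scope C_scope.

(** Let g = Delta^n f and suppose that g/f has finitely many zeros and is not rational. Then
    H = P f / g is entire for some polynomial P, and not a polynomial.

    Wiman's theorem: an entire function of order < 1/2 whose minimum modulus on |z| = r is O(r^M) is
    a polynomial. Indeed a Taylor polynomial of degree N ~ r^s, s < 1/2, approximates it on |z| <= r/2;
    replacing the zeros b of this polynomial by |b| gives a polynomial that is O(r^M) on [0, r/2],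
    so by a Chebyshev type estimate the original one is O(r^(M+1)) on |z| = c r / N^2, and Cauchy's
    estimate on this circle kills all high coefficients, since r / N^2 is a positive power of r.

    Applied to g, it gives circles on which |g| >= 1, hence |H| <= |P f| there; applied to H, it
    then gives circles on which |g| <= r^(-L) |f|. But for order < 1/2 the operator Delta differs from
    d/dz by a small perturbation on Taylor polynomials of degree N, since N^2 = o(r), so that
    M(r, f) = O(r^(n+1) (1 + M(r, g))), a contradiction.

    If g/f is rational and grows like z^m, then m <= -n contradicts the same inversion of Delta in
    a weighted form, and m > -n contradicts order < 1/n by Cauchy's estimates for g. *)

(** The exponent 1/2 enters twice, each time as N^2 = o(r) for the degree N of the Taylor
    polynomial. A polynomial of degree N that is bounded on a segment of length r stays under
    control, up to a factor O(N), within a distance of order r / N^2 of its end; and the errors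
    (z+1)^j - z^j - j z^(j-1), summed over all j < N, are absorbed by the largest coefficient.

    The obstacle is that H is a quotient, so its growth does not follow from that of f and g: small
    values of g could make it large. It is controlled only on circles where |g| is bounded below,
    and these are only known to exist at arbitrarily large radii. Hence the growth of H, and every
    contradiction with transcendence, is formulated for unbounded sets of radii, on which Cauchy's
    estimates still work.

    In the borderline case m = -n the inversion of Delta cannot afford the extra factor r that
    adding up N coefficients costs. A weight k^2 replaces this count by the convergent sum of 1/k^2.
    The weight comes from two inversions of Delta, one factor k from each, which is why n = 1 is
    treated separately. *)

(** * Continuous curves in the plane and their integrals *)

Definition curve_cont (phi : R -> C) : Prop :=
  forall x eps, (0 < eps)%R ->
    exists d, (0 < d)%R /\ forall y, (Rabs (y - x) < d -> Cmod (phi y - phi x) < eps)%R.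

Definition CInt (phi : R -> C) (a b : R) : C := @RInt C_R_CompleteNormedModule phi a b.

Lemma curve_cont_continuous (phi : R -> C) :
  curve_cont phi <-> forall x, @continuous R_UniformSpace (AbsRing_UniformSpace C_AbsRing) phi x.
Proof.
  split.
  - intros H x. apply filterlim_locally. intros eps. destruct (H x eps (cond_pos eps)) as [d [Hd K]].
    exists (mkposreal d Hd). intros y Hy. apply K, Hy.
  - intros H x eps He. destruct (proj1 (filterlim_locally _ _) (H x) (mkposreal eps He)) as [d Hd].
    exists d. split; [apply cond_pos|]. intros y Hy. apply Hd, Hy.
Qed.

Lemma curve_cont_ex_RInt (phi : R -> C) (a b : R) :
  curve_cont phi -> @ex_RInt C_R_CompleteNormedModule phi a b.
Proof.
  intros H. apply ex_RInt_continuous. intros z _. apply filterlim_locally. intros eps.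
  destruct (H z eps (cond_pos eps)) as [d [Hd H1]].
  exists (mkposreal d Hd). intros y Hy. apply (norm_compat1 (V := C_R_NormedModule)).
  eapply Rle_lt_trans; [apply Req_le; symmetry; exact (Cmod_norm (phi y - phi z))|apply H1, Hy].
Qed.

Lemma CInt_correct (phi : R -> C) (a b : R) :
  curve_cont phi -> @is_RInt C_R_NormedModule phi a b (CInt phi a b).
Proof. intros H. apply (RInt_correct (V := C_R_CompleteNormedModule)). now apply curve_cont_ex_RInt. Qed.

Lemma CInt_unique (phi : R -> C) (a b : R) (l : C) :
  @is_RInt C_R_NormedModule phi a b l -> CInt phi a b = l.
Proof. intros H. now apply (is_RInt_unique (V := C_R_CompleteNormedModule)). Qed.

Lemma CInt_ext (phi psi : R -> C) (a b : R) :
  (forall x, phi x = psi x) -> CInt phi a b = CInt psi a b.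
Proof. intros H. apply (RInt_ext (V := C_R_CompleteNormedModule)). intros; apply H. Qed.

Lemma CInt_plus (phi psi : R -> C) (a b : R) : curve_cont phi -> curve_cont psi ->
  CInt (fun x => phi x + psi x) a b = CInt phi a b + CInt psi a b.
Proof. intros H1 H2. apply CInt_unique. apply (is_RInt_plus (V := C_R_NormedModule)); now apply CInt_correct. Qed.

Lemma CInt_Chasles (phi : R -> C) (a b c : R) : curve_cont phi ->
  CInt phi a b + CInt phi b c = CInt phi a c.
Proof. intros H. apply (RInt_Chasles (V := C_R_CompleteNormedModule)); now apply curve_cont_ex_RInt. Qed.

(** The integral is taken in C as a real normed module, which gives linearity over R only. A complex
    factor is moved out through real and imaginary parts. *)
Lemma CInt_scal (k : C) (phi : R -> C) (a b : R) : curve_cont phi ->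
  CInt (fun x => k * phi x) a b = k * CInt phi a b.
Proof.
  intros H. apply CInt_unique.
  pose proof (CInt_correct phi a b H) as HI.
  pose proof (is_RInt_fct_extend_fst (U := R_NormedModule) (V := R_NormedModule) phi a b _ HI) as H1.
  pose proof (is_RInt_fct_extend_snd (U := R_NormedModule) (V := R_NormedModule) phi a b _ HI) as H2.
  destruct k as [k1 k2]. unfold Cmult at 2.
  apply (is_RInt_fct_extend_pair (U := R_NormedModule) (V := R_NormedModule)); simpl.
  - apply (is_RInt_minus (V := R_NormedModule)).
    + apply (is_RInt_scal (V := R_NormedModule) _ _ _ k1 _ H1).
    + apply (is_RInt_scal (V := R_NormedModule) _ _ _ k2 _ H2).
  - apply (is_RInt_plus (V := R_NormedModule)).
    + apply (is_RInt_scal (V := R_NormedModule) _ _ _ k1 _ H2).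
    + apply (is_RInt_scal (V := R_NormedModule) _ _ _ k2 _ H1).
Qed.

Lemma CInt_bound (phi : R -> C) (a b M : R) : curve_cont phi -> (a <= b)%R ->
  (forall x, (a <= x <= b)%R -> (Cmod (phi x) <= M)%R) -> (Cmod (CInt phi a b) <= (b - a) * M)%R.
Proof.
  intros H Hab HM.
  rewrite Cmod_norm.
  refine (norm_RInt_le_const (V := C_R_NormedModule) phi a b _ M Hab _ (CInt_correct phi a b H)).
  intros x Hx. eapply Rle_trans; [apply Req_le; symmetry; exact (Cmod_norm (phi x))|now apply HM].
Qed.

Lemma CInt_const (k : C) (a b : R) : CInt (fun _ => k) a b = RtoC (b - a) * k.
Proof.
  apply CInt_unique.
  replace (RtoC (b - a) * k) with (@scal _ C_R_NormedModule (b - a)%R k).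
  - apply (is_RInt_const (V := C_R_NormedModule)).
  - destruct k as [k1 k2]. unfold scal; simpl. unfold prod_scal, scal, Cmult; simpl. unfold mult; simpl.
    f_equal; ring.
Qed.

Lemma Cmod_minus_sym (x y : C) : Cmod (x - y) = Cmod (y - x).
Proof. rewrite <- Cmod_opp. f_equal. ring. Qed.

Lemma Cmod_triangle_minus (x y : C) : (Cmod (x - y) <= Cmod x + Cmod y)%R.
Proof. rewrite <- (Cmod_opp y). apply Cmod_triangle. Qed.

Lemma Cmod_reverse_triangle (x y : C) : (Cmod x - Cmod y <= Cmod (x - y))%R.
Proof.
  pose proof (Cmod_triangle (x - y) y) as H. replace (x - y + y) with x in H by ring. lra.
Qed.

Lemma curve_cont_const (k : C) : curve_cont (fun _ => k).
Proof.
  intros x eps H. exists 1%R. split; [lra|]. intros y _.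
  replace (k - k) with (RtoC 0) by ring. now rewrite Cmod_0.
Qed.

Lemma curve_cont_plus (phi psi : R -> C) : curve_cont phi -> curve_cont psi ->
  curve_cont (fun x => phi x + psi x).
Proof.
  rewrite !curve_cont_continuous. intros H1 H2 x.
  apply (continuous_plus (V := AbsRing_NormedModule C_AbsRing)); auto.
Qed.

Lemma curve_cont_mult (phi psi : R -> C) : curve_cont phi -> curve_cont psi ->
  curve_cont (fun x => phi x * psi x).
Proof.
  rewrite !curve_cont_continuous. intros H1 H2 x. apply (continuous_mult (K := C_AbsRing)); auto.
Qed.

Lemma curve_cont_minus (phi psi : R -> C) : curve_cont phi -> curve_cont psi ->
  curve_cont (fun x => phi x - psi x).
Proof.
  rewrite !curve_cont_continuous. intros H1 H2 x.
  apply (continuous_minus (V := AbsRing_NormedModule C_AbsRing)); auto.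
Qed.

Lemma Cmod_le_0 (x : C) : (Cmod x <= 0)%R -> x = 0.
Proof. intros H. apply Cmod_eq_0, Rle_antisym; [exact H|apply Cmod_ge_0]. Qed.

Lemma Cminus_eq_0 (x y : C) : x - y = 0 -> x = y.
Proof. intros H. replace x with (x - y + y) by ring. rewrite H. ring. Qed.

Lemma RtoC_neq_0 (x : R) : x <> 0%R -> RtoC x <> 0.
Proof. intros H E. apply H. now apply RtoC_inj. Qed.

Lemma zero_of_not_nonzero (f : C -> C) : ~ (exists z, f z <> 0) -> forall z, f z = 0.
Proof. intros H z. apply NNPP. intros h. apply H. now exists z. Qed.

(** * Complex derivatives in epsilon-delta form *)

Definition cderiv (f : C -> C) (z l : C) : Prop :=
  forall eps, (0 < eps)%R -> exists d, (0 < d)%R /\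
    forall w, (Cmod (w - z) < d -> Cmod (f w - f z - l * (w - z)) <= eps * Cmod (w - z))%R.

Lemma is_derive_cderiv (f : C -> C) (z l : C) :
  @is_derive C_AbsRing C_NormedModule f z l <-> cderiv f z l.
Proof.
  split.
  - intros [_ H]. intros eps He.
    specialize (H z (fun P HP => HP) (mkposreal eps He)).
    destruct H as [d Hd].
    exists d. split; [apply cond_pos|]. intros w Hw.
    specialize (Hd w Hw). simpl in Hd.
    replace (l * (w - z)) with ((w - z) * l) by ring. exact Hd.
  - intros H. split.
    + apply is_linear_scal_l.
    + intros x Hx. 
      apply (@is_filter_lim_locally_unique C_AbsRing (AbsRing_NormedModule C_AbsRing)) in Hx. subst x.
      intros eps. destruct (H eps (cond_pos eps)) as [d [Hd K]].
      exists (mkposreal d Hd). intros w Hw.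
      specialize (K w Hw). replace (l * (w - z)) with ((w - z) * l) in K by ring. exact K.
Qed.

Lemma entire_cderiv (f : C -> C) : entire f <-> forall z, exists l, cderiv f z l.
Proof.
  split; intros H z; destruct (H z) as [l Hl]; exists l; now apply is_derive_cderiv.
Qed.

Lemma cderiv_pointwise_cont (f : C -> C) (z l : C) : cderiv f z l -> forall eps, (0 < eps)%R ->
  exists d, (0 < d)%R /\ forall w, (Cmod (w - z) < d -> Cmod (f w - f z) < eps)%R.
Proof.
  intros H eps He. destruct (H 1%R Rlt_0_1) as [d [Hd K]].
  pose proof (Cmod_ge_0 l) as Hl.
  exists (Rmin d (eps / (2 + Cmod l)))%R. split.
  { apply Rmin_glb_lt; [lra|]. apply Rdiv_lt_0_compat; lra. }
  intros w Hw. specialize (K w (Rlt_le_trans _ _ _ Hw (Rmin_l _ _))).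
  apply (fun h => Rlt_le_trans _ _ _ h (Rmin_r _ _)) in Hw.
  replace (f w - f z) with ((f w - f z - l * (w - z)) + l * (w - z)) by ring.
  eapply Rle_lt_trans; [apply Cmod_triangle|]. rewrite Cmod_mult.
  pose proof (Cmod_ge_0 (w - z)) as Hp.
  assert (E : ((2 + Cmod l) * Cmod (w - z) < (2 + Cmod l) * (eps / (2 + Cmod l)))%R)
    by (apply Rmult_lt_compat_l; lra).
  replace ((2 + Cmod l) * (eps / (2 + Cmod l)))%R with eps in E by (field; lra).
  lra.
Qed.

(** The rules for sums and products are available for C as a module over its own absolute ring,
    while [entire] refers to [C_NormedModule]. Both notions of derivative reduce to [cderiv], which
    serves as the bridge. *)
Lemma is_derive_cderiv_ring (f : C -> C) (z l : C) :
  @is_derive C_AbsRing (AbsRing_NormedModule C_AbsRing) f z l <-> cderiv f z l.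
Proof. rewrite <- is_derive_cderiv. split; intros [H1 H2]; (split; [apply is_linear_scal_l|exact H2]). Qed.

Lemma cderiv_const (c z : C) : cderiv (fun _ => c) z 0.
Proof. apply is_derive_cderiv_ring. apply (is_derive_const (V := AbsRing_NormedModule C_AbsRing)). Qed.

Lemma cderiv_id (z : C) : cderiv (fun w => w) z 1.
Proof. apply is_derive_cderiv_ring. apply (is_derive_id (K := C_AbsRing)). Qed.

Lemma cderiv_plus (f g : C -> C) (z l m : C) : cderiv f z l -> cderiv g z m ->
  cderiv (fun w => f w + g w) z (l + m).
Proof.
  rewrite <- !is_derive_cderiv_ring. apply (is_derive_plus (V := AbsRing_NormedModule C_AbsRing)).
Qed.

Lemma cderiv_mult (f g : C -> C) (z l m : C) : cderiv f z l -> cderiv g z m ->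
  cderiv (fun w => f w * g w) z (l * g z + f z * m).
Proof.
  rewrite <- !is_derive_cderiv_ring. intros H1 H2.
  apply (is_derive_mult (K := C_AbsRing)); auto. exact Cmult_comm.
Qed.

Lemma cderiv_inv (g : C -> C) (z m : C) : cderiv g z m -> g z <> 0 ->
  cderiv (fun w => / g w) z (- m / (g z * g z)).
Proof.
  intros H Hz eps He. pose proof (proj1 (Cmod_gt_0 _) Hz) as Hp. set (p := Cmod (g z)) in *.
  pose proof (Cmod_ge_0 m) as Pm.
  (* Once |g w| >= p/2, the two terms of the decomposition used below are at most 2 e1 / p^2 and 2
     (|m| + 1) e2 / p^3 times |w - z|. With these values each is eps/2 times |w - z|. *)
  set (e1 := (eps * p * p / 4)%R). assert (He1 : (0 < e1)%R) by (unfold e1; repeat apply Rmult_lt_0_compat; lra).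
  set (e2 := (eps * p * p * p / (4 * (Cmod m + 1)))%R).
  assert (He2 : (0 < e2)%R).
  { unfold e2. apply Rdiv_lt_0_compat; [repeat apply Rmult_lt_0_compat; lra|lra]. }
  destruct (H e1 He1) as [d1 [Hd1 K1]].
  destruct (cderiv_pointwise_cont g z m H (Rmin (p / 2) e2)) as [d2 [Hd2 K2]].
  { apply Rmin_glb_lt; lra. }
  exists (Rmin d1 d2). split; [now apply Rmin_glb_lt|]. intros w Hw.
  specialize (K1 w (Rlt_le_trans _ _ _ Hw (Rmin_l _ _))).
  specialize (K2 w (Rlt_le_trans _ _ _ Hw (Rmin_r _ _))).
  pose proof (Rmin_l (p / 2) e2). pose proof (Rmin_r (p / 2) e2).
  assert (L : (p / 2 <= Cmod (g w))%R).
  { pose proof (Cmod_reverse_triangle (g z) (g z - g w)) as T.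
    replace (g z - (g z - g w)) with (g w) in T by ring.
    rewrite (Cmod_minus_sym (g z)) in T. fold p in T. lra. }
  assert (Hw0 : g w <> 0) by (apply Cmod_gt_0; lra).
  replace (/ g w - / g z - - m / (g z * g z) * (w - z))
    with (- (g w - g z - m * (w - z)) * / (g w * g z) + m * (w - z) * (g w - g z) * / (g z * g z * g w))
    by (field; auto).
  eapply Rle_trans; [apply Cmod_triangle|].
  rewrite !Cmod_mult, Cmod_opp, !Cmod_inv, !Cmod_mult by (repeat apply Cmult_neq_0; auto).
  fold p. set (h := Cmod (w - z)) in *. assert (Hh : (0 <= h)%R) by apply Cmod_ge_0.
  assert (I1 : (/ (Cmod (g w) * p) <= / (p / 2 * p))%R).
  { apply Rinv_le_contravar; [apply Rmult_lt_0_compat; lra|]. apply Rmult_le_compat_r; lra. }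
  assert (I2 : (/ (p * p * Cmod (g w)) <= / (p * p * (p / 2)))%R).
  { assert (0 < p * p)%R by (apply Rmult_lt_0_compat; lra).
    apply Rinv_le_contravar; [apply Rmult_lt_0_compat; lra|]. apply Rmult_le_compat_l; lra. }
  assert (J1 : (0 < / (Cmod (g w) * p))%R) by (apply Rinv_0_lt_compat, Rmult_lt_0_compat; lra).
  assert (J2 : (0 < / (p * p * Cmod (g w)))%R)
    by (apply Rinv_0_lt_compat; repeat apply Rmult_lt_0_compat; lra).
  assert (T1 : (Cmod (g w - g z - m * (w - z)) * / (Cmod (g w) * p) <= e1 * h * / (p / 2 * p))%R)
    by (apply Rmult_le_compat; auto using Cmod_ge_0; lra).
  assert (T2 : (Cmod m * h * Cmod (g w - g z) * / (p * p * Cmod (g w)) <=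
     (Cmod m + 1) * h * e2 * / (p * p * (p / 2)))%R).
  { apply Rmult_le_compat; try lra.
    - apply Rmult_le_pos; [now apply Rmult_le_pos|apply Cmod_ge_0].
    - apply Rmult_le_compat; [now apply Rmult_le_pos|apply Cmod_ge_0| |lra].
      apply Rmult_le_compat_r; lra. }
  replace (e1 * h * / (p / 2 * p))%R with (eps * h / 2)%R in T1 by (unfold e1; field; lra).
  replace ((Cmod m + 1) * h * e2 * / (p * p * (p / 2)))%R with (eps * h / 2)%R in T2
    by (unfold e2; field; lra).
  lra.
Qed.

Definition pointwise_cont (f : C -> C) : Prop :=
  forall z eps, (0 < eps)%R ->
    exists d, (0 < d)%R /\ forall w, (Cmod (w - z) < d -> Cmod (f w - f z) < eps)%R.

Lemma entire_cont (f : C -> C) : entire f -> pointwise_cont f.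
Proof.
  intros H z. apply entire_cderiv with (z := z) in H. destruct H as [l Hl].
  now apply cderiv_pointwise_cont with l.
Qed.

Lemma curve_cont_comp (f : C -> C) (phi : R -> C) :
  pointwise_cont f -> curve_cont phi -> curve_cont (fun x => f (phi x)).
Proof.
  intros Hf Hp x eps He. destruct (Hf (phi x) eps He) as [d [Hd K]].
  destruct (Hp x d Hd) as [d' [Hd' K']]. exists d'. split; [exact Hd'|].
  intros y Hy. apply K, K', Hy.
Qed.

Lemma curve_cont_inv (phi : R -> C) : curve_cont phi -> (forall x, phi x <> 0) ->
  curve_cont (fun x => / phi x).
Proof.
  intros H Hn x eps He.
  destruct (cderiv_pointwise_cont _ _ _ (cderiv_inv _ _ _ (cderiv_id (phi x)) (Hn x)) eps He) as [d [Hd K]].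
  destruct (H x d Hd) as [d' [Hd' K']]. exists d'. split; [exact Hd'|]. intros y Hy. apply K, K', Hy.
Qed.

(** * Cauchy's integral formula *)

(** This is e^(it) for a real angle t, a parametrisation of the unit circle, and not the complex
    exponential. *)
Definition cexp (t : R) : C := (cos t, sin t).

Lemma Cmod_cexp (t : R) : Cmod (cexp t) = 1%R.
Proof.
  unfold cexp, Cmod; simpl. replace (cos t * (cos t * 1) + sin t * (sin t * 1))%R with 1%R.
  - apply sqrt_1.
  - pose proof (sin2_cos2 t) as H. unfold Rsqr in H. lra.
Qed.

Lemma Rabs_diff_le_of_derive (f g : R -> R) (x y : R) (K : R) :
  (forall t, Rmin x y <= t <= Rmax x y -> is_derive f t (g t))%R ->
  (forall t, Rmin x y <= t <= Rmax x y -> Rabs (g t) <= K)%R ->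
  (Rabs (f y - f x) <= K * Rabs (y - x))%R.
Proof.
  intros Hf Hg.
  destruct (MVT_gen f x y g) as [c [Hc E]].
  - intros t Ht. apply Hf. lra.
  - intros t Ht. apply derivable_continuous_pt. exists (g t). apply is_derive_Reals, Hf, Ht.
  - rewrite E, Rabs_mult. apply Rmult_le_compat_r; [apply Rabs_pos|]. apply Hg, Hc.
Qed.

Lemma cexp_lipschitz (x y : R) : (Cmod (cexp y - cexp x) <= 2 * Rabs (y - x))%R.
Proof.
  assert (H1 : (Rabs (cos y - cos x) <= 1 * Rabs (y - x))%R).
  { apply Rabs_diff_le_of_derive with (fun t => - sin t)%R.
    - intros t _. auto_derive; [trivial|ring].
    - intros t _. rewrite Rabs_Ropp. apply Rabs_le. pose proof (SIN_bound t). lra. }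
  assert (H2 : (Rabs (sin y - sin x) <= 1 * Rabs (y - x))%R).
  { apply Rabs_diff_le_of_derive with (fun t => cos t)%R.
    - intros t _. auto_derive; [trivial|ring].
    - intros t _. apply Rabs_le. pose proof (COS_bound t). lra. }
  replace (cexp y - cexp x) with (RtoC (cos y - cos x) + Ci * RtoC (sin y - sin x)).
  - eapply Rle_trans; [apply Cmod_triangle|]. rewrite Cmod_mult, Cmod_Ci, !Cmod_R. lra.
  - unfold cexp, Cminus, Cplus, Cmult, Copp, Ci, RtoC; simpl. f_equal; ring.
Qed.

Lemma curve_cont_cexp : curve_cont cexp.
Proof.
  intros x eps He. exists (eps / 2)%R. split; [lra|]. intros y Hy.
  eapply Rle_lt_trans; [apply cexp_lipschitz|]. lra.
Qed.

Lemma cexp_pow (n : nat) (t : R) : cexp t ^ n = cexp (INR n * t).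
Proof.
  induction n as [|n IH].
  - unfold cexp. simpl. rewrite Rmult_0_l, cos_0, sin_0. reflexivity.
  - rewrite Cpow_S, IH, S_INR. unfold cexp, Cmult; simpl.
    replace ((INR n + 1) * t)%R with (t + INR n * t)%R by ring.
    rewrite cos_plus, sin_plus. f_equal; ring.
Qed.

Lemma cexp_neq_0 (t : R) : cexp t <> 0.
Proof. apply Cmod_gt_0. rewrite Cmod_cexp. lra. Qed.

Lemma cexp_opp (t : R) : cexp (- t) = / cexp t.
Proof.
  assert (H : cexp (- t) * cexp t = 1).
  { unfold cexp, Cmult, RtoC; simpl. rewrite cos_neg, sin_neg.
    pose proof (sin2_cos2 t) as H. unfold Rsqr in H. f_equal; lra. }
  replace (cexp (- t)) with (cexp (- t) * cexp t * / cexp t) by (field; apply cexp_neq_0).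
  rewrite H. ring.
Qed.

Lemma CInt_cexp (m a b : R) :
  CInt (fun t => Ci * RtoC m * cexp (m * t)) a b = cexp (m * b) - cexp (m * a).
Proof.
  apply CInt_unique.
  apply (is_RInt_fct_extend_pair (U := R_NormedModule) (V := R_NormedModule)).
  - apply is_RInt_ext with (fun t => - m * sin (m * t))%R.
    + intros t _. unfold Ci, cexp, Cmult, RtoC; simpl. ring.
    + apply (is_RInt_derive (V := R_CompleteNormedModule) (fun t => cos (m * t))).
      * intros t _. auto_derive; [trivial|ring].
      * intros t _. apply (ex_derive_continuous (V := R_NormedModule)). auto_derive. trivial.
  - apply is_RInt_ext with (fun t => m * cos (m * t))%R.
    + intros t _. unfold Ci, cexp, Cmult, RtoC; simpl. ring.
    + apply (is_RInt_derive (V := R_CompleteNormedModule) (fun t => sin (m * t))).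
      * intros t _. auto_derive; [trivial|ring].
      * intros t _. apply (ex_derive_continuous (V := R_NormedModule)). auto_derive. trivial.
Qed.

Lemma CInt_exp (a b : R) : CInt (fun x => RtoC (exp x)) a b = RtoC (exp b - exp a).
Proof.
  apply CInt_unique. unfold RtoC.
  apply (is_RInt_fct_extend_pair (U := R_NormedModule) (V := R_NormedModule)); simpl.
  - apply (is_RInt_derive (V := R_CompleteNormedModule) exp).
    + intros t _. auto_derive; [trivial|ring].
    + intros t _. apply (ex_derive_continuous (V := R_NormedModule)). auto_derive. trivial.
  - pose proof (is_RInt_const (V := R_NormedModule) a b 0%R) as H.
    replace (scal (b - a)%R (0%R : R_NormedModule)) with 0%R in H; [exact H|].
    unfold scal; simpl; unfold mult; simpl. ring.
Qed.

Lemma nested_intervals_common_point (a b : nat -> R) :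
  (forall n, a n <= a (S n) /\ b (S n) <= b n /\ a n <= b n)%R ->
  exists x, forall n, (a n <= x <= b n)%R.
Proof.
  intros H.
  assert (Ha : forall n k, (a n <= a (n + k)%nat)%R).
  { intros n k. induction k as [|k IH].
    - rewrite Nat.add_0_r. lra.
    - rewrite Nat.add_succ_r. destruct (H (n + k)%nat). lra. }
  assert (Hb : forall n k, (b (n + k)%nat <= b n)%R).
  { intros n k. induction k as [|k IH].
    - rewrite Nat.add_0_r. lra.
    - rewrite Nat.add_succ_r. destruct (H (n + k)%nat). lra. }
  assert (Hab : forall n m, (a n <= b m)%R).
  { intros n m. specialize (Ha n m). specialize (Hb m n). rewrite Nat.add_comm in Hb.
    destruct (H (n + m)%nat) as (_ & _ & K). lra. }
  destruct (completeness (fun y => exists n, y = a n)) as [x [Hx1 Hx2]].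
  - exists (b 0%nat). intros y [n ->]. apply Hab.
  - exists (a 0%nat), 0%nat. reflexivity.
  - exists x. intros n. split.
    + apply Hx1. now exists n.
    + apply Hx2. intros y [m ->]. apply Hab.
Qed.

(* Bisection on rectangles: the common core of Goursat's argument. *)
Lemma additive_rectangle_function_eq_0 (J : R -> R -> R -> R -> C) (x1 x2 y1 y2 : R) :
  (x1 <= x2)%R -> (y1 <= y2)%R ->
  (forall a b c d e, J a b d e + J b c d e = J a c d e) ->
  (forall a b c d e, J a b c d + J a b d e = J a b c e) ->
  (forall x y eps, x1 <= x <= x2 -> y1 <= y <= y2 -> 0 < eps ->
     exists del, 0 < del /\ forall a b c d,
       x1 <= a <= x -> x <= b <= x2 -> y1 <= c <= y -> y <= d <= y2 ->
       b - a <= del -> d - c <= del ->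
       Cmod (J a b c d) <= eps * ((b - a) + (d - c)) ^ 2)%R ->
  J x1 x2 y1 y2 = 0.
Proof.
  intros Hx Hy Ax Ay Hloc.
  apply Cmod_eq_0. destruct (Req_dec (Cmod (J x1 x2 y1 y2)) 0) as [|Hne]; [assumption|exfalso].
  assert (Hpos : (0 < Cmod (J x1 x2 y1 y2))%R) by (pose proof (Cmod_ge_0 (J x1 x2 y1 y2)); lra).
  set (m := fun u v : R => ((u + v) / 2)%R).
  (* Each cut keeps a half on which |J| is at least half of its value on the whole. A round of both
     cuts therefore loses at most a factor 4 while both sides of the rectangle are halved. *)
  set (cut1 := fun q : R * R * R * R => let '(a, b, c, d) := q in
     if Rle_dec (Cmod (J a b c d)) (2 * Cmod (J a (m a b) c d)) then (a, m a b, c, d) else (m a b, b, c, d)).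
  set (cut2 := fun q : R * R * R * R => let '(a, b, c, d) := q in
     if Rle_dec (Cmod (J a b c d)) (2 * Cmod (J a b c (m c d))) then (a, b, c, m c d) else (a, b, m c d, d)).
  set (Jq := fun q : R * R * R * R => let '(a, b, c, d) := q in Cmod (J a b c d)).
  assert (C1 : forall a b c d, (a <= b)%R -> exists a' b', cut1 (a, b, c, d) = (a', b', c, d) /\
     (a <= a' /\ b' <= b /\ a' <= b' /\ b' - a' = (b - a) / 2)%R /\
     (Cmod (J a b c d) <= 2 * Cmod (J a' b' c d))%R).
  { intros a b c d Hab. unfold cut1.
    destruct (Rle_dec (Cmod (J a b c d)) (2 * Cmod (J a (m a b) c d))) as [h|h].
    - exists a, (m a b). unfold m in *. repeat split; try lra.
    - exists (m a b), b. pose proof (Ax a (m a b) b c d) as E.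
      pose proof (Cmod_triangle (J a (m a b) c d) (J (m a b) b c d)) as T. rewrite E in T.
      unfold m in *. repeat split; lra. }
  assert (C2 : forall a b c d, (c <= d)%R -> exists c' d', cut2 (a, b, c, d) = (a, b, c', d') /\
     (c <= c' /\ d' <= d /\ c' <= d' /\ d' - c' = (d - c) / 2)%R /\
     (Cmod (J a b c d) <= 2 * Cmod (J a b c' d'))%R).
  { intros a b c d Hab. unfold cut2.
    destruct (Rle_dec (Cmod (J a b c d)) (2 * Cmod (J a b c (m c d)))) as [h|h].
    - exists c, (m c d). unfold m in *. repeat split; try lra.
    - exists (m c d), d. pose proof (Ay a b c (m c d) d) as E.
      pose proof (Cmod_triangle (J a b c (m c d)) (J a b (m c d) d)) as T. rewrite E in T.
      unfold m in *. repeat split; lra. }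
  set (Q := fun n => Nat.iter n (fun q => cut2 (cut1 q)) (x1, x2, y1, y2)).
  set (qa := fun n => fst (fst (fst (Q n)))). set (qb := fun n => snd (fst (fst (Q n)))).
  set (qc := fun n => snd (fst (Q n))). set (qd := fun n => snd (Q n)).
  assert (EQ : forall n, Q n = (qa n, qb n, qc n, qd n)).
  { intros n. unfold qa, qb, qc, qd. now destruct (Q n) as [[[? ?] ?] ?]. }
  assert (Step : forall n, (qa n <= qb n -> qc n <= qd n ->
     (qa n <= qa (S n) /\ qb (S n) <= qb n /\ qa (S n) <= qb (S n)) /\
     (qc n <= qc (S n) /\ qd (S n) <= qd n /\ qc (S n) <= qd (S n)) /\
     qb (S n) - qa (S n) = (qb n - qa n) / 2 /\ qd (S n) - qc (S n) = (qd n - qc n) / 2 /\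
     Cmod (J (qa n) (qb n) (qc n) (qd n)) <= 4 * Cmod (J (qa (S n)) (qb (S n)) (qc (S n)) (qd (S n))))%R).
  { intros n h1 h2. destruct (C1 (qa n) (qb n) (qc n) (qd n) h1) as (a' & b' & e1 & k1 & l1).
    destruct (C2 a' b' (qc n) (qd n) h2) as (c' & d' & e2 & k2 & l2).
    assert (E : Q (S n) = (a', b', c', d')).
    { unfold Q. simpl. fold (Q n). rewrite EQ, e1, e2. reflexivity. }
    assert (E1 : qa (S n) = a') by (unfold qa; now rewrite E).
    assert (E2 : qb (S n) = b') by (unfold qb; now rewrite E).
    assert (E3 : qc (S n) = c') by (unfold qc; now rewrite E).
    assert (E4 : qd (S n) = d') by (unfold qd; now rewrite E).
    rewrite E1, E2, E3, E4. repeat split; lra. }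
  assert (Inv : forall n, (qa n <= qb n /\ qc n <= qd n)%R).
  { induction n as [|n [h1 h2]].
    - unfold qa, qb, qc, qd; simpl. lra.
    - destruct (Step n h1 h2) as (k1 & k2 & _). lra. }
  destruct (nested_intervals_common_point qa qb) as [x Hxn].
  { intros n. destruct (Inv n) as [h1 h2]. destruct (Step n h1 h2) as (k1 & _). lra. }
  destruct (nested_intervals_common_point qc qd) as [y Hyn].
  { intros n. destruct (Inv n) as [h1 h2]. destruct (Step n h1 h2) as (_ & k1 & _). lra. }
  set (D := ((x2 - x1) + (y2 - y1))%R).
  assert (Size : forall n, (qb n - qa n = (x2 - x1) * (/ 2) ^ n /\ qd n - qc n = (y2 - y1) * (/ 2) ^ n /\
     Cmod (J x1 x2 y1 y2) <= 4 ^ n * Cmod (J (qa n) (qb n) (qc n) (qd n)) /\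
     x1 <= qa n /\ qb n <= x2 /\ y1 <= qc n /\ qd n <= y2)%R).
  { induction n as [|n (s1 & s2 & s3 & s4 & s5 & s6 & s7)].
    - unfold qa, qb, qc, qd; simpl. lra.
    - destruct (Inv n) as [h1 h2]. destruct (Step n h1 h2) as (k1 & k2 & k3 & k4 & k5).
      repeat split; try lra.
      + rewrite k3, s1. simpl. field.
      + rewrite k4, s2. simpl. field.
      + apply Rle_trans with (1 := s3). simpl.
        apply Rle_trans with (4 ^ n * (4 * Cmod (J (qa (S n)) (qb (S n)) (qc (S n)) (qd (S n)))))%R; [|lra].
        apply Rmult_le_compat_l; [apply pow_le; lra|exact k5]. }
  assert (Hx0 : (x1 <= x <= x2)%R) by (specialize (Hxn 0%nat); unfold qa, qb in Hxn; simpl in Hxn; lra).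
  assert (Hy0 : (y1 <= y <= y2)%R) by (specialize (Hyn 0%nat); unfold qc, qd in Hyn; simpl in Hyn; lra).
  assert (HD : (0 <= D)%R) by (unfold D; lra).
  (* After n rounds |J| is at least its original value divided by 4^n, whereas the local estimate
     gives at most eps D^2 / 4^n. This eps makes eps D^2 at most half of the original value. *)
  destruct (Hloc x y (Cmod (J x1 x2 y1 y2) / (2 * (D ^ 2 + 1)))%R Hx0 Hy0) as [del [Hdel K]].
  { apply Rdiv_lt_0_compat; [lra|]. nra. }
  assert (P2 : forall n, (0 < (/ 2) ^ n)%R) by (intros; apply pow_lt; lra).
  destruct (pow_lt_1_zero (/ 2)) with (y := (del / (D + 1))%R) as [n0 Hn0].
  { rewrite Rabs_pos_eq; lra. }
  { apply Rdiv_lt_0_compat; lra. }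
  specialize (Hn0 n0 (Nat.le_refl _)). rewrite Rabs_pos_eq in Hn0 by (left; apply P2).
  assert (Hs : (D * (/ 2) ^ n0 <= del)%R).
  { apply Rle_trans with ((D + 1) * (del / (D + 1)))%R.
    - apply Rmult_le_compat; [lra|left; apply P2|lra|lra].
    - right. field. lra. }
  destruct (Size n0) as (s1 & s2 & s3 & s4 & s5 & s6 & s7).
  specialize (Hxn n0). specialize (Hyn n0). specialize (P2 n0).
  assert (B1 : ((x2 - x1) * (/ 2) ^ n0 <= D * (/ 2) ^ n0)%R)
    by (apply Rmult_le_compat_r; unfold D; lra).
  assert (B2 : ((y2 - y1) * (/ 2) ^ n0 <= D * (/ 2) ^ n0)%R)
    by (apply Rmult_le_compat_r; unfold D; lra).
  specialize (K (qa n0) (qb n0) (qc n0) (qd n0) ltac:(lra) ltac:(lra) ltac:(lra) ltac:(lra) ltac:(lra) ltac:(lra)).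
  rewrite s1, s2 in K.
  replace ((x2 - x1) * (/ 2) ^ n0 + (y2 - y1) * (/ 2) ^ n0)%R with (D * (/ 2) ^ n0)%R in K by (unfold D; ring).
  assert (F : (Cmod (J x1 x2 y1 y2) <=
     4 ^ n0 * (Cmod (J x1 x2 y1 y2) / (2 * (D ^ 2 + 1)) * (D * (/ 2) ^ n0) ^ 2))%R).
  { apply Rle_trans with (1 := s3). apply Rmult_le_compat_l; [apply pow_le; lra|exact K]. }
  rewrite Rpow_mult_distr, <- pow_mult, Nat.mul_comm, pow_mult in F.
  replace ((/ 2) ^ 2)%R with (/ 4)%R in F by (simpl; field).
  replace (4 ^ n0 * (Cmod (J x1 x2 y1 y2) / (2 * (D ^ 2 + 1)) * (D ^ 2 * (/ 4) ^ n0)))%R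
    with ((4 * / 4) ^ n0 * (Cmod (J x1 x2 y1 y2) / (2 * (D ^ 2 + 1)) * D ^ 2))%R in F
    by (rewrite Rpow_mult_distr; ring).
  rewrite Rinv_r, pow1, Rmult_1_l in F by lra.
  assert (D2 : (0 <= D ^ 2)%R) by (apply pow_le; lra).
  assert (G : (Cmod (J x1 x2 y1 y2) / (2 * (D ^ 2 + 1)) * D ^ 2 <= Cmod (J x1 x2 y1 y2) / 2)%R).
  { apply (Rmult_le_reg_r (2 * (D ^ 2 + 1))); [lra|].
    replace (Cmod (J x1 x2 y1 y2) / (2 * (D ^ 2 + 1)) * D ^ 2 * (2 * (D ^ 2 + 1)))%R
      with (Cmod (J x1 x2 y1 y2) * D ^ 2)%R by (field; lra).
    nra. }
  lra.
Qed.

Section Rectangle.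

Variable k : R -> C.
Hypothesis k_cont : curve_cont k.

(* For u(x,t) = f(a + e^x (zeta(t) - a)) and k = i zeta / (zeta - a), this is the integral of
   f(w) dw / (w - a) along the image of the boundary of the rectangle. *)
Definition boundary_int (u : R -> R -> C) (a b c d : R) : C :=
  CInt (fun t => (u b t - u a t) * k t) c d - CInt (fun x => u x d - u x c) a b.

(** Continuity in each variable separately matches the integrals in [boundary_int], which run along
    horizontal and vertical sides only. *)
Definition sep_cont (u : R -> R -> C) : Prop :=
  (forall x, curve_cont (u x)) /\ (forall t, curve_cont (fun x => u x t)).

Lemma boundary_int_additive_x (u : R -> R -> C) (a b c d e : R) : sep_cont u ->
  boundary_int u a b d e + boundary_int u b c d e = boundary_int u a c d e.
Proof.
  intros [H1 H2]. unfold boundary_int.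
  assert (E1 : CInt (fun t => (u c t - u a t) * k t) d e =
    CInt (fun t => (u b t - u a t) * k t) d e + CInt (fun t => (u c t - u b t) * k t) d e).
  { rewrite <- CInt_plus by (apply curve_cont_mult; [apply curve_cont_minus|]; auto).
    apply CInt_ext. intros; ring. }
  rewrite E1, <- (CInt_Chasles (fun x => u x e - u x d) a b c) by (apply curve_cont_minus; auto).
  ring.
Qed.

Lemma boundary_int_additive_y (u : R -> R -> C) (a b c d e : R) : sep_cont u ->
  boundary_int u a b c d + boundary_int u a b d e = boundary_int u a b c e.
Proof.
  intros [H1 H2]. unfold boundary_int.
  assert (E1 : CInt (fun x => u x e - u x c) a b =
    CInt (fun x => u x d - u x c) a b + CInt (fun x => u x e - u x d) a b).
  { rewrite <- CInt_plus by (apply curve_cont_minus; auto).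
    apply CInt_ext. intros; ring. }
  rewrite E1, <- (CInt_Chasles (fun t => (u b t - u a t) * k t) c d e)
    by (apply curve_cont_mult; [apply curve_cont_minus|]; auto).
  ring.
Qed.

Lemma boundary_int_plus (u v : R -> R -> C) (a b c d : R) : sep_cont u -> sep_cont v ->
  boundary_int (fun x t => u x t + v x t) a b c d = boundary_int u a b c d + boundary_int v a b c d.
Proof.
  intros [H1 H2] [H3 H4]. unfold boundary_int.
  assert (E1 : CInt (fun t => (u b t + v b t - (u a t + v a t)) * k t) c d =
    CInt (fun t => (u b t - u a t) * k t) c d + CInt (fun t => (v b t - v a t) * k t) c d).
  { rewrite <- CInt_plus by (apply curve_cont_mult; [apply curve_cont_minus|]; auto).
    apply CInt_ext. intros; ring. }
  assert (E2 : CInt (fun x => u x d + v x d - (u x c + v x c)) a b =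
    CInt (fun x => u x d - u x c) a b + CInt (fun x => v x d - v x c) a b).
  { rewrite <- CInt_plus by (apply curve_cont_minus; auto).
    apply CInt_ext. intros; ring. }
  rewrite E1, E2. ring.
Qed.

Lemma boundary_int_bound (u : R -> R -> C) (a b c d K M : R) : sep_cont u ->
  (a <= b -> c <= d -> 0 <= M -> (forall t, c <= t <= d -> Cmod (k t) <= K) ->
  (forall x t, a <= x <= b -> c <= t <= d -> Cmod (u x t) <= M) ->
  Cmod (boundary_int u a b c d) <= (d - c) * (2 * M * K) + (b - a) * (2 * M))%R.
Proof.
  intros [H1 H2] Hab Hcd HM HK Hu. unfold boundary_int.
  eapply Rle_trans; [apply Cmod_triangle_minus|]. apply Rplus_le_compat.
  - apply CInt_bound; auto.
    + apply curve_cont_mult; [apply curve_cont_minus|]; auto.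
    + intros t Ht. rewrite Cmod_mult.
      apply Rmult_le_compat; try apply Cmod_ge_0; auto.
      eapply Rle_trans; [apply Cmod_triangle_minus|].
      pose proof (Hu b t ltac:(lra) Ht). pose proof (Hu a t ltac:(lra) Ht). lra.
  - apply CInt_bound; auto.
    + apply curve_cont_minus; auto.
    + intros x Hx. eapply Rle_trans; [apply Cmod_triangle_minus|].
      pose proof (Hu x d Hx ltac:(lra)). pose proof (Hu x c Hx ltac:(lra)). lra.
Qed.

End Rectangle.

Lemma exp_lipschitz_nonpos (x y : R) :
  (x <= 0 -> y <= 0 -> Rabs (exp y - exp x) <= Rabs (y - x))%R.
Proof.
  intros Hx Hy. rewrite <- (Rmult_1_l (Rabs (y - x))).
  apply Rabs_diff_le_of_derive with exp.
  - intros t _. auto_derive; [trivial|ring].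
  - intros t Ht. rewrite Rabs_pos_eq by (left; apply exp_pos).
    rewrite <- exp_0. destruct (Rle_lt_or_eq_dec t 0) as [h|h].
    + apply Rle_trans with (1 := proj2 Ht). now apply Rmax_lub.
    + left. now apply exp_increasing.
    + rewrite h. lra.
Qed.

Lemma curve_cont_exp : curve_cont (fun x => RtoC (exp x)).
Proof.
  intros x eps He.
  assert (H : continuity_pt exp x) by (apply derivable_continuous_pt, derivable_pt_exp).
  destruct (H eps He) as [d [Hd K]]. exists d. split; [exact Hd|]. intros y Hy.
  rewrite <- RtoC_minus, Cmod_R. destruct (Req_dec x y) as [->|hne].
  - rewrite Rminus_diag, Rabs_R0. exact He.
  - apply K. split; [|exact Hy]. split; [exact I|exact hne].
Qed.

Lemma Cmod_circle (r t : R) : (0 <= r)%R -> Cmod (RtoC r * cexp t) = r.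
Proof. intros Hr. rewrite Cmod_mult, Cmod_cexp, Cmod_R, Rabs_pos_eq; lra. Qed.

Lemma curve_cont_circle (r : R) : curve_cont (fun t => RtoC r * cexp t).
Proof. apply curve_cont_mult; [apply curve_cont_const|apply curve_cont_cexp]. Qed.

Lemma circle_sub_lower (a : C) (r t : R) : (Cmod a < r)%R ->
  (r - Cmod a <= Cmod (RtoC r * cexp t - a))%R.
Proof.
  intros Ha. pose proof (Cmod_ge_0 a). pose proof (Cmod_reverse_triangle (RtoC r * cexp t) a) as T.
  rewrite Cmod_circle in T; lra.
Qed.

Lemma circle_sub_neq_0 (a : C) (r t : R) : (Cmod a < r)%R -> RtoC r * cexp t - a <> 0.
Proof. intros Ha. apply Cmod_gt_0. pose proof (circle_sub_lower a r t Ha). lra. Qed.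

Lemma curve_cont_cauchy_kernel (a : C) (r : R) : (Cmod a < r)%R ->
  curve_cont (fun t => RtoC r * cexp t / (RtoC r * cexp t - a)).
Proof.
  intros Ha. apply curve_cont_mult; [apply curve_cont_circle|].
  apply curve_cont_inv; [|intros t; now apply circle_sub_neq_0].
  apply curve_cont_minus; [apply curve_cont_circle|apply curve_cont_const].
Qed.

Section Cauchy.

Variables (f : C -> C) (a : C) (r : R).
Hypothesis f_entire : entire f.
Hypothesis a_inside : (Cmod a < r)%R.

Let zeta (t : R) : C := RtoC r * cexp t.
Let ker (t : R) : C := Ci * (zeta t / (zeta t - a)).
(** Logarithmic polar coordinates around a: x = 0 is the given circle, and the curve shrinks to a as
    x tends to minus infinity. Since dw / (w - a) becomes dx + [ker t] dt, the singularity at a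
    disappears from the rectangle. *)
Let gam (x t : R) : C := a + RtoC (exp x) * (zeta t - a).

Let Cmod_zeta (t : R) : Cmod (zeta t) = r.
Proof. apply Cmod_circle. pose proof (Cmod_ge_0 a). lra. Qed.

Let zeta_sub_upper (t : R) : (Cmod (zeta t - a) <= 2 * r)%R.
Proof. pose proof (Cmod_triangle_minus (zeta t) a) as T. rewrite Cmod_zeta in T. lra. Qed.

Let zeta_sub_neq_0 (t : R) : zeta t - a <> 0.
Proof. now apply circle_sub_neq_0. Qed.

Let ker_cont : curve_cont ker.
Proof. apply curve_cont_mult; [apply curve_cont_const|now apply curve_cont_cauchy_kernel]. Qed.

Let ker_bound (t : R) : (Cmod (ker t) <= r / (r - Cmod a))%R.
Proof.
  unfold ker. rewrite Cmod_mult, Cmod_Ci, Rmult_1_l, Cmod_div, Cmod_zeta by apply zeta_sub_neq_0.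
  apply Rmult_le_compat_l; [pose proof (Cmod_ge_0 a); lra|].
  apply Rinv_le_contravar; [lra|now apply circle_sub_lower].
Qed.

Let gam_sep_cont : sep_cont gam.
Proof.
  split.
  - intros x. apply curve_cont_plus; [apply curve_cont_const|].
    apply curve_cont_mult; [apply curve_cont_const|].
    apply curve_cont_minus; [apply curve_cont_circle|apply curve_cont_const].
  - intros t. apply curve_cont_plus; [apply curve_cont_const|].
    apply curve_cont_mult; [apply curve_cont_exp|apply curve_cont_const].
Qed.

(** Goursat's argument subtracts the tangent of f, so affine functions must contribute nothing. Here
    this is a computation: both pairs of sides yield l (e^x2 - e^x1) (zeta t2 - zeta t1). *)
Let boundary_affine (l m : C) (x1 x2 t1 t2 : R) :
  boundary_int ker (fun x t => m + l * gam x t) x1 x2 t1 t2 = 0.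
Proof.
  unfold boundary_int.
  assert (E1 : CInt (fun t => (m + l * gam x2 t - (m + l * gam x1 t)) * ker t) t1 t2
    = l * RtoC (exp x2 - exp x1) * (zeta t2 - zeta t1)).
  { transitivity (CInt (fun t => l * RtoC (exp x2 - exp x1) * RtoC r * (Ci * RtoC 1 * cexp (1 * t))) t1 t2).
    - apply CInt_ext. intros t. unfold ker, gam. rewrite RtoC_minus, Rmult_1_l.
      change (zeta t) with (RtoC r * cexp t). field. apply zeta_sub_neq_0.
    - rewrite CInt_scal.
      + rewrite CInt_cexp, !Rmult_1_l. unfold zeta. ring.
      + apply curve_cont_mult; [apply curve_cont_const|].
        intros s eps He. destruct (curve_cont_cexp s eps He) as [d [Hd K]].
        exists d; split; [exact Hd|]. intros y Hy. rewrite !Rmult_1_l. now apply K. }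
  assert (E2 : CInt (fun x => m + l * gam x t2 - (m + l * gam x t1)) x1 x2
    = l * (zeta t2 - zeta t1) * RtoC (exp x2 - exp x1)).
  { rewrite <- CInt_exp, <- CInt_scal by apply curve_cont_exp.
    apply CInt_ext. intros x. unfold gam. ring. }
  rewrite E1, E2. ring.
Qed.

Let gam_lipschitz (x y s t : R) : (x <= 0 -> y <= 0 ->
  Cmod (gam y t - gam x s) <= 2 * r * (Rabs (y - x) + Rabs (t - s)))%R.
Proof.
  intros Hx Hy. unfold gam.
  replace (a + RtoC (exp y) * (zeta t - a) - (a + RtoC (exp x) * (zeta s - a)))
    with (RtoC (exp y - exp x) * (zeta t - a) + RtoC (exp x) * (RtoC r * (cexp t - cexp s)))
    by (unfold zeta; rewrite RtoC_minus; ring).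
  eapply Rle_trans; [apply Cmod_triangle|]. rewrite !Cmod_mult, !Cmod_R.
  pose proof (exp_lipschitz_nonpos x y Hx Hy) as L1. pose proof (cexp_lipschitz s t) as L2.
  pose proof (zeta_sub_upper t) as L3. pose proof (Cmod_ge_0 a).
  assert (L4 : (Rabs (exp x) <= 1)%R).
  { rewrite Rabs_pos_eq by (left; apply exp_pos). rewrite <- exp_0.
    destruct Hx as [h| ->]; [left; now apply exp_increasing|lra]. }
  rewrite (Rabs_pos_eq r) by lra.
  assert (M1 : (Rabs (exp y - exp x) * Cmod (zeta t - a) <= Rabs (y - x) * (2 * r))%R)
    by (apply Rmult_le_compat; auto using Rabs_pos, Cmod_ge_0).
  assert (M2 : (Rabs (exp x) * (r * Cmod (cexp t - cexp s)) <= 1 * (r * (2 * Rabs (t - s))))%R).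
  { apply Rmult_le_compat; auto using Rabs_pos.
    - apply Rmult_le_pos; [lra|apply Cmod_ge_0].
    - apply Rmult_le_compat_l; lra. }
  lra.
Qed.

Let f_gam_sep_cont : sep_cont (fun x t => f (gam x t)).
Proof.
  destruct gam_sep_cont as [H1 H2]. pose proof (entire_cont f f_entire) as Hf.
  split; intros; apply curve_cont_comp; auto.
Qed.

Let boundary_f_eq_0 (L : R) : (0 <= L)%R ->
  boundary_int ker (fun x t => f (gam x t)) (- L) 0 0 (2 * PI) = 0.
Proof.
  intros HL. pose proof PI_RGT_0 as Hpi. pose proof (Cmod_ge_0 a) as Ha0.
  apply (additive_rectangle_function_eq_0 (boundary_int ker (fun x t => f (gam x t)))); try lra.
  - intros. apply boundary_int_additive_x; auto.
  - intros. apply boundary_int_additive_y; auto.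
  - intros x y eps Hx Hy He.
    destruct (proj1 (entire_cderiv f) f_entire (gam x y)) as [l Hl].
    set (K := (r / (r - Cmod a))%R).
    assert (HK : (0 < K)%R) by (apply Rdiv_lt_0_compat; lra).
    (* The deviation of f from its tangent on the small rectangle is at most e * 2 r D, and the
       boundary integral multiplies such a bound by at most 2 (K + 1) D. This e turns the product
       into eps D^2. *)
    set (e := (eps / (4 * r * (K + 1)))%R).
    assert (Hr : (0 < 4 * r * (K + 1))%R) by (repeat apply Rmult_lt_0_compat; lra).
    assert (He' : (0 < e)%R) by (apply Rdiv_lt_0_compat; lra).
    destruct (Hl e He') as [d [Hd Kd]].
    exists (d / (8 * r))%R. split; [apply Rdiv_lt_0_compat; lra|].
    intros u v c w Hu Hv Hc Hw Huv Hcw.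
    set (E := fun s t => f (gam s t) - f (gam x y) - l * (gam s t - gam x y)).
    set (A0 := fun s t => (f (gam x y) - l * gam x y) + l * gam s t).
    assert (SA : sep_cont A0).
    { destruct gam_sep_cont as [H1 H2]. unfold A0. split; intros; apply curve_cont_plus;
        try apply curve_cont_const; apply curve_cont_mult; auto using curve_cont_const. }
    assert (SE : sep_cont E).
    { destruct gam_sep_cont as [H1 H2]. destruct f_gam_sep_cont as [H3 H4].
      unfold E. split; intros; apply curve_cont_minus.
      - apply curve_cont_minus; auto using curve_cont_const.
      - apply curve_cont_mult; [apply curve_cont_const|].
        apply curve_cont_minus; auto using curve_cont_const.
      - apply curve_cont_minus; [apply (H4 t)|apply curve_cont_const].
      - apply curve_cont_mult; [apply curve_cont_const|].
        apply curve_cont_minus; [apply (H2 t)|apply curve_cont_const]. }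
    assert (Eq : boundary_int ker (fun s t => f (gam s t)) u v c w = boundary_int ker E u v c w).
    { transitivity (boundary_int ker (fun s t => E s t + A0 s t) u v c w).
      - unfold boundary_int, E, A0. f_equal; apply CInt_ext; intros; ring.
      - rewrite boundary_int_plus by auto. unfold A0 at 1. rewrite boundary_affine. ring. }
    rewrite Eq. set (D := ((v - u) + (w - c))%R).
    assert (HD : (0 <= D)%R) by (unfold D; lra).
    assert (HM : (0 <= e * (2 * r * D))%R) by (apply Rmult_le_pos; [lra|]; apply Rmult_le_pos; lra).
    assert (Bd : forall s t, (u <= s <= v -> c <= t <= w -> Cmod (E s t) <= e * (2 * r * D))%R).
    { intros s t Hs Ht. unfold E.
      assert (G : (Cmod (gam s t - gam x y) <= 2 * r * D)%R).
      { eapply Rle_trans; [apply gam_lipschitz; lra|]. apply Rmult_le_compat_l; [lra|].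
        assert (Rabs (s - x) <= v - u)%R by (apply Rabs_le; lra).
        assert (Rabs (t - y) <= w - c)%R by (apply Rabs_le; lra).
        unfold D; lra. }
      apply Rle_trans with (e * Cmod (gam s t - gam x y))%R.
      - apply Kd. apply Rle_lt_trans with (1 := G).
        apply Rle_lt_trans with (2 * r * (d / (8 * r) + d / (8 * r)))%R.
        + apply Rmult_le_compat_l; unfold D; lra.
        + replace (2 * r * (d / (8 * r) + d / (8 * r)))%R with (d / 2)%R by (field; lra). lra.
      - apply Rmult_le_compat_l; lra. }
    eapply Rle_trans.
    { apply (boundary_int_bound ker ker_cont E u v c w K (e * (2 * r * D))); auto; lra. }
    fold D.
    apply Rle_trans with (e * (4 * r * (K + 1)) * D ^ 2)%R.
    + set (M := (e * (2 * r * D))%R) in *.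
      replace (e * (4 * r * (K + 1)) * D ^ 2)%R with (D * (2 * M * K) + D * (2 * M))%R by (unfold M; ring).
      assert (HMK : (0 <= 2 * M * K)%R) by (apply Rmult_le_pos; lra).
      apply Rplus_le_compat; apply Rmult_le_compat_r; unfold D; lra.
    + unfold e. right. field. lra.
Qed.

(** Shrinking the circle towards a leaves the integral of f(w) dw / (w - a) unchanged, and on tiny
    circles f is nearly f a. The value of [CInt ker] is left open here and follows from
    [kernel_mean]. *)
Lemma cauchy_integral_formula :
  CInt (fun t => f (zeta t) * ker t) 0 (2 * PI) = f a * CInt ker 0 (2 * PI).
Proof.
  pose proof PI_RGT_0 as Hpi. pose proof (Cmod_ge_0 a) as Ha0.
  pose proof (entire_cont f f_entire) as Hf.
  assert (fz : curve_cont (fun t => f (zeta t))) by (apply curve_cont_comp; [exact Hf|apply curve_cont_circle]).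
  set (K := (r / (r - Cmod a))%R).
  assert (HK : (0 < K)%R) by (apply Rdiv_lt_0_compat; lra).
  assert (Z : CInt (fun t => (f (zeta t) - f a) * ker t) 0 (2 * PI) = 0).
  { apply Cmod_le_0.
    apply le_epsilon. intros eps He. rewrite Rplus_0_l.
    destruct (Hf a (eps / (2 * PI * K))%R) as [d [Hd Kd]].
    { apply Rdiv_lt_0_compat; [lra|]. apply Rmult_lt_0_compat; lra. }
    (* With e^(-L) <= d / (4 r) and |zeta t - a| <= 2 r, the inner curve lies within d/2 of a. *)
    set (L := Rmax 0 (- ln (d / (4 * r)))).
    assert (HL : (0 <= L)%R) by apply Rmax_l.
    assert (HeL : (exp (- L) <= d / (4 * r))%R).
    { rewrite <- (exp_ln (d / (4 * r))) by (apply Rdiv_lt_0_compat; lra).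
      assert (hh : (- L <= ln (d / (4 * r)))%R).
      { pose proof (Rmax_r 0 (- ln (d / (4 * r)))). fold L in H. lra. }
      destruct hh as [h|h]; [left; now apply exp_increasing|rewrite h; lra]. }
    pose proof (boundary_f_eq_0 L HL) as B0. unfold boundary_int in B0.
    (* The sides t = 0 and t = 2 pi of the rectangle have the same image, so they cancel. *)
    assert (P : CInt (fun x => f (gam x (2 * PI)) - f (gam x 0)) (- L) 0 = 0).
    { transitivity (CInt (fun _ => 0) (- L) 0).
      - apply CInt_ext. intros x. unfold gam, zeta, cexp.
        rewrite cos_2PI, sin_2PI, cos_0, sin_0. ring.
      - rewrite CInt_const. ring. }
    rewrite P in B0.
    destruct f_gam_sep_cont as [S1 S2].
    assert (Sp : CInt (fun t => (f (zeta t) - f a) * ker t) 0 (2 * PI)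
      = CInt (fun t => (f (gam (- L) t) - f a) * ker t) 0 (2 * PI)).
    { assert (B1 : CInt (fun t => (f (gam 0 t) - f (gam (- L) t)) * ker t) 0 (2 * PI) = 0)
        by (rewrite <- B0; ring).
      rewrite <- (Cplus_0_l (CInt (fun t => (f (gam (- L) t) - f a) * ker t) 0 (2 * PI))), <- B1.
      rewrite <- CInt_plus.
      - apply CInt_ext. intros t. unfold gam at 1. rewrite exp_0.
        replace (a + 1 * (zeta t - a)) with (zeta t) by ring. ring.
      - apply curve_cont_mult; [apply curve_cont_minus; auto|auto].
      - apply curve_cont_mult; [apply curve_cont_minus; auto using curve_cont_const|auto]. }
    rewrite Sp.
    eapply Rle_trans.
    - apply CInt_bound with (M := (eps / (2 * PI * K) * K)%R); [| lra |].
      + apply curve_cont_mult; [apply curve_cont_minus; auto using curve_cont_const|auto].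
      + intros t _. rewrite Cmod_mult.
        apply Rmult_le_compat; [apply Cmod_ge_0|apply Cmod_ge_0| |apply ker_bound].
        * left. apply Kd. unfold gam.
          replace (a + RtoC (exp (- L)) * (zeta t - a) - a) with (RtoC (exp (- L)) * (zeta t - a)) by ring.
          rewrite Cmod_mult, Cmod_R, Rabs_pos_eq by (left; apply exp_pos).
          apply Rle_lt_trans with (d / (4 * r) * (2 * r))%R.
          { apply Rmult_le_compat; auto using Cmod_ge_0. left; apply exp_pos. }
          replace (d / (4 * r) * (2 * r))%R with (d / 2)%R by (field; lra). lra.
    - right. field. lra. }
  transitivity (CInt (fun t => (f (zeta t) - f a) * ker t + f a * ker t) 0 (2 * PI)).
  - apply CInt_ext. intros; ring.
  - rewrite CInt_plus, Z, CInt_scal; auto.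
    + ring.
    + apply curve_cont_mult; [apply curve_cont_minus; auto using curve_cont_const|auto].
    + apply curve_cont_mult; auto using curve_cont_const.
Qed.

End Cauchy.

(** * Finite sums and the expansion of the Cauchy kernel *)

Fixpoint csum (a : nat -> C) (n : nat) : C :=
  match n with O => 0 | S m => csum a m + a m end.

Notation psum a z := (csum (fun k => a k * z ^ k)%C).

Lemma csum_ext (a b : nat -> C) (n : nat) :
  (forall k, (k < n)%nat -> a k = b k) -> csum a n = csum b n.
Proof.
  induction n as [|n IH]; intros H; [reflexivity|]. simpl. f_equal; [apply IH|apply H]; intros; auto.
Qed.

Lemma csum_scal (c : C) (a : nat -> C) (n : nat) : csum (fun k => c * a k) n = c * csum a n.
Proof. induction n as [|n IH]; simpl; [ring|]. rewrite IH. ring. Qed.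

Lemma csum_minus (a b : nat -> C) (n : nat) : csum (fun k => a k - b k) n = csum a n - csum b n.
Proof. induction n as [|n IH]; simpl; [ring|]. rewrite IH. ring. Qed.

Lemma csum_zero (a : nat -> C) (n : nat) : (forall k, (k < n)%nat -> a k = 0) -> csum a n = 0.
Proof.
  induction n as [|n IH]; intros H; [reflexivity|]. simpl.
  rewrite IH by (intros; apply H; lia). rewrite H by lia. ring.
Qed.

Lemma csum_shift (a : nat -> C) (n : nat) : csum a (S n) = a 0%nat + csum (fun k => a (S k)) n.
Proof. induction n as [|n IH]; [simpl; ring|].
  change (csum a (S (S n))) with (csum a (S n) + a (S n)). rewrite IH. simpl. ring. Qed.

Fixpoint rsum (a : nat -> R) (n : nat) : R :=
  match n with O => 0%R | S m => (rsum a m + a m)%R end.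

Lemma Cmod_csum_le (a : nat -> C) (b : nat -> R) (n : nat) :
  (forall k, (k < n)%nat -> (Cmod (a k) <= b k)%R) -> (Cmod (csum a n) <= rsum b n)%R.
Proof.
  induction n as [|n IH]; intros H; simpl; [rewrite Cmod_0; lra|].
  eapply Rle_trans; [apply Cmod_triangle|]. apply Rplus_le_compat; [apply IH|apply H]; intros; auto.
Qed.

Lemma rsum_le (a b : nat -> R) (n : nat) :
  (forall k, (k < n)%nat -> (a k <= b k)%R) -> (rsum a n <= rsum b n)%R.
Proof.
  induction n as [|n IH]; intros H; simpl; [lra|].
  apply Rplus_le_compat; [apply IH|apply H]; intros; auto.
Qed.

Lemma rsum_const (c : R) (n : nat) : rsum (fun _ => c) n = (INR n * c)%R.
Proof. induction n as [|n IH]; simpl rsum; [simpl; ring|]. rewrite IH, S_INR. ring. Qed.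

Lemma rsum_le_const (u : nat -> R) (M : R) (n : nat) :
  (forall k, (k < n)%nat -> (u k <= M)%R) -> (rsum u n <= INR n * M)%R.
Proof. intros H. rewrite <- rsum_const. now apply rsum_le. Qed.

Lemma rsum_scal (c : R) (u : nat -> R) (n : nat) : rsum (fun k => c * u k)%R n = (c * rsum u n)%R.
Proof. induction n as [|n IH]; simpl; [ring|]. rewrite IH. ring. Qed.

Lemma rsum_nonneg (u : nat -> R) (n : nat) : (forall k, 0 <= u k)%R -> (0 <= rsum u n)%R.
Proof. intros H. induction n as [|n IH]; simpl; [lra|]. specialize (H n). lra. Qed.

Lemma Cmod_csum_le_const (a : nat -> C) (M : R) (n : nat) :
  (forall k, (k < n)%nat -> (Cmod (a k) <= M)%R) -> (Cmod (csum a n) <= INR n * M)%R.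
Proof. intros H. rewrite <- rsum_const. now apply Cmod_csum_le. Qed.

Lemma CInt_csum (phi : nat -> R -> C) (n : nat) (a b : R) : (forall k, curve_cont (phi k)) ->
  CInt (fun t => csum (fun k => phi k t) n) a b = csum (fun k => CInt (phi k) a b) n.
Proof.
  intros H. assert (Hc : forall m, curve_cont (fun t => csum (fun k => phi k t) m)).
  { induction m as [|m IH]; simpl; [apply curve_cont_const|now apply curve_cont_plus]. }
  induction n as [|n IH]; simpl.
  - rewrite CInt_const. ring.
  - rewrite CInt_plus by auto. now rewrite IH.
Qed.

Lemma curve_cont_pow (phi : R -> C) (n : nat) : curve_cont phi -> curve_cont (fun t => phi t ^ n).
Proof.
  intros H. induction n as [|n IH]; simpl; [apply curve_cont_const|now apply curve_cont_mult].
Qed.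

Lemma le_0_of_le_geom (x M q : R) :
  (0 <= q < 1 -> (forall N : nat, x <= M * q ^ N) -> x <= 0)%R.
Proof.
  intros Hq H. apply le_epsilon. intros eps He. rewrite Rplus_0_l.
  destruct (pow_lt_1_zero q) with (y := (eps / (Rabs M + 1))%R) as [n Hn].
  - rewrite Rabs_pos_eq; lra.
  - apply Rdiv_lt_0_compat; [lra|]. pose proof (Rabs_pos M); lra.
  - specialize (Hn n (Nat.le_refl _)). specialize (H n).
    apply Rle_trans with (1 := H). pose proof (Rabs_pos M) as HM.
    apply Rle_trans with ((Rabs M + 1) * (eps / (Rabs M + 1)))%R.
    + apply Rle_trans with (Rabs M * Rabs (q ^ n))%R.
      * rewrite <- Rabs_mult. apply Rle_abs.
      * apply Rmult_le_compat; try lra; apply Rabs_pos.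
    + right. field. lra.
Qed.

Lemma geometric_kernel (a z : C) (N : nat) : z <> 0 -> z - a <> 0 ->
  z / (z - a) = csum (fun k => a ^ k * (/ z) ^ k) N + a ^ N * (/ z) ^ N * (z / (z - a)).
Proof.
  intros Hz Hza. induction N as [|N IH]; [simpl; field; auto|].
  rewrite IH at 1. simpl csum. rewrite !Cpow_S.
  field. auto.
Qed.

(** The gauge at (u, v) is taken at most 1 / (1 + |f (u, v)|). The positive lower bound d that
    compactness provides for the gauge at suitable points then says |f| + 1 <= 1/d at these points,
    and f varies by less than 1 from there. *)
Lemma entire_bounded_on_square (f : C -> C) (M : R) : pointwise_cont f ->
  exists B, (0 < B)%R /\ forall z, (Rabs (fst z) <= M -> Rabs (snd z) <= M -> Cmod (f z) <= B)%R.
Proof.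
  intros Hf.
  assert (Hd : forall u v : R, exists d : posreal, (d <= / (1 + Cmod (f (u, v))))%R /\
     forall w, (Cmod (w - (u, v)) < 2 * d -> Cmod (f w - f (u, v)) < 1)%R).
  { intros u v. destruct (Hf (u, v) 1%R Rlt_0_1) as [d [Hd K]].
    pose proof (Cmod_ge_0 (f (u, v))) as Hp.
    assert (H0 : (0 < Rmin (d / 2) (/ (1 + Cmod (f (u, v)))))%R).
    { apply Rmin_glb_lt; [lra|]. apply Rinv_0_lt_compat. lra. }
    exists (mkposreal _ H0). simpl. split; [apply Rmin_r|].
    intros w Hw. apply K. pose proof (Rmin_l (d / 2) (/ (1 + Cmod (f (u, v))))). lra. }
  set (delta := fun u v => proj1_sig (constructive_indefinite_description _ (Hd u v))).
  assert (Hdel : forall u v, (delta u v <= / (1 + Cmod (f (u, v))))%R /\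
     forall w, (Cmod (w - (u, v)) < 2 * delta u v -> Cmod (f w - f (u, v)) < 1)%R).
  { intros u v. unfold delta. apply (proj2_sig (constructive_indefinite_description _ (Hd u v))). }
  destruct (compactness_value_2d (- M) M (- M) M delta) as [d K].
  exists (/ d + 1)%R. pose proof (cond_pos d) as Hdp. pose proof (Rinv_0_lt_compat _ Hdp).
  split; [lra|]. intros [x y] Hx Hy. simpl in Hx, Hy.
  apply Rabs_le_between in Hx. apply Rabs_le_between in Hy.
  apply Rnot_lt_le. intros Hlt. apply (K x y Hx Hy).
  intros (u & v & Hu & Hv & H1 & H2 & H3).
  destruct (Hdel u v) as [D1 D2].
  assert (E : (Cmod ((x, y) - (u, v)) < 2 * delta u v)%R).
  { replace ((x, y) - (u, v)) with (RtoC (x - u) + Ci * RtoC (y - v)).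
    - eapply Rle_lt_trans; [apply Cmod_triangle|]. rewrite Cmod_mult, Cmod_Ci, !Cmod_R. lra.
    - unfold Cminus, Cplus, Copp, Cmult, Ci, RtoC; simpl. f_equal; ring. }
  specialize (D2 _ E).
  pose proof (Cmod_reverse_triangle (f (x, y)) (f (u, v))) as T.
  assert (F : (1 + Cmod (f (u, v)) <= / d)%R).
  { pose proof (Cmod_ge_0 (f (u, v))).
    rewrite <- (Rinv_inv (1 + Cmod (f (u, v)))). apply Rinv_le_contravar; [exact Hdp|lra]. }
  lra.
Qed.

Lemma entire_bounded_on_disc (f : C -> C) (M : R) : entire f ->
  exists B, (0 < B)%R /\ forall z, (Cmod z <= M -> Cmod (f z) <= B)%R.
Proof.
  intros Hf. destruct (entire_bounded_on_square f M (entire_cont f Hf)) as [B [HB K]].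
  exists B. split; [exact HB|]. intros z Hz. pose proof (Rmax_Cmod z) as T.
  pose proof (Rmax_l (Rabs (fst z)) (Rabs (snd z))). pose proof (Rmax_r (Rabs (fst z)) (Rabs (snd z))).
  apply K; lra.
Qed.

(** This is the integral of f(w) w^(-k-1) dw / (2 pi i) over |w| = r. A priori it depends on r; for
    entire f the independence comes from the uniqueness of expansions at 0. *)
Definition circle_coef (f : C -> C) (r : R) (k : nat) : C :=
  / RtoC (2 * PI) * CInt (fun t => f (RtoC r * cexp t) * (/ (RtoC r * cexp t)) ^ k) 0 (2 * PI).

Lemma two_PI_neq_0 : RtoC (2 * PI) <> 0.
Proof. apply RtoC_neq_0. pose proof PI_RGT_0. lra. Qed.

Lemma curve_cont_circle_coef (f : C -> C) (r : R) (k : nat) : pointwise_cont f -> (0 < r)%R ->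
  curve_cont (fun t => f (RtoC r * cexp t) * (/ (RtoC r * cexp t)) ^ k).
Proof.
  intros Hf Hr. pose proof (curve_cont_circle r) as Hz.
  apply curve_cont_mult; [now apply curve_cont_comp|]. apply curve_cont_pow, curve_cont_inv; [exact Hz|].
  intros x. apply Cmod_gt_0. rewrite Cmod_circle; lra.
Qed.

Lemma circle_coef_bound (f : C -> C) (r B : R) (k : nat) : pointwise_cont f -> (0 < r)%R ->
  (forall z, Cmod z = r -> (Cmod (f z) <= B)%R) -> (Cmod (circle_coef f r k) * r ^ k <= B)%R.
Proof.
  intros Hf Hr HB. pose proof PI_RGT_0 as Hpi. unfold circle_coef.
  pose proof (pow_lt r k Hr) as Hrk.
  rewrite Cmod_mult, Cmod_inv, Cmod_R, Rabs_pos_eq by (apply two_PI_neq_0 || lra).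
  assert (H : (Cmod (CInt (fun t => f (RtoC r * cexp t) * (/ (RtoC r * cexp t)) ^ k)%C 0 (2 * PI))
     <= (2 * PI - 0) * (B * / r ^ k))%R).
  { apply CInt_bound; [now apply curve_cont_circle_coef|lra|].
    intros t _. rewrite Cmod_mult, Cmod_pow, Cmod_inv.
    - rewrite Cmod_circle by lra. rewrite pow_inv. apply Rmult_le_compat_r.
      + left. now apply Rinv_0_lt_compat.
      + apply HB, Cmod_circle. lra.
    - apply Cmod_gt_0. rewrite Cmod_circle; lra. }
  apply Rle_trans with (/ (2 * PI) * ((2 * PI - 0) * (B * / r ^ k)) * r ^ k)%R.
  - apply Rmult_le_compat_r; [lra|]. apply Rmult_le_compat_l; [|exact H].
    left. apply Rinv_0_lt_compat. lra.
  - right. field. lra.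
Qed.

(** The geometric expansion of w / (w - a) in powers of a / w, integrated against f. It is applied
    to the constant 1, to find the mean of the kernel, and then to f itself. *)
Lemma kernel_expansion (f : C -> C) (r B : R) (a : C) (N : nat) :
  pointwise_cont f -> (Cmod a < r)%R -> (forall z, Cmod z = r -> (Cmod (f z) <= B)%R) ->
  (Cmod (/ RtoC (2 * PI) * CInt (fun t => f (RtoC r * cexp t) * (RtoC r * cexp t / (RtoC r * cexp t - a)))%C 0 (2 * PI)
        - psum (circle_coef f r) a N) <= B * (r / (r - Cmod a)) * (Cmod a / r) ^ N)%R.
Proof.
  intros Hf Ha HB. pose proof PI_RGT_0 as Hpi. pose proof (Cmod_ge_0 a) as Ha0.
  assert (Hr : (0 < r)%R) by lra.
  assert (B0 : (0 <= B)%R).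
  { eapply Rle_trans; [apply Cmod_ge_0|]. apply (HB (RtoC r)). rewrite Cmod_R, Rabs_pos_eq; lra. }
  assert (Z0 : forall t, RtoC r * cexp t <> 0) by (intros t; apply Cmod_gt_0; rewrite Cmod_circle; lra).
  pose proof (fun t => circle_sub_neq_0 a r t Ha) as Za0.
  pose proof (curve_cont_cauchy_kernel a r Ha) as Hk.
  set (phi := fun k t => f (RtoC r * cexp t) * (/ (RtoC r * cexp t)) ^ k).
  assert (Hphi : forall k, curve_cont (phi k)) by (intros; now apply curve_cont_circle_coef).
  set (rem := fun t => a ^ N * phi N t * (RtoC r * cexp t / (RtoC r * cexp t - a))).
  assert (Hrem : curve_cont rem).
  { apply curve_cont_mult; [apply curve_cont_mult; auto using curve_cont_const|exact Hk]. }
  assert (E : CInt (fun t => f (RtoC r * cexp t) * (RtoC r * cexp t / (RtoC r * cexp t - a))) 0 (2 * PI)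
    = csum (fun k => a ^ k * CInt (phi k) 0 (2 * PI)) N + CInt rem 0 (2 * PI)).
  { transitivity (CInt (fun t => csum (fun k => a ^ k * phi k t) N + rem t) 0 (2 * PI)).
    - apply CInt_ext. intros t. rewrite (geometric_kernel a _ N (Z0 t) (Za0 t)).
      rewrite Cmult_plus_distr_l, <- csum_scal. f_equal.
      + apply csum_ext. intros k _. unfold phi. ring.
      + unfold rem, phi. ring.
    - rewrite CInt_plus.
      + f_equal. rewrite (CInt_csum (fun k t => a ^ k * phi k t)).
        * apply csum_ext. intros k _. now apply CInt_scal.
        * intros k. apply curve_cont_mult; auto using curve_cont_const.
      + clear -Hphi. induction N as [|N IH]; simpl; [apply curve_cont_const|].
        apply curve_cont_plus; [exact IH|]. apply curve_cont_mult; auto using curve_cont_const.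
      + exact Hrem. }
  rewrite E.
  replace (/ RtoC (2 * PI) * (csum (fun k => a ^ k * CInt (phi k) 0 (2 * PI)) N + CInt rem 0 (2 * PI))
     - psum (circle_coef f r) a N) with (/ RtoC (2 * PI) * CInt rem 0 (2 * PI)).
  2:{ rewrite Cmult_plus_distr_l, <- csum_scal.
      rewrite (csum_ext (fun k => circle_coef f r k * a ^ k)
        (fun k => / RtoC (2 * PI) * (a ^ k * CInt (phi k) 0 (2 * PI)))); [ring|].
      intros k _. unfold circle_coef. fold (phi k). ring. }
  rewrite Cmod_mult, Cmod_inv, Cmod_R, Rabs_pos_eq by (apply two_PI_neq_0 || lra).
  pose proof (pow_lt r N Hr) as HrN.
  apply Rle_trans with (/ (2 * PI) * ((2 * PI - 0) * (Cmod a ^ N * (B * / r ^ N) * (r / (r - Cmod a)))))%R.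
  - apply Rmult_le_compat_l; [left; apply Rinv_0_lt_compat; lra|].
    apply CInt_bound; [exact Hrem|lra|]. intros t _. unfold rem, phi.
    rewrite !Cmod_mult, Cmod_pow, Cmod_div by auto.
    rewrite Cmod_pow, Cmod_inv, Cmod_circle, pow_inv by (auto || lra).
    assert (Q1 : (0 <= / r ^ N)%R) by (left; now apply Rinv_0_lt_compat).
    assert (Q2 : (0 <= Cmod a ^ N)%R) by now apply pow_le.
    apply Rmult_le_compat.
    + apply Rmult_le_pos; [exact Q2|]. apply Rmult_le_pos; [apply Cmod_ge_0|exact Q1].
    + rewrite <- (Cmod_circle r t) at 1 by lra. rewrite <- Cmod_div by auto. apply Cmod_ge_0.
    + apply Rmult_le_compat_l; [exact Q2|]. apply Rmult_le_compat_r; [exact Q1|].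
      apply HB, Cmod_circle. lra.
    + apply Rmult_le_compat_l; [lra|]. apply Rinv_le_contravar; [lra|now apply circle_sub_lower].
  - right. unfold Rdiv at 3. rewrite Rpow_mult_distr, pow_inv. field. lra.
Qed.

Lemma circle_coef_one (r : R) (k : nat) : (0 < r)%R ->
  circle_coef (fun _ => 1) r k = if Nat.eqb k 0 then 1 else 0.
Proof.
  intros Hr. unfold circle_coef. destruct k as [|k]; simpl Nat.eqb; cbv iota.
  - transitivity (/ RtoC (2 * PI) * CInt (fun _ => 1) 0 (2 * PI)).
    + f_equal. apply CInt_ext. intros t. simpl. ring.
    + rewrite CInt_const. rewrite Rminus_0_r. field. apply two_PI_neq_0.
  - set (m := (- INR (S k))%R).
    assert (Hm : RtoC m <> 0).
    { apply RtoC_neq_0. unfold m. pose proof (lt_0_INR (S k) (Nat.lt_0_succ k)). lra. }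
    pose proof Ci_nz as HCi.
    assert (Hr0 : RtoC r <> 0) by (apply RtoC_neq_0; lra).
    transitivity (/ RtoC (2 * PI) * ((/ RtoC r) ^ (S k) * / (Ci * RtoC m) *
        CInt (fun t => Ci * RtoC m * cexp (m * t)) 0 (2 * PI))).
    + f_equal. rewrite <- CInt_scal.
      * apply CInt_ext. intros t.
        replace (/ (RtoC r * cexp t)) with (/ RtoC r * cexp (- t))
          by (rewrite cexp_opp; field; split; [apply cexp_neq_0|exact Hr0]).
        rewrite Cpow_mult_l, cexp_pow. replace (INR (S k) * - t)%R with (m * t)%R by (unfold m; ring).
        field. auto.
      * apply curve_cont_mult; [apply curve_cont_const|].
        intros s eps He. destruct (curve_cont_cexp (m * s)%R eps He) as [d [Hd K]].
        pose proof (Rabs_pos m) as Hm0.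
        exists (d / (Rabs m + 1))%R. split; [apply Rdiv_lt_0_compat; lra|].
        intros y Hy. apply K. rewrite <- Rmult_minus_distr_l, Rabs_mult.
        apply Rle_lt_trans with ((Rabs m + 1) * Rabs (y - s))%R.
        { apply Rmult_le_compat_r; [apply Rabs_pos|lra]. }
        apply Rlt_le_trans with ((Rabs m + 1) * (d / (Rabs m + 1)))%R.
        { apply Rmult_lt_compat_l; lra. }
        right. field. lra.
    + rewrite CInt_cexp. unfold m. rewrite !Ropp_mult_distr_l_reverse, !cexp_opp, <- !cexp_pow.
      replace (cexp (2 * PI)) with (cexp 0)
        by (unfold cexp; rewrite cos_2PI, sin_2PI, cos_0, sin_0; reflexivity).
      ring.
Qed.

Lemma csum_delta (x : C) (N : nat) : csum (fun k => (if Nat.eqb k 0 then 1 else 0) * x ^ k) (S N) = 1.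
Proof. rewrite csum_shift. rewrite csum_zero; [simpl; ring|]. intros; simpl; ring. Qed.

Lemma pointwise_cont_const (c : C) : pointwise_cont (fun _ => c).
Proof.
  intros z eps He. exists 1%R. split; [lra|]. intros w _.
  replace (c - c) with (RtoC 0) by ring. rewrite Cmod_0. exact He.
Qed.

(** For the constant function 1 only the coefficient of index 0 survives, and the remainder of the
    kernel expansion tends to 0 geometrically. *)
Lemma kernel_mean (r : R) (a : C) : (Cmod a < r)%R ->
  / RtoC (2 * PI) * CInt (fun t => RtoC r * cexp t / (RtoC r * cexp t - a)) 0 (2 * PI) = 1.
Proof.
  intros Ha. pose proof (Cmod_ge_0 a) as Ha0.
  set (I := / RtoC (2 * PI) * CInt (fun t => RtoC r * cexp t / (RtoC r * cexp t - a)) 0 (2 * PI)).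
  assert (H : (Cmod (I - 1) <= 0)%R).
  { apply le_0_of_le_geom with (M := (r / (r - Cmod a) * (Cmod a / r))%R) (q := (Cmod a / r)%R).
    - split; [apply Rdiv_le_0_compat; lra|]. apply (Rmult_lt_reg_r r); [lra|].
      unfold Rdiv. rewrite Rmult_assoc, Rinv_l by lra. lra.
    - intros N.
      assert (H1 : forall z : C, Cmod z = r -> (Cmod 1 <= 1)%R) by (intros; rewrite Cmod_1; lra).
      pose proof (kernel_expansion (fun _ => 1) r 1 a (S N) (pointwise_cont_const 1) Ha H1) as K.
      rewrite (csum_ext _ (fun k => (if Nat.eqb k 0 then 1 else 0) * a ^ k)) in K
        by (intros; rewrite circle_coef_one by lra; reflexivity).
      rewrite csum_delta in K.
      rewrite (CInt_ext _ (fun t => RtoC r * cexp t / (RtoC r * cexp t - a))) in K by (intros; ring).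
      fold I in K. simpl pow in K. lra. }
  now apply Cminus_eq_0, Cmod_le_0.
Qed.

Lemma circle_taylor (f : C -> C) (r B : R) (z : C) (N : nat) : entire f -> (Cmod z < r)%R ->
  (forall w, Cmod w = r -> (Cmod (f w) <= B)%R) ->
  (Cmod (f z - psum (circle_coef f r) z N) <= B * (r / (r - Cmod z)) * (Cmod z / r) ^ N)%R.
Proof.
  intros Hf Hz HB. pose proof (entire_cont f Hf) as Hc.
  pose proof Ci_nz as HCi.
  pose proof (Cmod_ge_0 z) as Hz0.
  pose proof (fun t => circle_sub_neq_0 z r t Hz) as Za0.
  pose proof (curve_cont_cauchy_kernel z r Hz) as Hk. pose proof (curve_cont_circle r) as Hzc.
  assert (E : f z = / RtoC (2 * PI) *
      CInt (fun t => f (RtoC r * cexp t) * (RtoC r * cexp t / (RtoC r * cexp t - z))) 0 (2 * PI)).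
  { assert (CF : CInt (fun t => f (RtoC r * cexp t) * (Ci * (RtoC r * cexp t / (RtoC r * cexp t - z)))) 0 (2 * PI)
      = f z * CInt (fun t => Ci * (RtoC r * cexp t / (RtoC r * cexp t - z))) 0 (2 * PI))
      by exact (cauchy_integral_formula f z r Hf Hz).
    assert (E2 : CInt (fun t => f (RtoC r * cexp t) * (Ci * (RtoC r * cexp t / (RtoC r * cexp t - z)))) 0 (2 * PI)
      = Ci * CInt (fun t => f (RtoC r * cexp t) * (RtoC r * cexp t / (RtoC r * cexp t - z))) 0 (2 * PI)).
    { rewrite <- CInt_scal; [apply CInt_ext; intros; field; auto|].
      apply curve_cont_mult; [now apply curve_cont_comp|auto]. }
    rewrite E2, CInt_scal in CF by auto.
    assert (K : CInt (fun t => RtoC r * cexp t / (RtoC r * cexp t - z)) 0 (2 * PI) = RtoC (2 * PI)).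
    { pose proof (kernel_mean r z Hz) as K.
      rewrite <- (Cmult_1_r (RtoC (2 * PI))), <- K. field. apply two_PI_neq_0. }
    rewrite K in CF.
    assert (G : CInt (fun t => f (RtoC r * cexp t) * (RtoC r * cexp t / (RtoC r * cexp t - z))) 0 (2 * PI)
      = f z * RtoC (2 * PI)).
    { match type of CF with _ = ?rhs =>
        transitivity (/ Ci * rhs); [rewrite <- CF; field; auto|field; auto] end. }
    rewrite G. field. apply two_PI_neq_0. }
  rewrite E. now apply kernel_expansion.
Qed.

(** * Taylor expansions *)

(** One sequence for all radii, with Cauchy's estimate and the remainder estimate built in for any
    bound B on the circle. These two inequalities are what the growth arguments consume. *)
Definition taylor (f : C -> C) (a : nat -> C) : Prop :=
  forall r B, (0 < r)%R -> (forall w, Cmod w = r -> (Cmod (f w) <= B)%R) ->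
    (forall k, (Cmod (a k) * r ^ k <= B)%R) /\
    (forall z N, (Cmod z < r ->
       Cmod (f z - psum a z N) <= B * (r / (r - Cmod z)) * (Cmod z / r) ^ N)%R).

(** An asymptotic expansion at 0: weaker than convergence, yet it determines the coefficients. It
    identifies sequences obtained on different circles or by different formulas. *)
Definition expansion (f : C -> C) (a : nat -> C) : Prop :=
  exists del, (0 < del)%R /\ forall N, exists M, (0 <= M)%R /\ forall z, (Cmod z < del ->
    Cmod (f z - psum a z N) <= M * Cmod z ^ N)%R.

Lemma expansion_zero (d : nat -> C) : expansion (fun _ => 0) d -> forall k, d k = 0.
Proof.
  intros [del [Hdel H]] k. induction k as [k IH] using lt_wf_ind.
  destruct (H (S k)) as [M [HM K]].
  apply Cmod_le_0.
  apply le_epsilon. intros eps He. rewrite Rplus_0_l.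
  set (x := Rmin (del / 2) (eps / (M + 1))).
  assert (Hx : (0 < x)%R) by (apply Rmin_glb_lt; [lra|apply Rdiv_lt_0_compat; lra]).
  assert (Hx1 : (x <= del / 2)%R) by apply Rmin_l.
  assert (Hx2 : (x <= eps / (M + 1))%R) by apply Rmin_r.
  specialize (K (RtoC x)). rewrite Cmod_R, Rabs_pos_eq in K by lra. specialize (K ltac:(lra)).
  simpl csum in K. rewrite csum_zero in K by (intros j Hj; rewrite IH by exact Hj; ring).
  replace (0 - (0 + d k * RtoC x ^ k)) with (- (d k * RtoC x ^ k)) in K by ring.
  rewrite Cmod_opp, Cmod_mult, Cmod_pow, Cmod_R, Rabs_pos_eq in K by lra.
  pose proof (pow_lt x k Hx) as Hxk. simpl in K.
  apply (Rmult_le_reg_r (x ^ k)); [exact Hxk|].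
  apply Rle_trans with (1 := K). rewrite <- Rmult_assoc. apply Rmult_le_compat_r; [lra|].
  apply Rle_trans with ((M + 1) * (eps / (M + 1)))%R.
  - apply Rmult_le_compat; lra.
  - right. field. lra.
Qed.

Lemma expansion_minus (f g : C -> C) (a b : nat -> C) : expansion f a -> expansion g b ->
  expansion (fun z => f z - g z) (fun k => a k - b k).
Proof.
  intros [d1 [Hd1 H1]] [d2 [Hd2 H2]]. exists (Rmin d1 d2). split; [now apply Rmin_glb_lt|].
  intros N. destruct (H1 N) as [M1 [HM1 K1]]. destruct (H2 N) as [M2 [HM2 K2]].
  exists (M1 + M2)%R. split; [lra|]. intros z Hz.
  specialize (K1 z (Rlt_le_trans _ _ _ Hz (Rmin_l _ _))).
  specialize (K2 z (Rlt_le_trans _ _ _ Hz (Rmin_r _ _))).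
  rewrite (csum_ext _ (fun k => a k * z ^ k - b k * z ^ k)) by (intros; ring).
  rewrite csum_minus.
  match goal with |- (Cmod (?x - ?y - (?u - ?v)) <= _)%R =>
    replace (x - y - (u - v)) with ((x - u) - (y - v)) by ring end.
  pose proof (Cmod_triangle_minus (f z - psum a z N) (g z - psum b z N)).
  lra.
Qed.

Lemma expansion_ext (f g : C -> C) (a : nat -> C) : (forall z, f z = g z) -> expansion f a -> expansion g a.
Proof.
  intros E [d [Hd H]]. exists d. split; [exact Hd|]. intros N. destruct (H N) as [M [HM K]].
  exists M. split; [exact HM|]. intros z Hz. rewrite <- E. now apply K.
Qed.

Lemma expansion_unique (f : C -> C) (a b : nat -> C) : expansion f a -> expansion f b -> forall k, a k = b k.
Proof.
  intros H1 H2 k. pose proof (expansion_minus _ _ _ _ H1 H2) as H.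
  apply (expansion_ext _ (fun _ => 0)) in H; [|intros; ring].
  apply Cminus_eq_0. exact (expansion_zero _ H k).
Qed.

Lemma remainder_expansion (f : C -> C) (a : nat -> C) (r B : R) : (0 < r)%R -> (0 <= B)%R ->
  (forall z N, (Cmod z < r ->
     Cmod (f z - psum a z N) <= B * (r / (r - Cmod z)) * (Cmod z / r) ^ N)%R) ->
  expansion f a.
Proof.
  intros Hr HB H. exists (r / 2)%R. split; [lra|]. intros N.
  pose proof (pow_lt r N Hr) as HrN.
  exists (B * 2 * / r ^ N)%R. split.
  { apply Rmult_le_pos; [lra|]. left. now apply Rinv_0_lt_compat. }
  intros z Hz. eapply Rle_trans; [apply H; lra|].
  unfold Rdiv at 2. rewrite Rpow_mult_distr, pow_inv.
  pose proof (pow_le (Cmod z) N (Cmod_ge_0 z)) as Hp.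
  replace (B * 2 * / r ^ N * Cmod z ^ N)%R with (B * 2 * (Cmod z ^ N * / r ^ N))%R by ring.
  apply Rmult_le_compat_r.
  - apply Rmult_le_pos; [exact Hp|]. left. now apply Rinv_0_lt_compat.
  - apply Rmult_le_compat_l; [exact HB|]. apply (Rmult_le_reg_r (r - Cmod z)); [lra|].
    unfold Rdiv. rewrite Rmult_assoc, Rinv_l by lra. lra.
Qed.

Lemma entire_circle_expansion (f : C -> C) (r : R) : entire f -> (0 < r)%R ->
  expansion f (circle_coef f r).
Proof.
  intros Hf Hr. destruct (entire_bounded_on_disc f r Hf) as [B [HB K]].
  apply (remainder_expansion f _ r B); [exact Hr|lra|].
  intros z N Hz. apply circle_taylor; auto. intros w Hw. apply K. lra.
Qed.

(** The coefficients taken on the unit circle serve every radius, because those taken on |w| = r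
    expand the same function at 0. *)
Lemma entire_taylor (f : C -> C) : entire f -> exists a, taylor f a.
Proof.
  intros Hf. exists (circle_coef f 1). intros r B Hr HB.
  assert (E : forall k, circle_coef f 1 k = circle_coef f r k).
  { apply expansion_unique with f; apply entire_circle_expansion; auto; lra. }
  split.
  - intros k. rewrite E. apply circle_coef_bound; auto. now apply entire_cont.
  - intros z N Hz. rewrite (csum_ext _ (fun k => circle_coef f r k * z ^ k)) by (intros; now rewrite E).
    now apply circle_taylor.
Qed.

Lemma taylor_expansion (f : C -> C) (a : nat -> C) : entire f -> taylor f a -> expansion f a.
Proof.
  intros Hf Ha. destruct (entire_bounded_on_disc f 1 Hf) as [B [HB K]].
  destruct (Ha 1%R B Rlt_0_1) as [_ H]; [intros w Hw; apply K; lra|].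
  apply (remainder_expansion f a 1 B); auto; lra.
Qed.

(** * Local factorization and quotients of entire functions *)

Lemma cderiv_ext_loc (f g : C -> C) (z l : C) :
  (exists d, (0 < d)%R /\ forall w, (Cmod (w - z) < d)%R -> f w = g w) ->
  cderiv f z l -> cderiv g z l.
Proof.
  intros [d0 [Hd0 E]] H eps He. destruct (H eps He) as [d [Hd K]].
  exists (Rmin d d0). split; [now apply Rmin_glb_lt|]. intros w Hw.
  rewrite <- !E.
  - apply K. eapply Rlt_le_trans; [exact Hw|apply Rmin_l].
  - replace (z - z) with (RtoC 0) by ring. now rewrite Cmod_0.
  - eapply Rlt_le_trans; [exact Hw|apply Rmin_r].
Qed.

Lemma cderiv_translate (f : C -> C) (c z l : C) : cderiv f (c + z) l -> cderiv (fun w => f (c + w)) z l.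
Proof.
  intros H eps He. destruct (H eps He) as [d [Hd K]]. exists d. split; [exact Hd|].
  intros w Hw. specialize (K (c + w)). replace (c + w - (c + z)) with (w - z) in K by ring. now apply K.
Qed.

Lemma entire_const (c : C) : entire (fun _ => c).
Proof. apply entire_cderiv. intros z. exists 0. apply cderiv_const. Qed.

Lemma entire_id : entire (fun w => w).
Proof. apply entire_cderiv. intros z. exists 1. apply cderiv_id. Qed.

Lemma entire_plus (f g : C -> C) : entire f -> entire g -> entire (fun w => f w + g w).
Proof.
  rewrite !entire_cderiv. intros H1 H2 z. destruct (H1 z) as [l Hl]. destruct (H2 z) as [m Hm].
  eexists. apply cderiv_plus; eassumption.
Qed.

Lemma entire_mult (f g : C -> C) : entire f -> entire g -> entire (fun w => f w * g w).
Proof.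
  rewrite !entire_cderiv. intros H1 H2 z. destruct (H1 z) as [l Hl]. destruct (H2 z) as [m Hm].
  eexists. apply cderiv_mult; eassumption.
Qed.

Lemma entire_ext (f g : C -> C) : (forall z, f z = g z) -> entire f -> entire g.
Proof.
  rewrite !entire_cderiv. intros E H z. destruct (H z) as [l Hl]. exists l.
  apply cderiv_ext_loc with f; [|exact Hl]. exists 1%R. split; [lra|]. intros; apply E.
Qed.

Lemma entire_minus (f g : C -> C) : entire f -> entire g -> entire (fun w => f w - g w).
Proof.
  intros H1 H2. apply entire_ext with (fun w => f w + (- (1)) * g w); [intros; ring|].
  apply entire_plus; [exact H1|]. apply entire_mult; [apply entire_const|exact H2].
Qed.

Lemma entire_pow (f : C -> C) (n : nat) : entire f -> entire (fun w => f w ^ n).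
Proof.
  intros H. induction n as [|n IH]; simpl; [apply entire_const|now apply entire_mult].
Qed.

Lemma entire_translate (f : C -> C) (c : C) : entire f -> entire (fun w => f (c + w)).
Proof.
  rewrite !entire_cderiv. intros H z. destruct (H (c + z)) as [l Hl]. exists l. now apply cderiv_translate.
Qed.

Lemma entire_inv (f : C -> C) : entire f -> (forall z, f z <> 0) -> entire (fun w => / f w).
Proof.
  rewrite !entire_cderiv. intros H Hn z. destruct (H z) as [l Hl].
  eexists. apply cderiv_inv; eauto.
Qed.

Lemma entire_csum (f : nat -> C -> C) (n : nat) : (forall k, entire (f k)) ->
  entire (fun z => csum (fun k => f k z) n).
Proof.
  intros H. induction n as [|n IH]; simpl; [apply entire_const|now apply entire_plus].
Qed.

(** The partial sums no longer change after K terms, while the remainder bound on a circle of radius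
    |z| + 1 tends to 0. *)
Lemma taylor_zero_fun (f : C -> C) (a : nat -> C) (K : nat) : entire f -> taylor f a ->
  (forall k, (K <= k)%nat -> a k = 0) -> forall z, f z = psum a z K.
Proof.
  intros Hf Ha H0 z.
  assert (E : (Cmod (f z - psum a z K) <= 0)%R).
  { pose proof (Cmod_ge_0 z) as Hz. set (r := (Cmod z + 1)%R).
    destruct (entire_bounded_on_disc f r Hf) as [B [HB Hb]].
    destruct (Ha r B) as [_ T]; [unfold r; lra|intros w Hw; apply Hb; lra|].
    apply le_0_of_le_geom with (M := (B * (r / (r - Cmod z)) * (Cmod z / r) ^ K)%R) (q := (Cmod z / r)%R).
    - split; [apply Rdiv_le_0_compat; unfold r; lra|]. apply (Rmult_lt_reg_r r); [unfold r; lra|].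
      unfold Rdiv. rewrite Rmult_assoc, Rinv_l by (unfold r; lra). unfold r; lra.
    - intros N. specialize (T z (K + N)%nat ltac:(unfold r; lra)). rewrite pow_add in T.
      replace (psum a z (K + N)) with (psum a z K) in T; [lra|].
      clear T. induction N as [|N IH]; [now rewrite Nat.add_0_r|].
      rewrite Nat.add_succ_r. simpl. rewrite <- IH, H0 by lia. ring. }
  now apply Cminus_eq_0, Cmod_le_0.
Qed.

Lemma Cpow_0_l_pos (k : nat) : (0 < k)%nat -> RtoC 0 ^ k = 0.
Proof. intros H. destruct k; [lia|]. simpl. ring. Qed.

Lemma least_nonzero (a : nat -> C) : (exists k, a k <> 0) ->
  exists k, a k <> 0 /\ forall j, (j < k)%nat -> a j = 0.
Proof.
  intros [k Hk]. induction k as [k IH] using lt_wf_ind.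
  destruct (classic (exists j, (j < k)%nat /\ a j <> 0)) as [[j [Hj1 Hj2]]|Hn].
  - now apply (IH j).
  - exists k. split; [exact Hk|]. intros j Hj. apply NNPP. intros Hne. apply Hn. now exists j.
Qed.

Lemma entire_local_factor (f : C -> C) (z0 : C) : entire f -> (exists z, f z <> 0) ->
  exists k f1, entire f1 /\ f1 z0 <> 0 /\ forall z, f z = (z - z0) ^ k * f1 z.
Proof.
  intros Hf Hne. set (F := fun w => f (z0 + w)).
  assert (HF : entire F) by now apply entire_translate.
  destruct (entire_taylor F HF) as [a Ha].
  destruct (least_nonzero a) as [k [Hk Hmin]].
  { apply NNPP. intros Hn. destruct Hne as [z Hz]. apply Hz.
    pose proof (taylor_zero_fun F a 0 HF Ha) as T.
    specialize (T (fun k _ => NNPP _ (fun h => Hn (ex_intro _ k h))) (z - z0)).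
    unfold F in T. replace (z0 + (z - z0)) with z in T by ring. exact T. }
  destruct (taylor_expansion F a HF Ha) as [del [Hdel Hexp]].
  (* Two terms are kept, of degrees k and k + 1: the remainder O(|w|^(k+2)) makes F / w^k, extended
     by a k, differentiable at 0 with derivative a (k+1). *)
  destruct (Hexp (S (S k))) as [M [HM KM]].
  set (F1 := fun w : C => if excluded_middle_informative (w = 0) then a k else F w * / w ^ k).
  assert (F1_0 : F1 0 = a k) by (unfold F1; destruct excluded_middle_informative; tauto).
  assert (F1_n : forall w : C, w <> 0 -> F1 w = F w * / w ^ k)
    by (intros w Hw; unfold F1; destruct excluded_middle_informative; tauto).
  assert (HF1 : entire F1).
  { apply entire_cderiv. intros w. destruct (classic (w = 0)) as [->|Hw].
    - exists (a (S k)). intros eps He.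
      exists (Rmin del (eps / (M + 1))). split.
      { apply Rmin_glb_lt; [lra|]. apply Rdiv_lt_0_compat; lra. }
      intros w Hw. replace (w - 0) with w in * by ring.
      pose proof (Rmin_l del (eps / (M + 1))). pose proof (Rmin_r del (eps / (M + 1))).
      destruct (classic (w = 0)) as [->|Hw0].
      { rewrite F1_0. replace (a k - a k - a (S k) * 0) with (RtoC 0) by ring. rewrite Cmod_0. lra. }
      rewrite F1_0, F1_n by exact Hw0.
      pose proof (Cpow_nz w k Hw0) as Hwk. pose proof (proj1 (Cmod_gt_0 _) Hwk) as Hpk.
      replace (F w * / w ^ k - a k - a (S k) * w)
        with ((F w - (a k * w ^ k + a (S k) * w ^ S k)) * / w ^ k) by (rewrite Cpow_S; field; auto).
      specialize (KM w ltac:(lra)). simpl csum in KM.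
      rewrite csum_zero in KM by (intros j Hj; rewrite Hmin by exact Hj; ring).
      rewrite Cplus_0_l in KM. rewrite Cmod_mult, Cmod_inv by exact Hwk.
      rewrite Cmod_pow in *. simpl pow in KM.
      apply (Rmult_le_reg_r (Cmod w ^ k)); [exact Hpk|].
      rewrite Rmult_assoc, Rinv_l, Rmult_1_r by lra.
      apply Rle_trans with (1 := KM).
      replace (M * (Cmod w * (Cmod w * Cmod w ^ k)))%R with (M * Cmod w * (Cmod w * Cmod w ^ k))%R by ring.
      rewrite (Rmult_assoc eps). apply Rmult_le_compat_r.
      + apply Rmult_le_pos; [apply Cmod_ge_0|lra].
      + pose proof (Cmod_ge_0 w).
        apply Rle_trans with ((M + 1) * (eps / (M + 1)))%R; [apply Rmult_le_compat; lra|right; field; lra].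
    - assert (Hd : exists l, cderiv (fun w => F w * / w ^ k) w l).
      { destruct (proj1 (entire_cderiv F) HF w) as [l Hl].
        destruct (proj1 (entire_cderiv _) (entire_pow _ k entire_id) w) as [m Hm].
        eexists. apply cderiv_mult; [exact Hl|]. apply cderiv_inv; [exact Hm|]. now apply Cpow_nz. }
      destruct Hd as [l Hl]. exists l. apply cderiv_ext_loc with (2 := Hl).
      exists (Cmod w). split; [now apply Cmod_gt_0|]. intros v Hv. symmetry. apply F1_n.
      intros ->. replace (0 - w) with (- w) in Hv by ring. rewrite Cmod_opp in Hv. lra. }
  exists k, (fun z => F1 (- z0 + z)). split; [|split].
  - now apply entire_translate.
  - replace (- z0 + z0) with (RtoC 0) by ring. now rewrite F1_0.
  - intros z. replace (- z0 + z) with (z - z0) by ring.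
    destruct (classic (z - z0 = 0)) as [E|E].
    + apply Cminus_eq_0 in E. subst z. replace (z0 - z0) with (RtoC 0) by ring. rewrite F1_0.
      assert (E0 : f z0 = a 0%nat).
      { destruct (Hexp 1%nat) as [M1 [HM1 KM1]]. specialize (KM1 0). rewrite Cmod_0 in KM1.
        specialize (KM1 Hdel). simpl in KM1. rewrite Rmult_0_l, Rmult_0_r in KM1.
        apply Cmod_le_0, Cminus_eq_0 in KM1. unfold F in KM1. rewrite Cplus_0_r in KM1. rewrite KM1. ring. }
      rewrite E0. destruct k as [|k]; [simpl; ring|].
      rewrite Cpow_0_l_pos, Hmin by lia. ring.
    + rewrite F1_n by exact E. unfold F. replace (z0 + (z - z0)) with z by ring.
      field. now apply Cpow_nz.
Qed.

Lemma entire_nonzero_near (f : C -> C) (z0 : C) : entire f -> f z0 <> 0 ->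
  exists d, (0 < d)%R /\ forall w, (Cmod (w - z0) < d)%R -> f w <> 0.
Proof.
  intros Hf H0. destruct (entire_cont f Hf z0 (Cmod (f z0)) (proj1 (Cmod_gt_0 _) H0)) as [d [Hd K]].
  exists d. split; [exact Hd|]. intros w Hw E. specialize (K w Hw). rewrite E in K.
  replace (0 - f z0) with (- f z0) in K by ring. rewrite Cmod_opp in K. lra.
Qed.

(** The value of H at each point is read off a local factorisation chosen for that point. Near z0
    these values agree with F1 / g1 for the single factorisation at z0, since g has no other zero
    nearby and both equal F / g away from z0. *)
Lemma entire_quotient (F g : C -> C) :
  (forall z0, exists k F1 g1, entire F1 /\ entire g1 /\ g1 z0 <> 0 /\
     (forall z, F z = (z - z0) ^ k * F1 z) /\ (forall z, g z = (z - z0) ^ k * g1 z)) ->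
  exists H, entire H /\ forall z, F z = H z * g z.
Proof.
  intros Hloc.
  set (P := fun z0 h => exists k F1 g1, entire F1 /\ entire g1 /\ g1 z0 <> 0 /\
     (forall z, F z = (z - z0) ^ k * F1 z) /\ (forall z, g z = (z - z0) ^ k * g1 z) /\ h = F1 z0 * / g1 z0).
  assert (HP : forall z0, exists h, P z0 h).
  { intros z0. destruct (Hloc z0) as (k & F1 & g1 & h1 & h2 & h3 & h4 & h5).
    exists (F1 z0 * / g1 z0), k, F1, g1. auto 10. }
  set (H := fun z => proj1_sig (constructive_indefinite_description _ (HP z))).
  assert (HH : forall z, P z (H z)).
  { intros z. unfold H. apply (proj2_sig (constructive_indefinite_description _ (HP z))). }
  assert (HFg : forall z, F z = H z * g z).
  { intros z. destruct (HH z) as (k & F1 & g1 & h1 & h2 & h3 & h4 & h5 & ->).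
    rewrite (h4 z), (h5 z). field. exact h3. }
  exists H. split; [|exact HFg].
  apply entire_cderiv. intros z0.
  destruct (HH z0) as (k & F1 & g1 & h1 & h2 & h3 & h4 & h5 & h6).
  assert (Hd : exists l, cderiv (fun w => F1 w * / g1 w) z0 l).
  { destruct (proj1 (entire_cderiv F1) h1 z0) as [l Hl].
    destruct (proj1 (entire_cderiv g1) h2 z0) as [m Hm].
    eexists. apply cderiv_mult; [exact Hl|]. apply cderiv_inv; eassumption. }
  destruct Hd as [l Hl]. exists l. apply cderiv_ext_loc with (2 := Hl).
  destruct (entire_nonzero_near g1 z0 h2 h3) as [d [Hd K]].
  exists d. split; [exact Hd|]. intros w Hw.
  destruct (classic (w = z0)) as [->|Hne]; [now rewrite h6|].
  pose proof (K w Hw) as Hg1.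
  assert (Hwz : w - z0 <> 0) by (intros E; now apply Hne, Cminus_eq_0).
  pose proof (Cpow_nz _ k Hwz) as Hwk.
  assert (Hgw : g w <> 0) by (rewrite h5; now apply Cmult_neq_0).
  transitivity (F w * / g w).
  - rewrite (h4 w), (h5 w). field. auto.
  - rewrite HFg. field. exact Hgw.
Qed.

Lemma entire_nonzero_nearby (f : C -> C) (z0 : C) : entire f -> (exists z, f z <> 0) ->
  exists d, (0 < d)%R /\ forall w, w <> z0 -> (Cmod (w - z0) < d)%R -> f w <> 0.
Proof.
  intros Hf Hne. destruct (entire_local_factor f z0 Hf Hne) as (k & f1 & h1 & h2 & h3).
  destruct (entire_nonzero_near f1 z0 h1 h2) as [d [Hd K]].
  exists d. split; [exact Hd|]. intros w Hw1 Hw2. rewrite h3. apply Cmult_neq_0; [|now apply K].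
  apply Cpow_nz. intros E. now apply Hw1, Cminus_eq_0.
Qed.

(** Zeros of f are isolated, so a point with D z nonzero would have neighbours where neither D nor f
    vanishes. This clears denominators from identities known only off their zeros. *)
Lemma entire_zero_off_zeros (f D : C -> C) : entire f -> (exists z, f z <> 0) -> entire D ->
  (forall z, f z <> 0 -> D z = 0) -> forall z, D z = 0.
Proof.
  intros Hf Hne HD H z. apply NNPP. intros Hz.
  destruct (entire_nonzero_nearby f z Hf Hne) as [d [Hd K]].
  destruct (entire_nonzero_near D z HD Hz) as [d' [Hd' K']].
  pose proof (Rmin_l d d') as M1. pose proof (Rmin_r d d') as M2.
  assert (Hm : (0 < Rmin d d')%R) by now apply Rmin_glb_lt.
  set (x := (Rmin d d' / 2)%R) in *.
  assert (Hx : Cmod (z + RtoC x - z) = x).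
  { replace (z + RtoC x - z) with (RtoC x) by ring. rewrite Cmod_R, Rabs_pos_eq; unfold x; lra. }
  apply (K' (z + RtoC x)); [rewrite Hx; unfold x; lra|].
  apply H, K; [|rewrite Hx; unfold x; lra]. intros E.
  rewrite E in Hx. replace (z - z) with (RtoC 0) in Hx by ring. rewrite Cmod_0 in Hx. unfold x in Hx. lra.
Qed.

(** * Polynomials *)

Lemma Rmax_Rle_l (x y z : R) : (Rmax x y <= z -> x <= z /\ y <= z)%R.
Proof. intros H. pose proof (Rmax_l x y). pose proof (Rmax_r x y). lra. Qed.

Lemma eq_0_of_bounded_multiples (x M : R) :
  (0 <= x -> (forall r0, exists r, r0 <= r /\ x * r <= M) -> x = 0)%R.
Proof.
  intros Hx H. destruct (Rle_lt_or_eq_dec 0 x Hx) as [Hp|]; [exfalso|auto].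
  destruct (H ((Rabs M + 1) / x)%R) as [r [Hr1 Hr2]].
  apply (Rmult_le_compat_l x) in Hr1; [|exact Hx].
  replace (x * ((Rabs M + 1) / x))%R with (Rabs M + 1)%R in Hr1 by (field; lra).
  pose proof (Rle_abs M). lra.
Qed.

(** Cauchy's estimate gives |a k| r <= M for k > d and r >= 1, and r takes arbitrarily large
    values. *)
Lemma taylor_coef_zero_of_growth (f : C -> C) (a : nat -> C) (M : R) (d : nat) : taylor f a ->
  (forall r0, exists r, r0 <= r /\ forall z, Cmod z = r -> Cmod (f z) <= M * r ^ d)%R ->
  forall k, (d < k)%nat -> a k = 0.
Proof.
  intros Ha H k Hk. apply Cmod_eq_0, eq_0_of_bounded_multiples with M; [apply Cmod_ge_0|].
  intros r0. destruct (H (Rmax 1 r0)) as [r [Hr Hb]].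
  pose proof (Rmax_l 1 r0). pose proof (Rmax_r 1 r0).
  exists r. split; [lra|].
  destruct (Ha r (M * r ^ d)%R ltac:(lra) Hb) as [T _]. specialize (T k).
  pose proof (pow_lt r d ltac:(lra)) as Hd.
  apply (Rmult_le_reg_r (r ^ d)); [exact Hd|].
  apply Rle_trans with (2 := T). rewrite Rmult_assoc. apply Rmult_le_compat_l; [apply Cmod_ge_0|].
  change (r * r ^ d)%R with (r ^ S d)%R. apply Rle_pow; lia || lra.
Qed.

Lemma entire_poly_eval (l : list C) : entire (poly_eval l).
Proof.
  induction l as [|a l IH]; simpl.
  - apply (entire_const 0).
  - apply (entire_plus (fun _ => a)); [apply entire_const|].
    apply (entire_mult (fun z => z)); [apply entire_id|exact IH].
Qed.

Lemma poly_eval_map_seq (a : nat -> C) (n s : nat) (z : C) :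
  poly_eval (map a (seq s n)) z = csum (fun k => a (s + k)%nat * z ^ k) n.
Proof.
  revert s. induction n as [|n IH]; intros s; [reflexivity|].
  rewrite csum_shift. simpl. rewrite IH, Nat.add_0_r, Cmult_1_r. f_equal.
  rewrite <- csum_scal. apply csum_ext. intros k _. rewrite Nat.add_succ_r. simpl. ring.
Qed.

Lemma exp_pow_INR (x : R) (n : nat) : (exp x ^ n = exp (INR n * x))%R.
Proof.
  induction n as [|n IH]; [simpl; rewrite Rmult_0_l, exp_0; reflexivity|].
  rewrite S_INR, Rmult_plus_distr_r, exp_plus, Rmult_1_l, <- IH. simpl. ring.
Qed.

Lemma Rle_1_pow (x : R) (n : nat) : (1 <= x -> 1 <= x ^ n)%R.
Proof. intros H. rewrite <- (pow1 n). apply pow_incr. lra. Qed.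

(** Coefficient lists may end in zeros, so m is the true degree and the induction asks whether the
    tail vanishes identically. The last estimate, that a first difference gains a factor 1/|z|, is
    meant for the numerator and denominator of Delta f / f. *)
Lemma poly_asymptotics (l : list C) : (exists z, poly_eval l z <> 0) ->
  exists m c M r0, (0 < c)%R /\ (0 <= M)%R /\ (1 <= r0)%R /\ forall z, (r0 <= Cmod z ->
    c * Cmod z ^ m <= Cmod (poly_eval l z) <= M * Cmod z ^ m /\
    Cmod (poly_eval l (z + 1)%C - poly_eval l z) * Cmod z <= M * Cmod z ^ m)%R.
Proof.
  induction l as [|a l IH]; intros Hne.
  { exfalso. destruct Hne as [z Hz]. now apply Hz. }
  destruct (classic (exists z, poly_eval l z <> 0)) as [Hl|Hl].
  - destruct (IH Hl) as (m & c & M & r0 & Hc & HM & Hr0 & K). clear IH.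
    set (r1 := Rmax (r0 + 1) (2 * Cmod a / c)).
    assert (R1 : (r0 + 1 <= r1)%R) by apply Rmax_l.
    assert (R2 : (2 * Cmod a / c <= r1)%R) by apply Rmax_r.
    pose proof (Cmod_ge_0 a) as Pa.
    assert (H2m : (0 <= 2 ^ m)%R) by (apply pow_le; lra).
    assert (HM2 : (0 <= M * 2 ^ m)%R) by now apply Rmult_le_pos.
    exists (S m), (c / 2)%R, (M + Cmod a + M * 2 ^ m)%R, r1.
    split; [lra|]. split; [lra|]. split; [lra|]. intros z Hz.
    destruct (K z ltac:(lra)) as [[K1 K2] K3].
    set (p := poly_eval l) in *. set (x := Cmod z) in *.
    assert (Hx : (1 <= x)%R) by lra.
    pose proof (Rle_1_pow x m Hx) as Hxm. simpl poly_eval. fold p.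
    assert (Hxs : (x ^ S m = x * x ^ m)%R) by reflexivity.
    assert (Hxx : (x <= x * x ^ m)%R) by nra.
    pose proof (Cmod_ge_0 (p z)) as Pp.
    assert (U : (x * Cmod (p z) <= x * (M * x ^ m))%R) by (apply Rmult_le_compat_l; lra).
    assert (L : (x * (c * x ^ m) <= x * Cmod (p z))%R) by (apply Rmult_le_compat_l; lra).
    assert (A1 : (Cmod a <= Cmod a * (x * x ^ m))%R) by nra.
    assert (A2 : (Cmod a <= c / 2 * (x * x ^ m))%R).
    { apply Rle_trans with (c / 2 * x)%R.
      - apply (Rmult_le_compat_l (c / 2)) in R2; [|lra].
        replace (c / 2 * (2 * Cmod a / c))%R with (Cmod a) in R2 by (field; lra).
        apply Rle_trans with (1 := R2). apply Rmult_le_compat_l; lra.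
      - apply Rmult_le_compat_l; lra. }
    assert (T1 : (Cmod (a + z * p z) <= Cmod a + x * Cmod (p z))%R)
      by (eapply Rle_trans; [apply Cmod_triangle|]; rewrite Cmod_mult; unfold x; lra).
    assert (T2 : (x * Cmod (p z) - Cmod a <= Cmod (a + z * p z))%R).
    { pose proof (Cmod_reverse_triangle (z * p z) (- a)) as T.
      rewrite Cmod_opp, Cmod_mult in T. replace (z * p z - - a) with (a + z * p z) in T by ring. exact T. }
    assert (Pos : (0 <= x * x ^ m)%R) by lra.
    assert (P1 : (0 <= M * (x * x ^ m))%R) by now apply Rmult_le_pos.
    assert (P2 : (0 <= M * 2 ^ m * (x * x ^ m))%R) by now apply Rmult_le_pos.
    rewrite Hxs. split; [split; nra|].
    replace (a + (z + 1) * p (z + 1) - (a + z * p z)) with (z * (p (z + 1) - p z) + p (z + 1)) by ring.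
    assert (Q : (Cmod (p (z + 1)%C) <= M * 2 ^ m * x ^ m)%R).
    { assert (Hz1 : (r0 <= Cmod (z + 1) <= 2 * x)%R).
      { pose proof (Cmod_triangle z 1) as T. rewrite Cmod_1 in T.
        pose proof (Cmod_reverse_triangle z (- (1))) as T'. rewrite Cmod_opp, Cmod_1 in T'.
        replace (z - - (1)) with (z + 1) in T' by ring. unfold x in *. lra. }
      destruct (K (z + 1)%C (proj1 Hz1)) as [[_ K4] _]. apply Rle_trans with (1 := K4).
      rewrite Rmult_assoc, <- Rpow_mult_distr. apply Rmult_le_compat_l; [exact HM|].
      apply pow_incr. pose proof (Cmod_ge_0 (z + 1)). lra. }
    apply Rle_trans with ((x * Cmod (p (z + 1)%C - p z) + M * 2 ^ m * x ^ m) * x)%R.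
    + apply Rmult_le_compat_r; [lra|]. eapply Rle_trans; [apply Cmod_triangle|]. rewrite Cmod_mult.
      fold x. lra.
    + assert (x * (Cmod (p (z + 1)%C - p z) * x) <= x * (M * x ^ m))%R by (apply Rmult_le_compat_l; lra).
      nra.
  - pose proof (zero_of_not_nonzero _ Hl) as Hz.
    assert (Ha : a <> 0).
    { intros ->. destruct Hne as [z Hnz]. apply Hnz. simpl. rewrite Hz. ring. }
    pose proof (proj1 (Cmod_gt_0 _) Ha).
    exists 0%nat, (Cmod a), (Cmod a), 1%R. split; [assumption|]. split; [lra|]. split; [lra|].
    intros z Hz1. simpl. rewrite !Hz. replace (a + z * 0) with a by ring.
    replace (a + (z + 1) * 0 - a) with (RtoC 0) by ring. rewrite Cmod_0. lra.
Qed.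

(** The fundamental theorem of algebra by Liouville's argument: without a root, the reciprocal would
    be entire and O(1/r) on large circles, so its value at 0 would be 0. *)
Lemma poly_root (a : C) (l : list C) : (exists z, poly_eval l z <> 0) ->
  exists b, poly_eval (a :: l) b = 0.
Proof.
  intros Hl. apply NNPP. intros Hn.
  assert (Hnz : forall z, poly_eval (a :: l) z <> 0) by (intros z h; apply Hn; now exists z).
  destruct (poly_asymptotics l Hl) as (m & c & M & r0 & Hc & HM & Hr0 & K).
  set (q := fun z => / poly_eval (a :: l) z).
  assert (Hq : entire q) by (apply entire_inv; [apply entire_poly_eval|exact Hnz]).
  destruct (entire_taylor q Hq) as [b Hb].
  assert (E : b 0%nat = 0).
  { apply Cmod_eq_0, eq_0_of_bounded_multiples with (2 / c)%R; [apply Cmod_ge_0|]. intros r1.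
    set (r := Rmax (Rmax r0 r1) (2 * Cmod a / c)).
    destruct (Rmax_Rle_l _ _ r (Rle_refl r)) as [R1 R2]. destruct (Rmax_Rle_l _ _ _ R1).
    exists r. split; [lra|].
    assert (Hcr : (0 < c * r)%R) by (apply Rmult_lt_0_compat; lra).
    destruct (Hb r (2 / (c * r))%R ltac:(lra)) as [T _].
    - intros z Hz. unfold q. rewrite Cmod_inv by apply Hnz.
      replace (2 / (c * r))%R with (/ (c * r / 2))%R by (field; lra).
      apply Rinv_le_contravar; [lra|].
      destruct (K z ltac:(lra)) as [[K1 _] _]. rewrite Hz in K1.
      pose proof (Cmod_reverse_triangle (z * poly_eval l z) (- a)) as T.
      rewrite Cmod_opp, Cmod_mult, Hz in T.
      replace (z * poly_eval l z - - a) with (poly_eval (a :: l) z) in T by (simpl; ring).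
      pose proof (Rle_1_pow r m ltac:(lra)) as Hrm.
      assert (r * (c * 1) <= r * Cmod (poly_eval l z))%R by (apply Rmult_le_compat_l; [lra|nra]).
      apply (Rmult_le_compat_l (c / 2)) in R2; [|lra].
      replace (c / 2 * (2 * Cmod a / c))%R with (Cmod a) in R2 by (field; lra). lra.
    - specialize (T 0%nat). simpl in T. rewrite Rmult_1_r in T.
      apply (Rmult_le_compat_r r) in T; [|lra].
      replace (2 / (c * r) * r)%R with (2 / c)%R in T by (field; lra). exact T. }
  destruct (taylor_expansion q b Hq Hb) as [d [Hd Hx]]. destruct (Hx 1%nat) as [M1 [_ K1]].
  specialize (K1 0). rewrite Cmod_0 in K1. specialize (K1 Hd).
  simpl csum in K1. rewrite E in K1.
  assert (Q0 : q 0 = 0).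
  { apply Cmod_le_0.
    rewrite pow_1, Rmult_0_r in K1.
    replace (q 0 - (0 + 0 * 1)) with (q 0) in K1 by ring. exact K1. }
  unfold q in Q0. apply (C1_nz). rewrite <- (Cinv_r (poly_eval (a :: l) 0)) by apply Hnz.
  rewrite Q0. ring.
Qed.

Lemma poly_divide_root (l : list C) (b : C) : exists q, length q = pred (length l) /\
  forall z, poly_eval l z = poly_eval l b + (z - b) * poly_eval q z.
Proof.
  induction l as [|a l [q [Hq1 Hq2]]].
  - exists nil. split; [reflexivity|]. intros z; simpl; ring.
  - destruct l as [|a' l'].
    + exists nil. split; [reflexivity|]. intros z; simpl; ring.
    + exists (poly_eval (a' :: l') b :: q). split; [simpl; rewrite Hq1; reflexivity|].
      intros z. change (poly_eval (a :: a' :: l') z) with (a + z * poly_eval (a' :: l') z).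
      change (poly_eval (a :: a' :: l') b) with (a + b * poly_eval (a' :: l') b).
      change (poly_eval (poly_eval (a' :: l') b :: q) z) with (poly_eval (a' :: l') b + z * poly_eval q z).
      rewrite (Hq2 z). ring.
Qed.

Definition cprod (f : C -> C) (l : list C) : C := fold_right (fun b acc => f b * acc) 1 l.

Lemma poly_factor (n : nat) (l : list C) : (length l <= S n)%nat -> (exists z, poly_eval l z <> 0) ->
  exists c bs, (length bs <= n)%nat /\ forall z, poly_eval l z = c * cprod (fun b => z - b) bs.
Proof.
  revert l. induction n as [|n IH]; intros l Hl Hne.
  - destruct l as [|a [|a' l]]; [|exists a, nil|simpl in Hl; lia].
    + destruct Hne as [z Hz]. now destruct Hz.
    + split; [simpl; lia|]. intros z; simpl; ring.
  - destruct l as [|a l]; [destruct Hne as [z Hz]; now destruct Hz|].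
    destruct (classic (exists z, poly_eval l z <> 0)) as [H|H].
    + destruct (poly_root a l H) as [b Hb].
      destruct (poly_divide_root (a :: l) b) as [q [Hq1 Hq2]].
      destruct (IH q) as (c & bs & h1 & h2).
      * rewrite Hq1. simpl in *. lia.
      * destruct Hne as [z Hz]. exists z. intros E. apply Hz. rewrite Hq2, E, Hb. ring.
      * exists c, (b :: bs). split; [simpl; lia|]. intros z. rewrite Hq2, Hb, h2. simpl. ring.
    + exists a, nil. split; [simpl; lia|]. intros z. simpl.
      rewrite (zero_of_not_nonzero _ H z). ring.
Qed.

Lemma Cmod_cprod_le (f g : C -> C) (l : list C) :
  (forall b, (Cmod (f b) <= Cmod (g b))%R) -> (Cmod (cprod f l) <= Cmod (cprod g l))%R.
Proof.
  intros H. induction l as [|b l IH]; simpl; [lra|]. rewrite !Cmod_mult.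
  apply Rmult_le_compat; auto using Cmod_ge_0.
Qed.

Lemma entire_cprod (f : C -> C -> C) (l : list C) : (forall b, entire (f b)) ->
  entire (fun u => cprod (fun b => f b u) l).
Proof.
  intros H. induction l as [|b l IH]; simpl; [apply entire_const|now apply entire_mult].
Qed.

(** The growth bound makes V a polynomial of degree at most d, and Cauchy's estimate on the unit
    circle bounds its d + 1 coefficients by B. The crude constant M is gone from the conclusion. *)
Lemma growth_beyond_unit_circle (V : C -> C) (d : nat) (M B : R) : entire V ->
  (forall u, 1 <= Cmod u -> Cmod (V u) <= M * Cmod u ^ d)%R ->
  (forall u, Cmod u = 1%R -> Cmod (V u) <= B)%R ->
  forall u, (1 <= Cmod u -> Cmod (V u) <= INR (S d) * (B * Cmod u ^ d))%R.
Proof.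
  intros HV HM HB u Hu. destruct (entire_taylor V HV) as [v Hv].
  assert (Hz : forall k, (S d <= k)%nat -> v k = 0).
  { intros k Hk. apply (taylor_coef_zero_of_growth V v M d Hv); [|lia].
    intros r0. exists (Rmax 1 r0). split; [apply Rmax_r|]. intros z Hz.
    pose proof (Rmax_l 1 r0). rewrite <- Hz. apply HM. lra. }
  rewrite (taylor_zero_fun V v (S d) HV Hv Hz u).
  destruct (Hv 1%R B Rlt_0_1 HB) as [T _].
  assert (B0 : (0 <= B)%R) by (specialize (T 0%nat); pose proof (Cmod_ge_0 (v 0%nat)); simpl in T; lra).
  apply Cmod_csum_le_const. intros k Hk. rewrite Cmod_mult, Cmod_pow.
  specialize (T k). rewrite pow1, Rmult_1_r in T.
  apply Rmult_le_compat; [apply Cmod_ge_0|apply pow_le; lra|exact T|]. apply Rle_pow; [exact Hu|lia].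
Qed.

(* Chebyshev's substitution x = -(rho/4)(u-1)^2/u maps the unit circle onto [0,rho] and carries
   prod (x - |b|) to a polynomial of degree at most 2N in u. *)
Lemma bound_from_minimum_modulus (c : C) (bs : list C) (N : nat) (rho B : R) :
  (0 < rho)%R -> (1 <= N)%nat -> (length bs <= N)%nat ->
  (forall x, 0 <= x <= rho -> exists z, Cmod z = x /\ Cmod (c * cprod (fun b => z - b) bs)%C <= B)%R ->
  forall z, Cmod z = (rho / (4 * INR N ^ 2))%R ->
    (Cmod (c * cprod (fun b => z - b) bs)%C <= INR (2 * N + 1) * (B * exp 2))%R.
Proof.
  intros HR HN Hlen Hmin z Hz.
  assert (HN1 : (1 <= INR N)%R) by (apply (le_INR 1); exact HN).
  (* This is u (|b| - x) for the substituted x, so V has no pole at u = 0. *)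
  set (fac := fun b u => RtoC (rho / 4) * ((u - 1) * (u - 1)) + RtoC (Cmod b) * u).
  set (V := fun u => c * cprod (fun b => fac b u) bs).
  assert (HV : entire V).
  { unfold V. apply (entire_mult (fun _ => c)); [apply entire_const|]. apply entire_cprod. intros b.
    unfold fac. apply entire_plus.
    - apply entire_mult; [apply entire_const|]. apply entire_mult; apply entire_minus;
        auto using entire_const, entire_id.
    - apply entire_mult; auto using entire_const, entire_id. }
  assert (Hunit : forall u, Cmod u = 1%R -> (Cmod (V u) <= B)%R).
  { intros u Hu. set (x := (rho / 4 * Cmod (u - 1) ^ 2)%R).
    assert (Hu1 : (Cmod (u - 1) <= 2)%R).
    { pose proof (Cmod_triangle_minus u 1) as T. rewrite Hu, Cmod_1 in T. lra. }
    pose proof (Cmod_ge_0 (u - 1)) as Hu0.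
    assert (Hsq : (0 <= Cmod (u - 1) ^ 2 <= 4)%R) by (split; [apply pow2_ge_0|nra]).
    assert (Hx : (0 <= x <= rho)%R) by (unfold x; split; nra).
    (* For |u| = 1 the number x lies in [0, rho], and every factor satisfies | |b| - x | <= |b - w|
       for all w of modulus x, in particular for the w at which the product is small. *)
    destruct (Hmin x Hx) as [w [Hw1 Hw2]]. apply Rle_trans with (2 := Hw2).
    unfold V. rewrite !Cmod_mult. apply Rmult_le_compat_l; [apply Cmod_ge_0|].
    apply Cmod_cprod_le. intros b.
    assert (E : fac b u = u * RtoC (Cmod b - x)).
    { assert (Q : (u - 1) * (u - 1) = - (RtoC (Cmod (u - 1) ^ 2) * u)).
      { assert (P : (fst u * fst u + snd u * snd u = 1)%R).
        { pose proof (Cmod2_alt u) as h. rewrite Hu in h. unfold Re, Im in h. simpl in h. lra. }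
        rewrite Cmod2_alt. destruct u as [p q]. simpl in P.
        unfold Re, Im, Cmult, Cminus, Cplus, Copp, RtoC; simpl.
        assert (Q2 : (q * q = 1 - p * p)%R) by lra. f_equal; ring [Q2]. }
      unfold fac. rewrite Q. unfold x. rewrite RtoC_minus, RtoC_mult. ring. }
    rewrite E, Cmod_mult, Hu, Rmult_1_l, Cmod_R, <- Hw1.
    pose proof (Cmod_reverse_triangle b w). pose proof (Cmod_reverse_triangle w b) as T2.
    rewrite (Cmod_minus_sym w b) in *. apply Rabs_le. lra. }
  assert (Hgrow : exists M, (0 <= M)%R /\ forall u, (1 <= Cmod u -> Cmod (V u) <= M * Cmod u ^ (2 * N))%R).
  { assert (H0 : exists M, (0 <= M)%R /\ forall u, (1 <= Cmod u ->
        Cmod (cprod (fun b => fac b u) bs) <= M * Cmod u ^ (2 * length bs))%R).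
    { clear -HR. induction bs as [|b bs [M [HM K]]].
      - exists 1%R. split; [lra|]. intros u _. simpl. rewrite Cmod_1. lra.
      - pose proof (Cmod_ge_0 b) as Hb.
        exists ((rho + Cmod b) * M)%R. split; [apply Rmult_le_pos; lra|]. intros u Hu.
        specialize (K u Hu). simpl cprod. rewrite Cmod_mult.
        replace (2 * length (b :: bs))%nat with (2 + 2 * length bs)%nat by (simpl; lia).
        rewrite pow_add.
        replace ((rho + Cmod b) * M * (Cmod u ^ 2 * Cmod u ^ (2 * length bs)))%R
          with ((rho + Cmod b) * Cmod u ^ 2 * (M * Cmod u ^ (2 * length bs)))%R by ring.
        apply Rmult_le_compat; auto using Cmod_ge_0.
        unfold fac. eapply Rle_trans; [apply Cmod_triangle|].
        rewrite !Cmod_mult, !Cmod_R, !Rabs_pos_eq by lra.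
        assert (Hu1 : (Cmod (u - 1) <= 2 * Cmod u)%R).
        { pose proof (Cmod_triangle_minus u 1) as T. rewrite Cmod_1 in T. lra. }
        pose proof (Cmod_ge_0 (u - 1)) as Hu0.
        assert (Cmod (u - 1) * Cmod (u - 1) <= 2 * Cmod u * (2 * Cmod u))%R by (apply Rmult_le_compat; lra).
        assert (rho / 4 * (Cmod (u - 1) * Cmod (u - 1)) <= rho / 4 * (2 * Cmod u * (2 * Cmod u)))%R
          by (apply Rmult_le_compat_l; lra).
        assert (Cmod b * Cmod u <= Cmod b * Cmod u ^ 2)%R by (apply Rmult_le_compat_l; nra).
        nra. }
    destruct H0 as [M [HM K]]. exists (Cmod c * M)%R. split; [apply Rmult_le_pos; auto using Cmod_ge_0|].
    intros u Hu. unfold V. rewrite Cmod_mult, Rmult_assoc.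
    apply Rmult_le_compat_l; [apply Cmod_ge_0|]. apply Rle_trans with (1 := K u Hu).
    apply Rmult_le_compat_l; [exact HM|]. apply Rle_pow; [exact Hu|lia]. }
  destruct Hgrow as [M [_ HM]].
  (* Here x is negative and [fac b u] is at least rho / (4 N^2) + |b|, which dominates |z - b| on
     the whole circle |z| = rho / (4 N^2). Moreover |u|^(2N) <= e^2. *)
  set (u := RtoC (1 + / INR N)).
  assert (HiN : (0 < / INR N)%R) by (apply Rinv_0_lt_compat; lra).
  assert (Hu : Cmod u = (1 + / INR N)%R) by (unfold u; rewrite Cmod_R, Rabs_pos_eq; lra).
  pose proof (growth_beyond_unit_circle V (2 * N) M B HV HM Hunit u ltac:(lra)) as G.
  assert (B0 : (0 <= B)%R).
  { eapply Rle_trans; [apply Cmod_ge_0|]. apply (Hunit 1). apply Cmod_1. }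
  apply Rle_trans with (Cmod (V u)).
  - unfold V. rewrite !Cmod_mult. apply Rmult_le_compat_l; [apply Cmod_ge_0|]. apply Cmod_cprod_le.
    intros b. eapply Rle_trans; [apply Cmod_triangle_minus|].
    pose proof (Cmod_ge_0 b) as Hb.
    assert (E : fac b u = RtoC (rho / (4 * INR N ^ 2) + Cmod b * (1 + / INR N))).
    { unfold fac, u. rewrite <- !RtoC_minus, <- !RtoC_mult, <- RtoC_plus. f_equal. field. lra. }
    rewrite E, Cmod_R, Hz. eapply Rle_trans; [|apply Rle_abs].
    apply Rplus_le_compat_l. nra.
  - apply Rle_trans with (1 := G). replace (2 * N + 1)%nat with (S (2 * N)) by lia.
    apply Rmult_le_compat_l; [apply pos_INR|]. apply Rmult_le_compat_l; [exact B0|].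
    rewrite Hu. apply Rle_trans with (exp (/ INR N) ^ (2 * N))%R.
    + apply pow_incr. split; [lra|]. apply exp_ineq1_le.
    + rewrite exp_pow_INR, mult_INR. simpl (INR 2). right. f_equal. field. lra.
Qed.

(** * Minimum modulus *)

Lemma nat_above (x : R) : (0 <= x)%R -> exists N : nat, (x <= INR N <= x + 1)%R.
Proof.
  intros Hx. destruct (archimed x) as [h1 h2].
  assert (Hz : (0 <= up x)%Z) by (apply le_IZR; lra).
  exists (Z.to_nat (up x)). rewrite INR_IZR_INZ, Z2Nat.id by exact Hz. lra.
Qed.

Lemma Rpower_ge_1 (r s : R) : (1 <= r -> 0 <= s -> 1 <= Rpower r s)%R.
Proof. intros Hr Hs. rewrite <- (Rpower_O r) by lra. now apply Rle_Rpower. Qed.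

Lemma Rpower_le_self (r s : R) : (1 <= r -> s <= 1 -> Rpower r s <= r)%R.
Proof. intros Hr Hs. rewrite <- (Rpower_1 r) at 2 by lra. now apply Rle_Rpower. Qed.

Lemma exp_le_pow2 (s : R) (N : nat) : (2 * s <= INR N -> exp s <= 2 ^ N)%R.
Proof.
  intros H. rewrite <- (exp_ln 2) by lra. rewrite exp_pow_INR.
  pose proof ln_lt_2 as L. pose proof (pos_INR N) as HN.
  assert (h : (s <= INR N * ln 2)%R) by nra.
  destruct h as [h|h]; [left; now apply exp_increasing|rewrite h; lra].
Qed.

(** On |z| <= r/2 the tail after N terms is at most 2 e^s 2^(-N), and N >= 2 s suffices to cancel
    e^s because ln 2 > 1/2. *)
Lemma taylor_truncation (f : C -> C) (a : nat -> C) (r s : R) (N : nat) : taylor f a ->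
  (0 < r -> 2 * s <= INR N -> (forall w, Cmod w = r -> Cmod (f w) <= exp s) ->
  forall z, Cmod z <= r / 2 -> Cmod (f z - psum a z N) <= 2)%R.
Proof.
  intros Ha Hr HN Hf z Hz. destruct (Ha r (exp s) Hr Hf) as [_ T].
  pose proof (Cmod_ge_0 z) as Hz0.
  apply Rle_trans with (1 := T z N ltac:(lra)).
  assert (E1 : (r / (r - Cmod z) <= 2)%R).
  { apply (Rmult_le_reg_r (r - Cmod z)); [lra|]. unfold Rdiv. rewrite Rmult_assoc, Rinv_l; lra. }
  assert (E1' : (0 <= r / (r - Cmod z))%R) by (apply Rdiv_le_0_compat; lra).
  assert (E2 : ((Cmod z / r) ^ N <= (/ 2) ^ N)%R).
  { apply pow_incr. split; [apply Rdiv_le_0_compat; lra|].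
    apply (Rmult_le_reg_r r); [lra|]. unfold Rdiv. rewrite Rmult_assoc, Rinv_l; lra. }
  assert (E2' : (0 <= (Cmod z / r) ^ N)%R) by (apply pow_le, Rdiv_le_0_compat; lra).
  pose proof (exp_le_pow2 s N HN) as E3. pose proof (exp_pos s) as E4.
  assert (P2 : (0 < 2 ^ N)%R) by (apply pow_lt; lra).
  apply Rle_trans with (2 ^ N * 2 * (/ 2) ^ N)%R.
  - apply Rmult_le_compat; try assumption.
    + apply Rmult_le_pos; lra.
    + apply Rmult_le_compat; lra.
  - rewrite pow_inv. right. field. lra.
Qed.

Lemma polynomial_of_taylor (f : C -> C) (a : nat -> C) (K : nat) : entire f -> taylor f a ->
  (forall k, (K <= k)%nat -> a k = 0) -> is_polynomial_fun f.
Proof.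
  intros Hf Ha H. exists (map a (seq 0 K)). intros z. rewrite poly_eval_map_seq. simpl.
  now apply taylor_zero_fun.
Qed.

(** Growth is assumed on an unbounded set of circles, which is all that is known of the quotient to
    which this is applied. The bound on the minimum modulus concerns all large radii, since it is
    used along the whole segment [0, r/2]. *)
Lemma wiman_minimum_modulus (H : C -> C) (sig : R) (M : nat) : entire H -> (0 < sig < 1 / 2)%R ->
  (forall r0, exists r, r0 <= r /\ forall z, Cmod z = r -> Cmod (H z) <= exp (Rpower r sig))%R ->
  (exists r0, forall r, r0 <= r -> exists z, Cmod z = r /\ Cmod (H z) <= r ^ M)%R ->
  is_polynomial_fun H.
Proof.
  intros HH Hsig Hgrow [r1 Hmin].
  destruct (entire_taylor H HH) as [a Ha].
  destruct (entire_bounded_on_disc H r1 HH) as [B0 [HB0 KB0]].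
  (* The small circle has radius at least r^del / 72 with del = 1 - 2 sig. For k del >= M + 2 its
     k-th power beats the bound C1 r^(M+1) by a factor r, up to constants. *)
  destruct (nat_above ((INR M + 2) / (1 - 2 * sig))%R) as [k0 [Hk0 _]].
  { apply Rdiv_le_0_compat; [|lra]. pose proof (pos_INR M). lra. }
  apply (polynomial_of_taylor H a k0 HH Ha). intros k Hk.
  set (del := (1 - 2 * sig)%R) in *. assert (Hdel : (0 < del)%R) by (unfold del; lra).
  assert (Hkd : (INR M + 2 <= INR k * del)%R).
  { apply le_INR in Hk. apply (Rmult_le_compat_r del) in Hk0; [|lra].
    unfold Rdiv in Hk0. rewrite Rmult_assoc, Rinv_l, Rmult_1_r in Hk0 by lra.
    apply Rle_trans with (1 := Hk0). apply Rmult_le_compat_r; lra. }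
  (* The factor 7 comes from 2N + 1 <= 7r, where N <= 2s + 1 <= 3s <= 3r; the factor 3 + B0 from Bd
     <= (3 + B0) r^M; the summand 2 is the truncation error. Below, 72 = 8 * 3^2 arises from 8 N^2
     <= 72 s^2. *)
  set (C1 := (7 * (3 + B0) * exp 2 + 2)%R).
  apply Cmod_eq_0, eq_0_of_bounded_multiples with (C1 * 72 ^ k)%R; [apply Cmod_ge_0|].
  intros r0. destruct (Hgrow (Rmax 1 (Rmax r0 r1))) as [r [Hr Hcirc]].
  apply Rmax_Rle_l in Hr. destruct Hr as [Hr1 Hr]. apply Rmax_Rle_l in Hr. destruct Hr as [Hr0 Hr].
  exists r. split; [exact Hr0|].
  set (s := Rpower r sig) in *.
  assert (Hs1 : (1 <= s)%R) by (apply Rpower_ge_1; lra).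
  assert (Hsr : (s <= r)%R) by (apply Rpower_le_self; lra).
  destruct (nat_above (2 * s)) as [N [HN1 HN2]]; [lra|].
  assert (HN : (1 <= N)%nat) by (apply INR_le; rewrite INR_1; lra).
  set (p := fun z => psum a z N).
  assert (Herr : forall z, (Cmod z <= r / 2 -> Cmod (H z - p z) <= 2)%R).
  { intros z Hz. apply (taylor_truncation H a r s N Ha); auto; lra. }
  (* B0 takes care of the radii below r1, where the minimum modulus is not controlled, and 2 of the
     passage from H to its Taylor polynomial. *)
  set (Bd := (2 + B0 + r ^ M)%R).
  assert (Hpmin : forall x, (0 <= x <= r / 2)%R -> exists z, Cmod z = x /\ (Cmod (p z) <= Bd)%R).
  { intros x Hx. assert (Hz : exists z, Cmod z = x /\ (Cmod (H z) <= B0 + r ^ M)%R).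
    { pose proof (Rle_1_pow r M Hr1) as HrM. destruct (Rle_lt_dec r1 x) as [h|h].
      - destruct (Hmin x h) as [z [Hz1 Hz2]]. exists z. split; [exact Hz1|].
        assert (x ^ M <= r ^ M)%R by (apply pow_incr; lra). lra.
      - exists (RtoC x). assert (E : Cmod (RtoC x) = x) by (rewrite Cmod_R, Rabs_pos_eq; lra).
        split; [exact E|]. pose proof (KB0 (RtoC x) ltac:(lra)). lra. }
    destruct Hz as [z [Hz1 Hz2]]. exists z. split; [exact Hz1|].
    pose proof (Herr z ltac:(lra)) as E.
    pose proof (Cmod_triangle_minus (H z) (H z - p z)) as T.
    replace (H z - (H z - p z)) with (p z) in T by ring. unfold Bd. lra. }
  assert (HBd : (0 <= Bd)%R) by (unfold Bd; pose proof (Rle_1_pow r M Hr1); lra).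
  pose proof (exp_pos 2) as He2.
  set (x := (r / 2 / (4 * INR N ^ 2))%R).
  assert (HNp : (1 <= INR N)%R) by lra.
  assert (Hq : (1 <= 4 * INR N ^ 2)%R) by (pose proof (Rle_1_pow (INR N) 2 HNp); lra).
  assert (Hxr : (0 < x <= r / 2)%R).
  { unfold x. split; [apply Rdiv_lt_0_compat; lra|].
    apply (Rmult_le_reg_r (4 * INR N ^ 2)); [lra|]. unfold Rdiv at 1.
    rewrite Rmult_assoc, Rinv_l by lra. apply Rmult_le_compat_l; lra. }
  assert (Hpx : forall z, Cmod z = x -> (Cmod (p z) <= INR (2 * N + 1) * (Bd * exp 2))%R).
  { set (l := map a (seq 0 N)).
    assert (Hl : forall z, p z = poly_eval l z) by (intros z; unfold l; now rewrite poly_eval_map_seq).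
    intros z Hz. destruct (classic (exists z, poly_eval l z <> 0)) as [Hne|Hne].
    - destruct (poly_factor N l) as (c & bs & Hbs & Hfac).
      + unfold l. rewrite length_map, length_seq. lia.
      + exact Hne.
      + rewrite Hl, Hfac. apply bound_from_minimum_modulus with (rho := (r / 2)%R); auto; [lra|].
        intros y Hy. destruct (Hpmin y Hy) as [w [Hw1 Hw2]]. exists w. split; [exact Hw1|].
        now rewrite <- Hfac, <- Hl.
    - rewrite Hl, (zero_of_not_nonzero _ Hne z), Cmod_0.
      apply Rmult_le_pos; [apply pos_INR|]. apply Rmult_le_pos; lra. }
  destruct (Ha x (INR (2 * N + 1) * (Bd * exp 2) + 2)%R) as [T _]; [lra| |].
  { intros z Hz. pose proof (Hpx z Hz). pose proof (Herr z ltac:(lra)) as E.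
    pose proof (Cmod_triangle (H z - p z) (p z)) as T.
    replace (H z - p z + p z) with (H z) in T by ring. lra. }
  specialize (T k).
  assert (Erhs : (INR (2 * N + 1) * (Bd * exp 2) + 2 <= C1 * r ^ S M)%R).
  { pose proof (Rle_1_pow r M Hr1) as HrM.
    assert (e1 : (INR (2 * N + 1) <= 7 * r)%R) by (rewrite plus_INR, mult_INR; simpl; lra).
    assert (e2 : (Bd <= (3 + B0) * r ^ M)%R) by (unfold Bd; nra).
    assert (e3 : (INR (2 * N + 1) * (Bd * exp 2) <= 7 * r * ((3 + B0) * r ^ M * exp 2))%R).
    { apply Rmult_le_compat; [apply pos_INR|apply Rmult_le_pos; lra|exact e1|].
      apply Rmult_le_compat_r; lra. }
    assert (e4 : (1 * 1 <= r * r ^ M)%R) by (apply Rmult_le_compat; lra).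
    change (r ^ S M)%R with (r * r ^ M)%R. unfold C1. lra. }
  assert (Ex : (Rpower r del / 72 <= x)%R).
  { assert (E : Rpower r del = (r / (s * s))%R).
    { unfold del, s. rewrite <- Rpower_plus.
      replace (1 - 2 * sig)%R with (1 + - (sig + sig))%R by ring.
      rewrite Rpower_plus, Rpower_Ropp, Rpower_1 by lra. reflexivity. }
    rewrite E. unfold x. apply Rle_trans with (r / (8 * (3 * s) ^ 2))%R.
    - right. field. lra.
    - replace (r / 2 / (4 * INR N ^ 2))%R with (r / (8 * INR N ^ 2))%R by (field; lra).
      apply Rmult_le_compat_l; [lra|]. apply Rinv_le_contravar; [nra|].
      apply Rmult_le_compat_l; [lra|]. apply pow_incr. lra. }
  assert (Hrd : (0 < Rpower r del)%R) by apply exp_pos.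
  assert (Ek : (r ^ (M + 2) <= Rpower r del ^ k)%R).
  { rewrite <- (Rpower_pow k) by exact Hrd. rewrite Rpower_mult, <- Rpower_pow by lra.
    apply Rle_Rpower; [lra|]. rewrite plus_INR. simpl (INR 2). lra. }
  assert (Fin : (Cmod (a k) * (r ^ (M + 2) / 72 ^ k) <= C1 * r ^ S M)%R).
  { apply Rle_trans with (2 := Erhs). apply Rle_trans with (2 := T).
    apply Rmult_le_compat_l; [apply Cmod_ge_0|].
    apply Rle_trans with ((Rpower r del / 72) ^ k)%R.
    - unfold Rdiv. rewrite Rpow_mult_distr, pow_inv. apply Rmult_le_compat_r; [|exact Ek].
      left. apply Rinv_0_lt_compat, pow_lt. lra.
    - apply pow_incr. split; [apply Rdiv_le_0_compat; lra|exact Ex]. }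
  pose proof (pow_lt r (S M) ltac:(lra)) as HrS. pose proof (pow_lt 72 k ltac:(lra)) as H72.
  replace (M + 2)%nat with (S (S M)) in Fin by lia.
  change (r ^ S (S M))%R with (r * r ^ S M)%R in Fin.
  apply (Rmult_le_reg_r (r ^ S M / 72 ^ k)); [apply Rdiv_lt_0_compat; lra|].
  replace (Cmod (a k) * r * (r ^ S M / 72 ^ k))%R with (Cmod (a k) * (r * r ^ S M / 72 ^ k))%R by (field; lra).
  replace (C1 * 72 ^ k * (r ^ S M / 72 ^ k))%R with (C1 * r ^ S M)%R by (field; lra).
  exact Fin.
Qed.

(** * Inverting differences *)

Lemma Delta_n_comm (n : nat) (f : C -> C) : Delta_n n (Delta f) = Delta (Delta_n n f).
Proof. induction n as [|n IH]; [reflexivity|]. simpl. now rewrite IH. Qed.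

Lemma Delta_n_ext (n : nat) (f g : C -> C) : (forall z, f z = g z) ->
  forall z, Delta_n n f z = Delta_n n g z.
Proof. intros E. induction n as [|n IH]; [exact E|]. intros z. simpl. unfold Delta. now rewrite !IH. Qed.

Lemma Delta_n_minus (n : nat) (f g : C -> C) (z : C) :
  Delta_n n (fun w => f w - g w) z = Delta_n n f z - Delta_n n g z.
Proof.
  revert z. induction n as [|n IH]; intros z; [reflexivity|]. simpl. unfold Delta. rewrite !IH. ring.
Qed.

Lemma entire_Delta (f : C -> C) : entire f -> entire (Delta f).
Proof.
  intros H. unfold Delta. apply entire_minus; [|exact H].
  apply entire_ext with (fun z => f (1 + z)); [intros z; f_equal; ring|]. now apply entire_translate.
Qed.

Lemma entire_Delta_n (n : nat) (f : C -> C) : entire f -> entire (Delta_n n f).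
Proof. intros H. induction n as [|n IH]; [exact H|]. simpl. now apply entire_Delta. Qed.

Lemma Delta_n_bound (n : nat) (f : C -> C) (rho B : R) :
  (forall w, Cmod w <= rho + INR n -> Cmod (f w) <= B)%R ->
  forall z, (Cmod z <= rho -> Cmod (Delta_n n f z) <= 2 ^ n * B)%R.
Proof.
  revert rho. induction n as [|n IH]; intros rho H z Hz.
  - simpl. rewrite Rmult_1_l. apply H. simpl. lra.
  - simpl. unfold Delta. rewrite S_INR in H.
    assert (H' : forall w, (Cmod w <= rho + 1 + INR n -> Cmod (f w) <= B)%R) by (intros w Hw; apply H; lra).
    pose proof (Cmod_triangle z 1) as T. rewrite Cmod_1 in T.
    pose proof (IH (rho + 1)%R H' z ltac:(lra)) as I1.
    pose proof (IH (rho + 1)%R H' (z + 1) ltac:(lra)) as I2.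
    eapply Rle_trans; [apply Cmod_triangle_minus|]. lra.
Qed.

(** The constant 3 bounds e: for j <= r one has |z + 1|^j <= r^j (1 + 1/r)^j <= e r^j. *)
Lemma shift_pow_first_order (z : C) (r : R) (j : nat) : Cmod z = r -> (1 <= r)%R -> (INR j <= r)%R ->
  (Cmod ((z + 1) ^ j - z ^ j) * r <= 3 * INR j * r ^ j)%R.
Proof.
  intros Hz Hr. induction j as [|j IH]; intros Hj.
  - simpl. replace (1 - 1) with (RtoC 0) by ring. rewrite Cmod_0. lra.
  - rewrite S_INR in *. specialize (IH ltac:(lra)).
    replace ((z + 1) ^ S j - z ^ S j) with (z * ((z + 1) ^ j - z ^ j) + (z + 1) ^ j) by (simpl; ring).
    assert (E : (Cmod ((z + 1) ^ j) <= 3 * r ^ j)%R).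
    { rewrite Cmod_pow. apply Rle_trans with ((r * (1 + / r)) ^ j)%R.
      - apply pow_incr. split; [apply Cmod_ge_0|]. pose proof (Cmod_triangle z 1) as T.
        rewrite Cmod_1, Hz in T. rewrite Rmult_plus_distr_l, Rinv_r by lra. lra.
      - rewrite Rpow_mult_distr, Rmult_comm. apply Rmult_le_compat_r; [apply pow_le; lra|].
        assert (Hir : (0 < / r)%R) by (apply Rinv_0_lt_compat; lra).
        apply Rle_trans with (exp (/ r) ^ j)%R.
        + apply pow_incr. split; [lra|]. apply exp_ineq1_le.
        + rewrite exp_pow_INR. apply Rle_trans with (exp 1); [|apply exp_le_3].
          assert (h : (INR j * / r <= 1)%R).
          { apply (Rmult_le_reg_r r); [lra|]. rewrite Rmult_assoc, Rinv_l by lra. lra. }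
          destruct h as [h|h]; [left; now apply exp_increasing|rewrite h; lra]. }
    apply Rle_trans with ((r * Cmod ((z + 1) ^ j - z ^ j) + 3 * r ^ j) * r)%R.
    + apply Rmult_le_compat_r; [lra|]. eapply Rle_trans; [apply Cmod_triangle|].
      rewrite Cmod_mult, Hz. lra.
    + change (r ^ S j)%R with (r * r ^ j)%R.
      assert (r * (Cmod ((z + 1) ^ j - z ^ j) * r) <= r * (3 * INR j * r ^ j))%R
        by (apply Rmult_le_compat_l; lra).
      lra.
Qed.

Lemma shift_pow_second_order (z : C) (r : R) (j : nat) : Cmod z = r -> (1 <= r)%R -> (INR j <= r)%R ->
  (Cmod ((z + 1) ^ j - z ^ j - RtoC (INR j) * z ^ pred j) * r ^ 2 <= 2 * INR j ^ 2 * r ^ j)%R.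
Proof.
  intros Hz Hr. induction j as [|j IH]; intros Hj.
  - simpl. replace (1 - 1 - 0 * 1) with (RtoC 0) by ring. rewrite Cmod_0. lra.
  - pose proof (pos_INR j) as Pj. rewrite S_INR in *. specialize (IH ltac:(lra)).
    pose proof (shift_pow_first_order z r j Hz Hr ltac:(lra)) as F1.
    assert (E : (z + 1) ^ S j - z ^ S j - RtoC (INR j + 1) * z ^ pred (S j) =
      z * ((z + 1) ^ j - z ^ j - RtoC (INR j) * z ^ pred j) + ((z + 1) ^ j - z ^ j)).
    { rewrite RtoC_plus. destruct j as [|j]; simpl; ring. }
    rewrite E. pose proof (pow_le r j ltac:(lra)) as Hrj.
    apply Rle_trans with ((r * Cmod ((z + 1) ^ j - z ^ j - RtoC (INR j) * z ^ pred j)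
       + Cmod ((z + 1) ^ j - z ^ j)) * r ^ 2)%R.
    + apply Rmult_le_compat_r; [apply pow2_ge_0|]. eapply Rle_trans; [apply Cmod_triangle|].
      rewrite Cmod_mult, Hz. lra.
    + change (r ^ S j)%R with (r * r ^ j)%R.
      assert (T1 : (r * (Cmod ((z + 1) ^ j - z ^ j - RtoC (INR j) * z ^ pred j) * r ^ 2)
        <= r * (2 * INR j ^ 2 * r ^ j))%R) by (apply Rmult_le_compat_l; lra).
      assert (T2 : (r * (Cmod ((z + 1) ^ j - z ^ j) * r) <= r * (3 * INR j * r ^ j))%R)
        by (apply Rmult_le_compat_l; lra).
      assert (T3 : (0 <= r * r ^ j * (INR j + 2))%R) by (apply Rmult_le_pos; [apply Rmult_le_pos|]; lra).
      lra.
Qed.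

Lemma expansion_csum (e : nat -> C) (K : nat) : (forall k, (K <= k)%nat -> e k = 0) ->
  expansion (fun z => psum e z K) e.
Proof.
  intros He. exists 1%R. split; [lra|]. intros N.
  destruct (Nat.le_gt_cases K N) as [h|h].
  - exists 0%R. split; [lra|]. intros z _. rewrite Rmult_0_l.
    replace (psum e z N) with (psum e z K).
    + replace (psum e z K - psum e z K) with (RtoC 0) by ring.
      rewrite Cmod_0. lra.
    + replace N with (K + (N - K))%nat by lia. induction (N - K)%nat as [|m IH]; [now rewrite Nat.add_0_r|].
      rewrite Nat.add_succ_r. simpl. rewrite <- IH, He by lia. ring.
  - exists (rsum (fun k => Cmod (e (N + k)%nat)) (K - N)). split.
    + assert (G : forall m, (0 <= rsum (fun k => Cmod (e (N + k)%nat)) m)%R).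
      { induction m as [|m IH]; simpl; [lra|]. pose proof (Cmod_ge_0 (e (N + m)%nat)). lra. }
      apply G.
    + intros z Hz. replace K with (N + (K - N))%nat at 1 by lia.
      pose proof (pow_le (Cmod z) N (Cmod_ge_0 z)) as Hp.
      induction (K - N)%nat as [|m IH].
      * rewrite Nat.add_0_r. replace (psum e z N - psum e z N)
          with (RtoC 0) by ring. rewrite Cmod_0. simpl. lra.
      * rewrite Nat.add_succ_r. simpl.
        match goal with |- (Cmod (?u + ?v - ?w) <= _)%R => replace (u + v - w) with ((u - w) + v) by ring end.
        eapply Rle_trans; [apply Cmod_triangle|]. rewrite Rmult_plus_distr_r.
        apply Rplus_le_compat; [exact IH|]. rewrite Cmod_mult, Cmod_pow.
        apply Rmult_le_compat_l; [apply Cmod_ge_0|]. rewrite pow_add.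
        rewrite <- (Rmult_1_r (Cmod z ^ N)) at 2. apply Rmult_le_compat_l; [exact Hp|].
        rewrite <- (pow1 m). apply pow_incr. split; [apply Cmod_ge_0|lra].
Qed.

Lemma entire_monomial_sum (a : nat -> C) (K : nat) : entire (fun z => psum a z K).
Proof.
  apply (entire_csum (fun k z => a k * z ^ k)). intros k.
  apply entire_mult; [apply entire_const|]. apply entire_pow, entire_id.
Qed.

Lemma polynomial_coef_bound (a : nat -> C) (K : nat) (r B : R) : (0 < r)%R ->
  (forall z, Cmod z = r -> Cmod (psum a z K) <= B)%R ->
  forall k, (k < K)%nat -> (Cmod (a k) * r ^ k <= B)%R.
Proof.
  intros Hr HB k Hk. set (e := fun k => if Nat.ltb k K then a k else 0).
  set (p := fun z => psum e z K).
  assert (Ep : forall z, p z = psum a z K).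
  { intros z. apply csum_ext. intros j Hj. unfold e. apply Nat.ltb_lt in Hj. now rewrite Hj. }
  assert (He : forall k, (K <= k)%nat -> e k = 0).
  { intros j Hj. unfold e. apply Nat.ltb_ge in Hj. now rewrite Hj. }
  assert (Hp : entire p) by apply entire_monomial_sum.
  destruct (entire_taylor p Hp) as [b Hb].
  assert (E : e k = b k).
  { apply (expansion_unique p); [now apply expansion_csum|now apply taylor_expansion]. }
  replace (a k) with (b k).
  - apply (Hb r B Hr). intros w Hw. rewrite Ep. now apply HB.
  - rewrite <- E. unfold e. apply Nat.ltb_lt in Hk. now rewrite Hk.
Qed.

Lemma finite_max (u : nat -> R) (K : nat) : (0 < K)%nat ->
  exists j, (j < K)%nat /\ forall k, (k < K)%nat -> (u k <= u j)%R.
Proof.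
  induction K as [|K IH]; [lia|]. intros _. destruct K as [|K].
  - exists 0%nat. split; [lia|]. intros k Hk. replace k with 0%nat by lia. lra.
  - destruct IH as [j [Hj H]]; [lia|]. destruct (Rle_lt_dec (u (S K)) (u j)) as [h|h].
    + exists j. split; [lia|]. intros k Hk. destruct (Nat.eq_dec k (S K)) as [->|]; [exact h|apply H; lia].
    + exists (S K). split; [lia|]. intros k Hk. destruct (Nat.eq_dec k (S K)) as [->|]; [lra|].
      specialize (H k ltac:(lia)). lra.
Qed.

Lemma csum_at_0 (a : nat -> C) (K : nat) : (0 < K)%nat -> psum a 0 K = a 0%nat.
Proof.
  intros HK. destruct K as [|K]; [lia|]. rewrite csum_shift, csum_zero; [simpl; ring|].
  intros j _. simpl. ring.
Qed.

(* The coefficients b of Delta p differ from those of p' by at most the maximum modulus of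
   Delta p - p', which is O(sum j^2 |a_j| r^j / r^2) and so is absorbed when K^2 << r. *)
Lemma difference_coefs (a : nat -> C) (K : nat) (r : R) : (0 < K)%nat -> (4 * INR K ^ 2 <= r)%R ->
  exists b, (forall z, Delta (fun w => psum a w K) z = psum b z K) /\
    forall e B, (e <= 1)%nat ->
      (forall k, (k < K)%nat -> (INR (S k) ^ e * (Cmod (b k) * r ^ k) <= B)%R) ->
      forall k, (k < K)%nat -> (INR k ^ S e * (Cmod (a k) * r ^ k) <= 2 * r * B)%R.
Proof.
  intros HK HKr.
  assert (HK1 : (1 <= INR K)%R) by (apply (le_INR 1); lia).
  assert (HKK : (INR K <= INR K ^ 2)%R) by nra.
  assert (Hr1 : (1 <= r)%R) by lra.
  set (p := fun w => psum a w K).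
  assert (HDp : entire (Delta p)) by apply entire_Delta, entire_monomial_sum.
  destruct (entire_taylor _ HDp) as [b Hb].
  assert (Hp : forall z rho, (1 <= rho -> Cmod z <= rho ->
     Cmod (p z) <= rsum (fun k => Cmod (a k)) K * rho ^ pred K)%R).
  { intros z rho Hrho Hz. apply Rle_trans with (rsum (fun k => Cmod (a k) * rho ^ pred K)%R K).
    - apply Cmod_csum_le. intros k Hk. rewrite Cmod_mult, Cmod_pow.
      apply Rmult_le_compat_l; [apply Cmod_ge_0|]. apply Rle_trans with (rho ^ k)%R.
      + apply pow_incr. split; [apply Cmod_ge_0|exact Hz].
      + apply Rle_pow; [exact Hrho|lia].
    - right. rewrite Rmult_comm, <- rsum_scal. clear. generalize (rho ^ pred K)%R. intros y.
      induction K as [|K IH]; simpl; [reflexivity|]. rewrite IH. ring. }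
  assert (Hb0 : forall k, (K <= k)%nat -> b k = 0).
  { intros k Hk. set (S0 := rsum (fun k => Cmod (a k)) K).
    apply (taylor_coef_zero_of_growth _ b (2 * S0 * 2 ^ pred K)%R (pred K) Hb); [|lia].
    intros r0. exists (Rmax 1 r0). split; [apply Rmax_r|]. intros z Hz.
    pose proof (Rmax_l 1 r0). set (rho := Rmax 1 r0) in *.
    unfold Delta. eapply Rle_trans; [apply Cmod_triangle_minus|].
    pose proof (Cmod_triangle z 1) as T. rewrite Cmod_1 in T.
    pose proof (Hp (z + 1) (2 * rho)%R ltac:(lra) ltac:(lra)) as P1.
    pose proof (Hp z (2 * rho)%R ltac:(lra) ltac:(lra)) as P2.
    rewrite Rpow_mult_distr in P1, P2. fold S0 in P1, P2. lra. }
  exists b. split; [intros z; now apply taylor_zero_fun|].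
  set (e := fun k => if Nat.ltb (S k) K then RtoC (INR (S k)) * a (S k) else 0).
  assert (He : forall k, (K <= k)%nat -> e k = 0).
  { intros k Hk. unfold e. replace (Nat.ltb (S k) K) with false; [reflexivity|].
    symmetry. apply Nat.ltb_ge. lia. }
  assert (Hde : forall z, csum (fun j => a j * (RtoC (INR j) * z ^ pred j)) K = psum e z K).
  { intros z. destruct K as [|K']; [lia|]. rewrite csum_shift.
    change (psum e z (S K')) with (psum e z K' + e K' * z ^ K').
    replace (e K') with (RtoC 0).
    - rewrite (csum_ext (fun k => a (S k) * (RtoC (INR (S k)) * z ^ pred (S k))) (fun k => e k * z ^ k)).
      + simpl. ring.
      + intros k Hk. unfold e. replace (Nat.ltb (S k) (S K')) with true.
        * simpl pred. ring.
        * symmetry. apply Nat.ltb_lt. lia.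
    - unfold e. now rewrite Nat.ltb_irrefl. }
  set (q := fun z => Delta p z - psum e z K).
  assert (Hq : entire q) by (apply entire_minus; [exact HDp|apply entire_monomial_sum]).
  destruct (entire_taylor q Hq) as [c Hc].
  assert (Ec : forall k, c k = b k - e k).
  { apply expansion_unique with q; [now apply taylor_expansion|].
    apply expansion_minus; [now apply taylor_expansion|now apply expansion_csum]. }
  set (al := fun j => (Cmod (a j) * r ^ j)%R).
  assert (Pal : forall j, (0 <= al j)%R).
  { intros j. apply Rmult_le_pos; [apply Cmod_ge_0|apply pow_le; lra]. }
  set (Sg := rsum (fun j => INR j ^ 2 * al j)%R K).
  assert (Hqb : forall z, Cmod z = r -> (Cmod (q z) <= 2 * Sg / r ^ 2)%R).
  { intros z Hz. unfold q, Delta, p. rewrite <- csum_minus, <- Hde, <- csum_minus.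
    assert (Hr2 : (0 < r ^ 2)%R) by (apply pow_lt; lra).
    apply Rle_trans with (rsum (fun j => 2 / r ^ 2 * (INR j ^ 2 * al j))%R K).
    - apply Cmod_csum_le. intros j Hj.
      replace (a j * (z + 1) ^ j - a j * z ^ j - a j * (RtoC (INR j) * z ^ pred j))
        with (a j * ((z + 1) ^ j - z ^ j - RtoC (INR j) * z ^ pred j)) by ring.
      rewrite Cmod_mult.
      assert (Hjr : (INR j <= r)%R) by (apply le_INR in Hj; rewrite S_INR in Hj; lra).
      pose proof (shift_pow_second_order z r j Hz Hr1 Hjr) as F2.
      apply (Rmult_le_reg_r (r ^ 2)); [exact Hr2|].
      replace (2 / r ^ 2 * (INR j ^ 2 * al j) * r ^ 2)%R with (2 * (INR j ^ 2 * al j))%R by (field; lra).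
      unfold al. rewrite Rmult_assoc.
      replace (2 * (INR j ^ 2 * (Cmod (a j) * r ^ j)))%R with (Cmod (a j) * (2 * INR j ^ 2 * r ^ j))%R by ring.
      apply Rmult_le_compat_l; [apply Cmod_ge_0|exact F2].
    - rewrite rsum_scal. fold Sg. right. field. lra. }
  assert (Hstep : forall k, (S k < K)%nat -> (INR (S k) * al (S k) <= r * (Cmod (b k) * r ^ k) + 2 * Sg / r)%R).
  { intros k Hk. destruct (Hc r (2 * Sg / r ^ 2)%R ltac:(lra) Hqb) as [T _]. specialize (T k).
    pose proof (pow_lt r k ltac:(lra)) as Hrk.
    assert (Eek : (Cmod (e k) = INR (S k) * Cmod (a (S k)))%R).
    { unfold e. apply Nat.ltb_lt in Hk. rewrite Hk, Cmod_mult, Cmod_R, Rabs_pos_eq by apply pos_INR.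
      reflexivity. }
    assert (T2 : (Cmod (e k) <= Cmod (b k) + Cmod (c k))%R).
    { replace (e k) with (b k - c k) by (rewrite Ec; ring). apply Cmod_triangle_minus. }
    apply (Rmult_le_compat_r (r * r ^ k)) in T2; [|apply Rmult_le_pos; lra].
    apply (Rmult_le_compat_l r) in T; [|lra].
    replace (r * (2 * Sg / r ^ 2))%R with (2 * Sg / r)%R in T by (field; lra).
    unfold al. change (r ^ S k)%R with (r * r ^ k)%R. rewrite Eek in T2. lra. }
  assert (HKr' : (2 * INR K ^ 2 / r <= / 2)%R).
  { apply (Rmult_le_reg_r r); [lra|]. unfold Rdiv. rewrite Rmult_assoc, Rinv_l; lra. }
  assert (Hir : (0 < / r)%R) by (apply Rinv_0_lt_compat; lra).
  intros e0 B He0 HB.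
  (* At the largest weighted coefficient A0 the error sum is at most A0 / 2, so the estimates
     collapse to A0 <= r B + A0 / 2. *)
  destruct (finite_max (fun k => INR k ^ S e0 * al k)%R K HK) as [j [Hj Hmax]].
  set (A0 := (INR j ^ S e0 * al j)%R) in *.
  assert (PA : (0 <= A0)%R) by (apply Rmult_le_pos; [apply pow_le, pos_INR|apply Pal]).
  assert (HA : (A0 <= 2 * r * B)%R).
  { assert (PB : (0 <= r * B)%R).
    { apply Rmult_le_pos; [lra|]. eapply Rle_trans; [|apply (HB 0%nat HK)].
      apply Rmult_le_pos; [apply pow_le, pos_INR|]. apply Rmult_le_pos; [apply Cmod_ge_0|apply pow_le; lra]. }
    destruct j as [|j]; [unfold A0; simpl; lra|].
    pose proof (Hstep j Hj) as T. set (w := (INR (S j) ^ e0)%R).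
    assert (Pw : (0 <= w)%R) by (apply pow_le, pos_INR).
    apply (Rmult_le_compat_l w) in T; [|exact Pw].
    replace (w * (INR (S j) * al (S j)))%R with A0 in T by (unfold A0, w; simpl; ring).
    pose proof (HB j ltac:(lia)) as HBj. fold w in HBj. apply (Rmult_le_compat_l r) in HBj; [|lra].
    assert (G : (w * Sg <= INR K * (INR K * A0))%R).
    { unfold Sg. rewrite <- rsum_scal. apply rsum_le_const. intros i Hi. specialize (Hmax i Hi). simpl in Hmax.
      pose proof (Pal i) as Pi. pose proof (pos_INR i).
      assert (HiK : (INR i <= INR K)%R) by (apply le_INR; lia).
      assert (HjK : (INR (S j) <= INR K)%R) by (apply le_INR; lia).
      (* For e0 = 0 one factor i of i^2 [al i] is bounded by K and the rest by A0. For e0 = 1 the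
         product i^2 [al i] is itself at most A0, and K bounds the weight w. *)
      destruct e0 as [|[|e0]]; [| |lia]; simpl in Hmax; simpl (_ ^ 2)%R.
      - replace w with 1%R by reflexivity. rewrite Rmult_1_r in *. rewrite Rmult_1_l, Rmult_assoc. apply Rmult_le_compat; try lra.
        apply Rmult_le_pos; lra.
      - replace w with (INR (S j)) by (unfold w; ring). rewrite Rmult_1_r in *.
        apply Rmult_le_compat; try lra; [apply pos_INR|].
        apply Rmult_le_pos; [|lra]. now apply Rmult_le_pos. }
    assert (G2 : (w * (2 * Sg / r) <= 2 * INR K ^ 2 / r * A0)%R).
    { replace (w * (2 * Sg / r))%R with (w * Sg * (2 * / r))%R by (field; lra).
      replace (2 * INR K ^ 2 / r * A0)%R with (INR K * (INR K * A0) * (2 * / r))%R by (field; lra).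
      apply Rmult_le_compat_r; lra. }
    assert (G3 : (2 * INR K ^ 2 / r * A0 <= / 2 * A0)%R) by (apply Rmult_le_compat_r; lra).
    lra. }
  intros k Hk. apply Rle_trans with (2 := HA). exact (Hmax k Hk).
Qed.

(** Each inversion of Delta costs a factor 2r. Delta loses the constant term, so the values at 0 of
    the lower differences enter as initial data. *)
Lemma polynomial_coefs_from_Delta_n (n : nat) (a : nat -> C) (K : nat) (r B : R) :
  (0 < K)%nat -> (4 * INR K ^ 2 <= r)%R ->
  (forall z, Cmod z = r -> Cmod (Delta_n n (fun w => psum a w K) z) <= B)%R ->
  (forall i, (i < n)%nat -> (Cmod (Delta_n i (fun w => psum a w K) 0) <= B)%R) ->
  forall k, (k < K)%nat -> (Cmod (a k) * r ^ k <= (2 * r + 1) ^ n * B)%R.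
Proof.
  intros HK HKr. assert (HK1 : (1 <= INR K)%R) by (apply (le_INR 1); lia).
  assert (Hr : (1 <= r)%R) by nra.
  revert a. induction n as [|n IH]; intros a HB Hi k Hk.
  - simpl. rewrite Rmult_1_l. now apply polynomial_coef_bound with K; [lra|..].
  - destruct (difference_coefs a K r HK HKr) as [b [Hb H1]].
    assert (B0 : (0 <= B)%R).
    { eapply Rle_trans; [apply Cmod_ge_0|]. apply (HB (RtoC r)). rewrite Cmod_R, Rabs_pos_eq; lra. }
    assert (Hn : (1 <= (2 * r + 1) ^ n)%R) by (apply Rle_1_pow; lra).
    assert (Hbk : forall k, (k < K)%nat -> (Cmod (b k) * r ^ k <= (2 * r + 1) ^ n * B)%R).
    { apply IH.
      - intros z Hz. rewrite <- (Delta_n_ext n _ _ Hb), Delta_n_comm. now apply HB.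
      - intros i Hin. rewrite <- (Delta_n_ext i _ _ Hb), Delta_n_comm. apply (Hi (S i)). lia. }
    specialize (H1 0%nat ((2 * r + 1) ^ n * B)%R ltac:(lia)). simpl in H1.
    specialize (H1 ltac:(intros; rewrite Rmult_1_l; auto) k Hk). rewrite Rmult_1_r in H1.
    assert (Pn : (0 <= (2 * r + 1) ^ n * B)%R) by (apply Rmult_le_pos; lra).
    change ((2 * r + 1) ^ S n)%R with ((2 * r + 1) * (2 * r + 1) ^ n)%R.
    destruct k as [|k].
    + specialize (Hi 0%nat ltac:(lia)). simpl in Hi.
      rewrite csum_at_0 in Hi by exact HK. simpl. nra.
    + assert (Hk1 : (1 <= INR (S k))%R) by (apply (le_INR 1); lia).
      assert (Pa : (0 <= Cmod (a (S k)) * r ^ S k)%R)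
        by (apply Rmult_le_pos; [apply Cmod_ge_0|apply pow_le; lra]).
      nra.
Qed.

(** The last two inversions each gain a factor k, as integration divides the new coefficient of z^k
    by k. The resulting 1/k^2 makes the coefficients summable without a loss that depends on K. *)
Lemma polynomial_coefs_from_Delta_n_weighted (n : nat) (a : nat -> C) (K : nat) (r B : R) :
  (0 < K)%nat -> (4 * INR K ^ 2 <= r)%R ->
  (forall z, Cmod z = r -> Cmod (Delta_n (S (S n)) (fun w => psum a w K) z) <= B)%R ->
  (forall i, (i < S (S n))%nat -> (Cmod (Delta_n i (fun w => psum a w K) 0) <= B)%R) ->
  forall k, (k < K)%nat -> (INR k ^ 2 * (Cmod (a k) * r ^ k) <= 2 * ((2 * r + 1) ^ S (S n) * B))%R.
Proof.
  intros HK HKr HB Hi k Hk. assert (HK1 : (1 <= INR K)%R) by (apply (le_INR 1); lia).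
  assert (Hr : (1 <= r)%R) by nra.
  assert (B0 : (0 <= B)%R).
  { eapply Rle_trans; [apply Cmod_ge_0|]. apply (HB (RtoC r)). rewrite Cmod_R, Rabs_pos_eq; lra. }
  destruct (difference_coefs a K r HK HKr) as [b [Hb H1]].
  destruct (difference_coefs b K r HK HKr) as [c [Hc H2]].
  assert (Hcc : forall z, Delta (Delta (fun w => psum a w K)) z = psum c z K).
  { intros z. rewrite <- Hc. unfold Delta at 1 3. now rewrite !Hb. }
  assert (Hck : forall k, (k < K)%nat -> (Cmod (c k) * r ^ k <= (2 * r + 1) ^ n * B)%R).
  { apply polynomial_coefs_from_Delta_n; auto.
    - intros z Hz. rewrite <- (Delta_n_ext n _ _ Hcc), !Delta_n_comm. now apply HB.
    - intros i Hin. rewrite <- (Delta_n_ext i _ _ Hcc), !Delta_n_comm. apply (Hi (S (S i))). lia. }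
  assert (Hn : (1 <= (2 * r + 1) ^ n)%R) by (apply Rle_1_pow; lra).
  set (X := ((2 * r + 1) ^ n * B)%R) in *.
  assert (PX : (0 <= X)%R) by (apply Rmult_le_pos; lra).
  assert (BX : (B <= X)%R) by (unfold X; nra).
  (* The next inversion expects the weight k + 1, because b k corresponds to a (k+1), whereas [H2]
     provides k. For k >= 1 this doubles the bound 2 r X; for k = 0 the value of Delta p at 0 gives
     X. *)
  assert (Hbk : forall k, (k < K)%nat -> (INR (S k) * (Cmod (b k) * r ^ k) <= (4 * r + 1) * X)%R).
  { intros j Hj. specialize (H2 0%nat X ltac:(lia)). simpl in H2.
    specialize (H2 ltac:(intros; rewrite Rmult_1_l; auto) j Hj). rewrite Rmult_1_r in H2. destruct j as [|j].
    - specialize (Hi 1%nat ltac:(lia)). simpl Delta_n in Hi. rewrite Hb in Hi.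
      rewrite csum_at_0 in Hi by exact HK. simpl. nra.
    - assert (Hj1 : (1 <= INR (S j))%R) by (apply (le_INR 1); lia).
      assert (Pb : (0 <= Cmod (b (S j)) * r ^ S j)%R)
        by (apply Rmult_le_pos; [apply Cmod_ge_0|apply pow_le; lra]).
      rewrite (S_INR (S j)). nra. }
  assert (Hbk1 : forall k, (k < K)%nat -> (INR (S k) ^ 1 * (Cmod (b k) * r ^ k) <= (4 * r + 1) * X)%R)
    by (intros; rewrite pow_1; auto).
  apply Rle_trans with (1 := H1 1%nat _ (Nat.le_refl _) Hbk1 k Hk).
  replace ((2 * r + 1) ^ S (S n) * B)%R with ((2 * r + 1) * ((2 * r + 1) * X))%R by (unfold X; simpl; ring).
  assert (0 <= r * X)%R by (apply Rmult_le_pos; lra). assert (0 <= r * (r * X))%R by (apply Rmult_le_pos; lra).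
  nra.
Qed.

(** * Growth of entire functions of finite order *)

Definition growth (f : C -> C) (sig : R) : Prop :=
  exists r0, forall r, (r0 <= r)%R -> forall z, (Cmod z <= r -> Cmod (f z) <= exp (Rpower r sig))%R.

(** [max_modulus] applies [real] to an extended supremum, which would yield the default 0 for an
    infinite one; boundedness of f on discs excludes this. *)
Lemma max_modulus_ge (f : C -> C) (z : C) : entire f -> (Cmod (f z) <= max_modulus f (Cmod z))%R.
Proof.
  intros Hf. unfold max_modulus.
  set (E := fun x => exists w : C, Cmod w = Cmod z /\ x = Cmod (f w)).
  destruct (entire_bounded_on_disc f (Cmod z) Hf) as [B [_ HB]].
  destruct (Lub_Rbar_correct E) as [U L].
  assert (Hub : Rbar_le (Lub_Rbar E) (Finite B)).
  { apply L. intros x [w [Hw ->]]. apply HB. lra. }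
  assert (Hz : Rbar_le (Finite (Cmod (f z))) (Lub_Rbar E)) by (apply U; now exists z).
  destruct (Lub_Rbar E) as [l| |]; simpl in *; [exact Hz|contradiction|contradiction].
Qed.

Lemma Rpower_mono_l (r r' s : R) : (0 < r -> r <= r' -> 0 <= s -> Rpower r s <= Rpower r' s)%R.
Proof. intros. apply Rle_Rpower_l; [assumption|]. split; assumption. Qed.

Lemma exp_mono (x y : R) : (x <= y -> exp x <= exp y)%R.
Proof. intros [h|h]; [left; now apply exp_increasing|rewrite h; lra]. Qed.

Lemma Rpower_unbounded (s A : R) : (0 < s)%R ->
  exists r0, (1 <= r0)%R /\ forall r, (r0 <= r -> A <= Rpower r s)%R.
Proof.
  intros Hs. set (A' := Rmax 1 A). assert (HA : (1 <= A')%R) by apply Rmax_l.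
  exists (Rpower A' (/ s)). assert (Hi : (0 < / s)%R) by now apply Rinv_0_lt_compat.
  split; [apply Rpower_ge_1; lra|]. intros r Hr.
  apply Rle_trans with A'; [apply Rmax_r|].
  replace A' with (Rpower (Rpower A' (/ s)) s) at 1.
  - apply Rpower_mono_l; [apply exp_pos|exact Hr|lra].
  - rewrite Rpower_mult, Rinv_l, Rpower_1 by lra. reflexivity.
Qed.

Lemma Rpower_dominates (s t A : R) : (s < t)%R ->
  exists r0, (1 <= r0)%R /\ forall r, (r0 <= r -> A * Rpower r s <= Rpower r t)%R.
Proof.
  intros Hst. destruct (Rpower_unbounded (t - s) A ltac:(lra)) as [r0 [Hr0 H]].
  exists r0. split; [exact Hr0|]. intros r Hr. specialize (H r Hr).
  replace t with ((t - s) + s)%R by ring. rewrite Rpower_plus.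
  apply Rmult_le_compat_r; [left; apply exp_pos|exact H].
Qed.

Lemma order_lt_growth (f : C -> C) (c : R) : entire f -> (0 < c)%R -> Rbar_lt (order f) (Finite c) ->
  exists sig, (0 < sig < c)%R /\ growth f sig.
Proof.
  intros Hf Hc Ho. set (g := fun r => (ln (ln (max_modulus f r)) / ln r)%R).
  assert (Hr0 : exists r0, Rbar_lt (Lub_Rbar (fun x => exists r, (r0 < r)%R /\ x = g r)) (Finite c)).
  { apply NNPP. intros Hn. apply (Rbar_lt_not_le _ _ Ho). unfold order, limsup_infty.
    unfold Rbar_glb.
    match goal with |- Rbar_le _ (proj1_sig ?g) => apply (proj2 (proj2_sig g)) end. intros y [r0 ->]. apply Rbar_not_lt_le. intros h.
    apply Hn. now exists r0. }
  destruct Hr0 as [r0 Hr0]. set (E := fun x => exists r, (r0 < r)%R /\ x = g r) in *.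
  destruct (Lub_Rbar_correct E) as [U _].
  assert (Hsig : exists sig, (0 < sig < c)%R /\ forall r, (r0 < r -> g r <= sig)%R).
  { destruct (Lub_Rbar E) as [l| |]; simpl in Hr0.
    (* The maximum with c/2 keeps sig positive even when the supremum l is not. *)
    - exists (Rmax l (c / 2)). pose proof (Rmax_l l (c / 2)). pose proof (Rmax_r l (c / 2)).
      split; [split; [lra|apply Rmax_lub_lt; lra]|]. intros r Hr.
      specialize (U (g r) (ex_intro _ r (conj Hr eq_refl))). simpl in U. lra.
    - contradiction.
    - exists (c / 2)%R. split; [lra|]. intros r Hr.
      specialize (U (g r) (ex_intro _ r (conj Hr eq_refl))). contradiction. }
  destruct Hsig as [sig [Hsig Hg]]. exists sig. split; [exact Hsig|].
  assert (Hcirc : forall z, (Rmax 3 (r0 + 1) <= Cmod z -> Cmod (f z) <= exp (Rpower (Cmod z) sig))%R).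
  { intros z Hz. pose proof (Rmax_l 3 (r0 + 1)). pose proof (Rmax_r 3 (r0 + 1)).
    apply Rle_trans with (1 := max_modulus_ge f z Hf). set (r := Cmod z) in *. set (m := max_modulus f r).
    specialize (Hg r ltac:(lra)). unfold g in Hg. fold m in Hg.
    assert (Hl : (0 < ln r)%R) by (rewrite <- ln_1; apply ln_increasing; lra).
    apply (Rmult_le_compat_r (ln r)) in Hg; [|lra].
    unfold Rdiv in Hg. rewrite Rmult_assoc, Rinv_l, Rmult_1_r in Hg by lra.
    (* [ln] is 0 on nonpositive arguments, so ln (ln m) carries no information when m <= 0 or ln m
       <= 0. In both cases m <= 1 and the claim is immediate. *)
    destruct (Rle_lt_dec m 0) as [h|h]; [pose proof (exp_pos (Rpower r sig)); lra|].
    rewrite <- (exp_ln m h). apply exp_mono.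
    destruct (Rle_lt_dec (ln m) 0) as [h'|h']; [pose proof (exp_pos (sig * ln r)); unfold Rpower; lra|].
    rewrite <- (exp_ln (ln m) h'). unfold Rpower. now apply exp_mono. }
  set (r1 := Rmax 3 (r0 + 1)) in *. assert (Hr1 : (3 <= r1)%R) by apply Rmax_l.
  destruct (entire_bounded_on_disc f r1 Hf) as [B [HB KB]].
  destruct (Rpower_unbounded sig (ln B)) as [r2 [Hr2 K2]]; [lra|].
  exists r2. intros r Hr z Hz. destruct (Rle_lt_dec r1 (Cmod z)) as [h|h].
  - apply Rle_trans with (1 := Hcirc z h). apply exp_mono, Rpower_mono_l; lra.
  - apply Rle_trans with (1 := KB z ltac:(lra)). rewrite <- (exp_ln B HB). apply exp_mono. now apply K2.
Qed.

Lemma transcendental_growth (f : C -> C) (d : nat) (M : R) : transcendental_entire f ->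
  ~ (forall r0, exists r, r0 <= r /\ forall z, Cmod z = r -> Cmod (f z) <= M * r ^ d)%R.
Proof.
  intros [Hf Hnp] H. apply Hnp. destruct (entire_taylor f Hf) as [a Ha].
  apply (polynomial_of_taylor f a (S d) Hf Ha). intros k Hk.
  apply (taylor_coef_zero_of_growth f a M d Ha H). lia.
Qed.

Lemma transcendental_nonzero (f : C -> C) : transcendental_entire f -> exists z, f z <> 0.
Proof.
  intros [_ Hnp]. apply NNPP. intros Hn. apply Hnp. exists nil. now apply zero_of_not_nonzero.
Qed.

Lemma circle_sup (f : C -> C) (r : R) : entire f -> (0 <= r)%R -> exists S0, (0 <= S0)%R /\
  (forall z, Cmod z = r -> Cmod (f z) <= S0)%R /\
  (forall B, (forall z, Cmod z = r -> Cmod (f z) <= B) -> S0 <= B)%R.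
Proof.
  intros Hf Hr. destruct (entire_bounded_on_disc f r Hf) as [B [_ HB]].
  destruct (completeness (fun x => exists z, Cmod z = r /\ x = Cmod (f z))) as [S0 [U L]].
  - exists B. intros x [z [Hz ->]]. apply HB. lra.
  - exists (Cmod (f (RtoC r))), (RtoC r). split; [rewrite Cmod_R, Rabs_pos_eq; lra|reflexivity].
  - assert (H1 : forall z, Cmod z = r -> (Cmod (f z) <= S0)%R) by (intros z Hz; apply U; now exists z).
    exists S0. split; [|split].
    + eapply Rle_trans; [apply Cmod_ge_0|]. apply (H1 (RtoC r)). rewrite Cmod_R, Rabs_pos_eq; lra.
    + exact H1.
    + intros B' HB'. apply L. intros x [z [Hz ->]]. now apply HB'.
Qed.

(** Transfer of the polynomial estimates to f through its Taylor polynomial with K terms, which is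
    within 2 of f on |z| <= 2r while K^2 is small against r. C0 collects the truncation error in the
    differences and the initial data at 0. *)
Lemma coefs_from_Delta_n (f : C -> C) (a : nat -> C) (sig : R) (n : nat) :
  entire f -> taylor f a -> (0 < sig < 1 / 2)%R -> growth f sig ->
  exists C0 r0, (0 <= C0)%R /\ (1 <= r0)%R /\ forall r B, (r0 <= r -> 0 <= B ->
    (forall z, Cmod z = r -> Cmod (Delta_n n f z) <= B) ->
    exists K : nat, INR K <= r /\
      (forall z, Cmod z = r -> Cmod (f z) <= rsum (fun k => Cmod (a k) * r ^ k) K + 2) /\
      (forall k, (k < K)%nat -> Cmod (a k) * r ^ k <= (2 * r + 1) ^ n * (B + C0)) /\
      (forall m k, n = S (S m) -> (k < K)%nat ->
         INR k ^ 2 * (Cmod (a k) * r ^ k) <= 2 * ((2 * r + 1) ^ n * (B + C0))))%R.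
Proof.
  intros Hf Ha Hsig [rg Hg].
  set (C0 := (2 ^ n * 2 + rsum (fun i => Cmod (Delta_n i f 0)) n)%R).
  assert (P2n : (1 <= 2 ^ n)%R) by (apply Rle_1_pow; lra).
  assert (Psum : (0 <= rsum (fun i => Cmod (Delta_n i f 0)) n)%R) by (apply rsum_nonneg; intros; apply Cmod_ge_0).
  (* With K <= 3 s the condition 4 K^2 <= r follows from 36 s^2 <= r, that is, from 144 s^2 <= 4r,
     where s^2 = (4r)^(2 sig). *)
  destruct (Rpower_dominates (2 * sig) 1 144) as [r1 [Hr1 Hdom]]; [lra|].
  exists C0, (Rmax (Rmax r1 rg) (INR n)). split; [unfold C0; lra|].
  split; [apply Rle_trans with (1 := Hr1); eapply Rle_trans; apply Rmax_l|].
  intros r B Hr HB HDB. destruct (Rmax_Rle_l _ _ _ Hr) as [Hr' Hrn]. destruct (Rmax_Rle_l _ _ _ Hr').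
  (* On |z| = r the differences reach out to r + n <= 2r, and truncation halves the radius; hence
     4r. *)
  set (s := Rpower (4 * r) sig).
  assert (Hs1 : (1 <= s)%R) by (apply Rpower_ge_1; lra).
  destruct (nat_above (2 * s)) as [K [HK1 HK2]]; [lra|].
  assert (HK : (0 < K)%nat) by (apply INR_lt; simpl; lra).
  assert (HKr : (4 * INR K ^ 2 <= r)%R).
  { specialize (Hdom (4 * r)%R ltac:(lra)). rewrite Rpower_1 in Hdom by lra.
    replace (2 * sig)%R with (sig + sig)%R in Hdom by ring. rewrite Rpower_plus in Hdom. fold s in Hdom.
    assert (INR K ^ 2 <= (3 * s) ^ 2)%R by (apply pow_incr; lra). lra. }
  assert (Herr : forall z, (Cmod z <= 2 * r -> Cmod (f z - psum a z K) <= 2)%R).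
  { intros z Hz. apply (taylor_truncation f a (4 * r) s K Ha); try lra.
    intros w Hw. apply Hg; lra. }
  set (p := fun z => psum a z K) in *.
  assert (Hdel : forall i z, (i <= n)%nat -> (Cmod z <= r)%R ->
     (Cmod (Delta_n i p z) <= Cmod (Delta_n i f z) + 2 ^ n * 2)%R).
  { intros i z Hi Hz.
    assert (D1 : (Cmod (Delta_n i (fun w => f w - p w)%C z) <= 2 ^ i * 2)%R).
    { apply (Delta_n_bound i (fun w => f w - p w) r 2); [|exact Hz]. intros w Hw. apply Herr.
      apply le_INR in Hi. lra. }
    rewrite Delta_n_minus in D1.
    assert (D2 : (2 ^ i <= 2 ^ n)%R) by (apply Rle_pow; [lra|exact Hi]).
    pose proof (Cmod_triangle_minus (Delta_n i f z) (Delta_n i f z - Delta_n i p z)) as T.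
    replace (Delta_n i f z - (Delta_n i f z - Delta_n i p z)) with (Delta_n i p z) in T by ring. lra. }
  assert (E1 : forall z, Cmod z = r -> (Cmod (Delta_n n p z) <= B + C0)%R).
  { intros z Hz. pose proof (Hdel n z (Nat.le_refl n) ltac:(lra)). specialize (HDB z Hz). unfold C0. lra. }
  assert (E2 : forall i, (i < n)%nat -> (Cmod (Delta_n i p 0) <= B + C0)%R).
  { intros i Hi. pose proof (Hdel i 0 ltac:(lia)) as T. rewrite Cmod_0 in T. specialize (T ltac:(lra)).
    assert (S1 : forall m, (i < m)%nat -> (Cmod (Delta_n i f 0) <= rsum (fun i => Cmod (Delta_n i f 0)) m)%R).
    { induction m as [|m IH]; [lia|]. intros Him. simpl.
      pose proof (rsum_nonneg (fun i => Cmod (Delta_n i f 0)) m (fun k => Cmod_ge_0 _)).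
      destruct (Nat.eq_dec i m) as [->|].
      - lra.
      - specialize (IH ltac:(lia)). pose proof (Cmod_ge_0 (Delta_n m f 0)). lra. }
    specialize (S1 n Hi). unfold C0. lra. }
  exists K. split; [|split; [|split]].
  - assert (1 <= INR K)%R by (apply (le_INR 1); lia). nra.
  - intros z Hz. pose proof (Herr z ltac:(lra)) as T.
    pose proof (Cmod_triangle (f z - p z) (p z)) as T2.
    replace (f z - p z + p z) with (f z) in T2 by ring.
    assert (T3 : (Cmod (p z) <= rsum (fun k => Cmod (a k) * r ^ k)%R K)%R).
    { apply Cmod_csum_le. intros k _. rewrite Cmod_mult, Cmod_pow, Hz. lra. }
    unfold p in *. lra.
  - intros k Hk. apply (polynomial_coefs_from_Delta_n n a K r (B + C0)); auto.
  - intros m k -> Hk. apply (polynomial_coefs_from_Delta_n_weighted m a K r (B + C0)); auto.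
Qed.

(** Of the n + 1 factors r, n pay for inverting the differences and one for adding up K <= r
    coefficients. *)
Lemma bound_from_Delta_n (f : C -> C) (sig : R) (n : nat) :
  entire f -> (0 < sig < 1 / 2)%R -> growth f sig ->
  exists C0 r0, (0 <= C0)%R /\ (1 <= r0)%R /\ forall r B, (r0 <= r -> 0 <= B ->
    (forall z, Cmod z = r -> Cmod (Delta_n n f z) <= B) ->
    forall z, Cmod z = r -> Cmod (f z) <= C0 * r ^ S n * (B + 1))%R.
Proof.
  intros Hf Hsig Hg. destruct (entire_taylor f Hf) as [a Ha].
  destruct (coefs_from_Delta_n f a sig n Hf Ha Hsig Hg) as (C0 & r0 & HC0 & Hr0 & H).
  assert (P3 : (1 <= 3 ^ n)%R) by (apply Rle_1_pow; lra).
  assert (Hc : (0 <= 3 ^ n * C0)%R) by (apply Rmult_le_pos; lra).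
  exists (3 ^ n + 3 ^ n * C0 + 2)%R, r0. split; [lra|]. split; [exact Hr0|].
  intros r B Hr HB HDB z Hz. destruct (H r B Hr HB HDB) as (K & HKr & Hfz & Hk & _).
  apply Rle_trans with (1 := Hfz z Hz).
  assert (Hr1 : (1 <= r)%R) by lra. pose proof (Rle_1_pow r n Hr1) as Hrn.
  assert (T : ((2 * r + 1) ^ n <= 3 ^ n * r ^ n)%R).
  { rewrite <- Rpow_mult_distr. apply pow_incr. lra. }
  set (X := ((2 * r + 1) ^ n * (B + C0))%R) in *.
  assert (HX : (X <= 3 ^ n * r ^ n * (B + C0))%R) by (apply Rmult_le_compat_r; lra).
  assert (PX : (0 <= X)%R) by (apply Rmult_le_pos; [apply pow_le; lra|lra]).
  assert (S1 : (rsum (fun k => Cmod (a k) * r ^ k)%R K <= INR K * X)%R) by (apply rsum_le_const; exact Hk).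
  assert (S2 : (INR K * X <= r * (3 ^ n * r ^ n * (B + C0)))%R).
  { apply Rmult_le_compat; [apply pos_INR|exact PX|exact HKr|exact HX]. }
  change (r ^ S n)%R with (r * r ^ n)%R.
  assert (Hy : (1 * 1 <= r * r ^ n)%R) by (apply Rmult_le_compat; lra).
  set (y := (r * r ^ n)%R) in *.
  assert (Q : (3 ^ n * (B + C0) + 2 <= (3 ^ n + 3 ^ n * C0 + 2) * (B + 1))%R).
  { assert (0 <= 3 ^ n * C0 * B)%R by (apply Rmult_le_pos; lra). lra. }
  assert (Q2 : (y * (3 ^ n * (B + C0) + 2) <= y * ((3 ^ n + 3 ^ n * C0 + 2) * (B + 1)))%R)
    by (apply Rmult_le_compat_l; lra).
  replace (r * (3 ^ n * r ^ n * (B + C0)))%R with (y * (3 ^ n * (B + C0)))%R in S2 by (unfold y; ring).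
  lra.
Qed.

(** * Finitely many zeros force a rational quotient *)

Lemma poly_add_exists (l1 l2 : list C) :
  exists l, forall z, poly_eval l z = poly_eval l1 z + poly_eval l2 z.
Proof.
  revert l2. induction l1 as [|a l1 IH]; intros l2.
  - exists l2. intros z; simpl; ring.
  - destruct l2 as [|b l2].
    + exists (a :: l1). intros z; simpl; ring.
    + destruct (IH l2) as [l Hl]. exists (a + b :: l). intros z. simpl. rewrite Hl. ring.
Qed.

Lemma poly_mult_linear (b : C) (l : list C) :
  exists l', forall z, poly_eval l' z = (z - b) * poly_eval l z.
Proof.
  destruct (poly_add_exists (RtoC 0 :: l) (map (Cmult (- b)) l)) as [l' Hl'].
  exists l'. intros z. rewrite Hl'.
  assert (E : poly_eval (map (Cmult (- b)) l) z = - b * poly_eval l z).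
  { clear. induction l as [|a l IH]; simpl; [ring|]. rewrite IH. ring. }
  rewrite E. simpl. ring.
Qed.

Lemma poly_mult_linear_pow (b : C) (k : nat) (l : list C) :
  exists l', forall z, poly_eval l' z = (z - b) ^ k * poly_eval l z.
Proof.
  induction k as [|k [l1 H1]].
  - exists l. intros z. simpl. ring.
  - destruct (poly_mult_linear b l1) as [l' H']. exists l'. intros z. rewrite H', H1. simpl. ring.
Qed.

(** Away from z0 the quotient is (z - z0)^(b-a) g1 / f1, which extends differentiably to z0 with
    value 0. The punctured neighbourhood hides the point z0, where g / f may be a division by
    zero. *)
Lemma mero_zero_of_factor (g f g1 f1 : C -> C) (z0 : C) (a b : nat) :
  entire g1 -> entire f1 -> f1 z0 <> 0 -> (a < b)%nat ->
  (forall z, g z = (z - z0) ^ b * g1 z) -> (forall z, f z = (z - z0) ^ a * f1 z) ->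
  mero_zero (fun z => g z / f z) z0.
Proof.
  intros Hg1 Hf1 Hf10 Hab Hg Hf.
  set (u := fun w => (w - z0) ^ (b - a) * (g1 w * / f1 w)).
  assert (Hu : exists l, cderiv u z0 l).
  { destruct (proj1 (entire_cderiv _) (entire_pow _ (b - a) (entire_minus _ _ entire_id (entire_const z0))) z0) as [l1 H1].
    destruct (proj1 (entire_cderiv g1) Hg1 z0) as [l2 H2].
    destruct (proj1 (entire_cderiv f1) Hf1 z0) as [l3 H3].
    eexists. apply cderiv_mult; [exact H1|]. apply cderiv_mult; [exact H2|]. apply cderiv_inv; eassumption. }
  destruct Hu as [l Hl].
  assert (Hu0 : u z0 = 0).
  { unfold u. replace (z0 - z0) with (RtoC 0) by ring. rewrite Cpow_0_l_pos by lia. ring. }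
  destruct (entire_nonzero_near f1 z0 Hf1 Hf10) as [d1 [Hd1 K1]].
  assert (Hlim : forall eps, (0 < eps)%R -> exists d, (0 < d)%R /\
    forall w, w <> z0 -> (Cmod (w - z0) < d -> Cmod (g w / f w) < eps)%R).
  { intros eps He. destruct (cderiv_pointwise_cont u z0 l Hl eps He) as [d [Hd K]].
    exists (Rmin d d1). split; [now apply Rmin_glb_lt|]. intros w Hw Hwd.
    specialize (K w (Rlt_le_trans _ _ _ Hwd (Rmin_l _ _))).
    pose proof (K1 w (Rlt_le_trans _ _ _ Hwd (Rmin_r _ _))) as Hfw.
    assert (Hwz : w - z0 <> 0) by (intros E; now apply Hw, Cminus_eq_0).
    replace (g w / f w) with (u w - u z0); [exact K|].
    rewrite Hu0, Hg, Hf. unfold u. replace b with (a + (b - a))%nat at 2 by lia.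
    rewrite Cpow_add_r. field. split; [exact Hfw|now apply Cpow_nz]. }
  intros P [eps HP]. destruct (Hlim eps (cond_pos eps)) as [d [Hd K]].
  assert (Hloc : locally z0 (fun w => w <> z0 -> P (g w / f w))).
  { apply (locally_le_locally_norm (V := C_NormedModule)). exists (mkposreal d Hd). intros w Hw Hne.
    apply HP. apply C_NormedModule_mixin_compat1.
    change (minus (g w / f w) (RtoC 0)) with (g w / f w - 0).
    replace (g w / f w - 0) with (g w / f w) by ring. apply K; [exact Hne|]. exact Hw. }
  exact Hloc.
Qed.

(* P absorbs the finitely many points where g = Delta^n f vanishes to higher order than f, so
   that P f / g has no poles. *)
Lemma polynomial_quotient (f g : C -> C) (l : list C) : entire f -> entire g ->
  (exists z, f z <> 0) -> (exists z, g z <> 0) ->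
  (forall z, mero_zero (fun w => g w / f w) z -> In z l) ->
  exists P H, (exists z, poly_eval P z <> 0) /\ entire H /\ forall z, poly_eval P z * f z = H z * g z.
Proof.
  intros Hf Hg Hfn Hgn Hl.
  assert (HP : exists P, (exists z, poly_eval P z <> 0) /\ forall z0, In z0 l ->
    exists k g1 h, entire g1 /\ entire h /\ g1 z0 <> 0 /\
      (forall z, g z = (z - z0) ^ k * g1 z) /\ (forall z, poly_eval P z = (z - z0) ^ k * h z)).
  { clear Hl. induction l as [|b l' [P' [[z1 Hz1] IH]]].
    - exists (RtoC 1 :: nil). split; [|intros z0 []]. exists 0. simpl.
      replace (RtoC 1 + 0 * 0) with (RtoC 1) by ring. exact C1_nz.
    - destruct (entire_local_factor g b Hg Hgn) as (k & g1 & h1 & h2 & h3).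
      destruct (poly_mult_linear_pow b k P') as [P HP]. exists P. split.
      + destruct (entire_nonzero_nearby (poly_eval P') b (entire_poly_eval P') (ex_intro _ z1 Hz1))
          as [d [Hd K]].
        exists (b + RtoC (d / 2)).
        assert (E : b + RtoC (d / 2) - b = RtoC (d / 2)) by ring.
        assert (Hd0 : RtoC (d / 2) <> 0) by (apply RtoC_neq_0; lra).
        rewrite HP, E. apply Cmult_neq_0; [now apply Cpow_nz|]. apply K.
        * intros h. apply Hd0. rewrite <- E, h. ring.
        * rewrite E, Cmod_R, Rabs_pos_eq; lra.
      + intros z0 [->|Hin].
        * exists k, g1, (poly_eval P'). split; [exact h1|]. split; [apply entire_poly_eval|auto].
        * destruct (IH z0 Hin) as (k' & g1' & h' & i1 & i2 & i3 & i4 & i5).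
          exists k', g1', (fun z => (z - b) ^ k * h' z). split; [exact i1|]. split.
          { apply entire_mult; [|exact i2]. apply entire_pow, entire_minus; auto using entire_id, entire_const. }
          split; [exact i3|]. split; [exact i4|]. intros z. rewrite HP, i5. ring. }
  destruct HP as [P [HPn HP]].
  destruct (entire_quotient (fun z => poly_eval P z * f z) g) as [H [HH HE]].
  - intros z0. destruct (classic (In z0 l)) as [Hin|Hin].
    + destruct (HP z0 Hin) as (k & g1 & h & i1 & i2 & i3 & i4 & i5).
      exists k, (fun z => h z * f z), g1. split; [now apply entire_mult|]. split; [exact i1|].
      split; [exact i3|]. split; [|exact i4]. intros z. rewrite i5. ring.
    + destruct (entire_local_factor f z0 Hf Hfn) as (a & f1 & h1 & h2 & h3).
      destruct (entire_local_factor g z0 Hg Hgn) as (b & g1 & i1 & i2 & i3).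
      destruct (Nat.lt_ge_cases a b) as [hab|hab].
      (* If f vanished to lower order than g, z0 would be a zero of g / f and hence belong to l. *)
      { exfalso. apply Hin, Hl. now apply (mero_zero_of_factor g f g1 f1 z0 a b). }
      exists b, (fun z => poly_eval P z * ((z - z0) ^ (a - b) * f1 z)), g1. split.
      { apply entire_mult; [apply entire_poly_eval|]. apply entire_mult; [|exact h1].
        apply entire_pow, entire_minus; auto using entire_id, entire_const. }
      split; [exact i1|]. split; [exact i2|]. split; [|exact i3].
      intros z. rewrite h3. replace a with (b + (a - b))%nat at 1 by lia. rewrite Cpow_add_r. ring.
  - exists P, H. auto.
Qed.

Lemma pow_le_exp_Rpower (sig r : R) (m : nat) : (0 < sig)%R -> (1 <= r)%R ->
  (r ^ m <= exp (INR m / sig * Rpower r sig))%R.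
Proof.
  intros Hs Hr. rewrite <- Rpower_pow by lra. unfold Rpower at 1. apply exp_mono.
  unfold Rdiv. rewrite !Rmult_assoc. apply Rmult_le_compat_l; [apply pos_INR|].
  apply (Rmult_le_reg_l sig); [exact Hs|]. rewrite <- Rmult_assoc, Rinv_r, Rmult_1_l by lra.
  unfold Rpower. pose proof (exp_ineq1_le (sig * ln r)). lra.
Qed.

(** Inverting Delta would turn a polynomial bound for the n-th difference into one for f. *)
Lemma Delta_n_not_polynomial (f : C -> C) (sig : R) (n : nat) : transcendental_entire f ->
  (0 < sig < 1 / 2)%R -> growth f sig -> ~ is_polynomial_fun (Delta_n n f).
Proof.
  intros Hf Hsig Hg [l Hl].
  destruct (bound_from_Delta_n f sig n (proj1 Hf) Hsig Hg) as (C0 & r0 & HC0 & Hr0 & H).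
  assert (Hpoly : exists M d r1, (0 <= M)%R /\ (1 <= r1)%R /\ forall z, (r1 <= Cmod z ->
     Cmod (poly_eval l z) <= M * Cmod z ^ d)%R).
  { destruct (classic (exists z, poly_eval l z <> 0)) as [Hne|Hne].
    - destruct (poly_asymptotics l Hne) as (m & c & M & r1 & _ & HM & Hr1 & K).
      exists M, m, r1. split; [exact HM|]. split; [exact Hr1|]. intros z Hz. apply K, Hz.
    - exists 0%R, 0%nat, 1%R. split; [lra|]. split; [lra|]. intros z _.
      rewrite (zero_of_not_nonzero _ Hne z), Cmod_0. lra. }
  destruct Hpoly as (M & d & r1 & HM & Hr1 & K).
  apply (transcendental_growth f (S n + d) (C0 * (M + 1))%R Hf). intros r2.
  set (r := Rmax (Rmax r0 r1) r2).
  destruct (Rmax_Rle_l _ _ r (Rle_refl r)) as [R1 R2]. destruct (Rmax_Rle_l _ _ _ R1).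
  exists r. split; [exact R2|]. intros z Hz.
  pose proof (Rle_1_pow r d ltac:(lra)) as Hrd.
  assert (PB : (0 <= M * r ^ d)%R) by (apply Rmult_le_pos; lra).
  specialize (H r (M * r ^ d)%R ltac:(lra) PB).
  assert (H' : (Cmod (f z) <= C0 * r ^ S n * (M * r ^ d + 1))%R).
  { apply H; [|exact Hz]. intros w Hw. rewrite Hl, <- Hw. apply K. lra. }
  apply Rle_trans with (1 := H'). rewrite pow_add.
  assert (P1 : (0 <= C0 * r ^ S n)%R) by (apply Rmult_le_pos; [exact HC0|apply pow_le; lra]).
  replace (C0 * (M + 1) * (r ^ S n * r ^ d))%R with (C0 * r ^ S n * ((M + 1) * r ^ d))%R by ring.
  apply Rmult_le_compat_l; lra.
Qed.

Lemma Delta_n_growth (f : C -> C) (sig tau : R) (n : nat) : (0 < sig < tau)%R -> (tau < 1)%R ->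
  growth f sig -> growth (Delta_n n f) tau.
Proof.
  intros Hsig Htau [r0 H].
  destruct (Rpower_dominates sig tau (INR n + 2)) as [r1 [Hr1 K]]; [lra|].
  exists (Rmax (Rmax r0 r1) (INR n)). intros r Hr z Hz.
  destruct (Rmax_Rle_l _ _ _ Hr) as [Hr0 Hn]. destruct (Rmax_Rle_l _ _ _ Hr0).
  assert (B1 : (Cmod (Delta_n n f z) <= 2 ^ n * exp (Rpower (r + INR n) sig))%R).
  { apply (Delta_n_bound n f r); [|exact Hz]. intros w Hw. apply H; [|exact Hw]. pose proof (pos_INR n). lra. }
  apply Rle_trans with (1 := B1).
  assert (Hs1 : (1 <= Rpower r sig)%R) by (apply Rpower_ge_1; lra).
  assert (E1 : (2 ^ n <= exp (INR n * Rpower r sig))%R).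
  { apply Rle_trans with (exp 1 ^ n)%R.
    - apply pow_incr. pose proof (exp_ineq1_le 1). lra.
    - rewrite exp_pow_INR. apply exp_mono. apply Rmult_le_compat_l; [apply pos_INR|lra]. }
  assert (E2 : (Rpower (r + INR n) sig <= 2 * Rpower r sig)%R).
  { pose proof (pos_INR n). apply Rle_trans with (Rpower (2 * r) sig).
    - apply Rpower_mono_l; lra.
    - rewrite <- Rpower_mult_distr by lra. apply Rmult_le_compat_r; [lra|]. apply Rpower_le_self; lra. }
  apply Rle_trans with (exp (INR n * Rpower r sig) * exp (2 * Rpower r sig))%R.
  - apply Rmult_le_compat; [apply pow_le; lra|left; apply exp_pos|exact E1|now apply exp_mono].
  - rewrite <- exp_plus. apply exp_mono. specialize (K r ltac:(lra)). lra.
Qed.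

Lemma infinitely_many_zeros (f : C -> C) (sig : R) (n : nat) : transcendental_entire f ->
  (0 < sig < 1 / 2)%R -> growth f sig ->
  ~ rational_on (fun z => f z <> RtoC 0) (fun z => Delta_n n f z / f z) ->
  infinitely_many (mero_zero (fun z => Delta_n n f z / f z)).
Proof.
  intros Htr Hsig Hg Hnr.
  destruct (classic (infinitely_many (mero_zero (fun z => Delta_n n f z / f z)))) as [|Hinf]; [assumption|].
  exfalso. apply not_all_ex_not in Hinf. destruct Hinf as [l Hl].
  assert (Hz : forall z, mero_zero (fun w => Delta_n n f w / f w) z -> In z l).
  { intros z Hz. apply NNPP. intros h. apply Hl. now exists z. }
  clear Hl. set (g := Delta_n n f) in *.
  pose proof (proj1 Htr) as Hf. pose proof (transcendental_nonzero f Htr) as Hfn.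
  assert (Hge : entire g) by now apply entire_Delta_n.
  assert (Hgnp : ~ is_polynomial_fun g) by now apply Delta_n_not_polynomial with sig.
  assert (Hgn : exists z, g z <> 0) by (apply transcendental_nonzero; now split).
  destruct (polynomial_quotient f g l Hf Hge Hfn Hgn Hz) as (P & H & HPn & HH & HE).
  (* Room is left between sig and 1/2, so that constants and powers of r in front of exp (r^sig) are
     absorbed by exp (r^tau). *)
  set (tau := ((sig + 1 / 2) / 2)%R). set (tau' := ((sig + tau) / 2)%R).
  assert (Htau : (sig < tau' < tau /\ tau < 1 / 2)%R) by (unfold tau', tau; lra).
  assert (Hgg : growth g tau) by (apply Delta_n_growth with sig; auto; lra).
  destruct (poly_asymptotics P HPn) as (m & c & M & r0 & Hc & HM & Hr0 & HPa).
  assert (HHnp : ~ is_polynomial_fun H).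
  { intros [q Hq]. apply Hnr. exists P, q. split.
    (* If the denominator q vanished identically, so would P f = H g, and then f by isolation of the
       zeros of P. *)
    - apply NNPP. intros Hn. destruct Hfn as [z1 Hz1]. apply Hz1.
      apply (entire_zero_off_zeros (poly_eval P) f (entire_poly_eval P) HPn Hf). intros z HPz.
      assert (E : poly_eval P z * f z = 0) by (rewrite HE, Hq, (zero_of_not_nonzero _ Hn z); ring).
      replace (f z) with (/ poly_eval P z * (poly_eval P z * f z)) by (field; exact HPz). rewrite E. ring.
    - intros z Hfz Hqz. specialize (HE z). rewrite Hq in HE.
      replace (g z) with (/ poly_eval q z * (poly_eval q z * g z)) by (field; exact Hqz).
      rewrite <- HE. field. auto. }
  assert (Hcirc : forall r1, exists r, (r1 <= r)%R /\ forall z, Cmod z = r -> (Cmod (H z) <= exp (Rpower r tau))%R).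
  { destruct (Rpower_dominates sig tau (INR m / sig + M + 1)) as [r2 [Hr2 Kd]]; [lra|].
    destruct Hg as [rg Kg].
    intros r1. apply NNPP. intros Hn. apply Hgnp.
    (* With exponent 0 the bound r^0 is 1: if H were too large somewhere on every large circle, |g|
       <= 1 would occur on each of them, and g would be a polynomial. *)
    apply (wiman_minimum_modulus g tau 0 Hge); [lra| |].
    - destruct Hgg as [r3 K3]. intros r4. exists (Rmax r3 r4). split; [apply Rmax_r|].
      intros z Hzr. apply K3; [apply Rmax_l|lra].
    - exists (Rmax (Rmax r0 r1) (Rmax r2 rg)). intros r Hr.
      destruct (Rmax_Rle_l _ _ _ Hr) as [Hr01 Hr2g].
      destruct (Rmax_Rle_l _ _ _ Hr01). destruct (Rmax_Rle_l _ _ _ Hr2g).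
      apply NNPP. intros Hn2. apply Hn. exists r. split; [lra|]. intros z Hzr.
      assert (Hg1 : (1 < Cmod (g z))%R).
      { apply Rnot_le_lt. intros h. apply Hn2. exists z. split; [exact Hzr|]. simpl. exact h. }
      destruct (HPa z ltac:(lra)) as [[_ HPz] _]. rewrite Hzr in HPz.
      pose proof (Kg r ltac:(lra) z ltac:(lra)) as Hfz.
      assert (E : (Cmod (H z) * Cmod (g z) = Cmod (poly_eval P z) * Cmod (f z))%R)
        by (rewrite <- !Cmod_mult; now rewrite HE).
      pose proof (Cmod_ge_0 (H z)) as PH.
      assert (E1 : (Cmod (H z) <= M * r ^ m * exp (Rpower r sig))%R).
      { apply Rle_trans with (Cmod (H z) * Cmod (g z))%R; [nra|]. rewrite E.
        apply Rmult_le_compat; auto using Cmod_ge_0. }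
      apply Rle_trans with (1 := E1). set (s := Rpower r sig) in *.
      assert (Hs1 : (1 <= s)%R) by (apply Rpower_ge_1; lra).
      assert (E2 : (M <= exp (M * s))%R).
      { pose proof (exp_ineq1_le (M * s)). nra. }
      pose proof (pow_le_exp_Rpower sig r m ltac:(lra) ltac:(lra)) as E3. fold s in E3.
      apply Rle_trans with (exp (M * s) * exp (INR m / sig * s) * exp s)%R.
      + apply Rmult_le_compat_r; [left; apply exp_pos|].
        apply Rmult_le_compat; [exact HM|apply pow_le; lra|exact E2|exact E3].
      + rewrite <- !exp_plus. apply exp_mono. specialize (Kd r ltac:(lra)). fold s in Kd. lra. }
  destruct (bound_from_Delta_n f sig n Hf Hsig Hg) as (C0 & r1 & HC0 & Hr1 & HD).
  (* Where |H| > r^(m+n+2), the factor r^m offsets the growth of P and leaves |g| <= M r^(-n-2) max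
     |f|. Inverting Delta costs r^(n+1), so a factor 1/r remains to absorb max |f|. *)
  apply HHnp. apply (wiman_minimum_modulus H tau (m + n + 2) HH); [lra|exact Hcirc|].
  apply NNPP. intros Hn.
  apply (transcendental_growth f (S n) (2 * C0)%R Htr). intros r2.
  (* For r >= 2 C0 M the term with B is at most S0 / 2, which leaves S0 <= 2 C0 r^(n+1). *)
  set (r3 := Rmax (Rmax r0 r1) (Rmax r2 (2 * C0 * M))).
  assert (Hn2 : exists r, (r3 <= r)%R /\ forall z, Cmod z = r -> (r ^ (m + n + 2) < Cmod (H z))%R).
  { apply NNPP. intros Hn2. apply Hn. exists r3. intros r Hr. apply NNPP. intros Hn3. apply Hn2.
    exists r. split; [exact Hr|]. intros z Hzr. apply Rnot_le_lt. intros h. apply Hn3. now exists z. }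
  destruct Hn2 as [r [Hr HHr]]. unfold r3 in Hr.
  destruct (Rmax_Rle_l _ _ _ Hr) as [Hr01 Hr2]. destruct (Rmax_Rle_l _ _ _ Hr01). destruct (Rmax_Rle_l _ _ _ Hr2).
  exists r. split; [lra|]. intros z Hzr.
  destruct (circle_sup f r Hf ltac:(lra)) as (S0 & PS & US & LS).
  assert (Hr1' : (1 <= r)%R) by lra.
  pose proof (pow_lt r (n + 2) ltac:(lra)) as Hrn2. pose proof (pow_lt r m ltac:(lra)) as Hrm.
  set (B := (M * S0 / r ^ (n + 2))%R).
  assert (PB : (0 <= B)%R) by (apply Rdiv_le_0_compat; [apply Rmult_le_pos; assumption|exact Hrn2]).
  assert (HgB : forall w, Cmod w = r -> (Cmod (g w) <= B)%R).
  { intros w Hw. specialize (HHr w Hw). destruct (HPa w ltac:(lra)) as [[_ HPw] _]. rewrite Hw in HPw.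
    assert (E : (Cmod (H w) * Cmod (g w) = Cmod (poly_eval P w) * Cmod (f w))%R)
      by (rewrite <- !Cmod_mult; now rewrite HE).
    pose proof (Cmod_ge_0 (g w)) as Pg.
    assert (E1 : (r ^ (m + n + 2) * Cmod (g w) <= M * r ^ m * S0)%R).
    { apply Rle_trans with (Cmod (H w) * Cmod (g w))%R; [apply Rmult_le_compat_r; lra|]. rewrite E.
      apply Rmult_le_compat; auto using Cmod_ge_0. }
    replace (m + n + 2)%nat with (m + (n + 2))%nat in E1 by lia. rewrite pow_add in E1.
    unfold B. apply (Rmult_le_reg_l (r ^ m * r ^ (n + 2))); [now apply Rmult_lt_0_compat|].
    replace (r ^ m * r ^ (n + 2) * (M * S0 / r ^ (n + 2)))%R with (M * r ^ m * S0)%R by (field; lra).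
    exact E1. }
  specialize (HD r B ltac:(lra) PB HgB).
  assert (HS : (S0 <= C0 * r ^ S n * (B + 1))%R) by (apply LS; exact HD).
  assert (EB : (C0 * r ^ S n * B <= S0 / 2)%R).
  { unfold B. replace (n + 2)%nat with (S (S n)) by lia.
    pose proof (pow_lt r (S n) ltac:(lra)) as HrS.
    change (r ^ S (S n))%R with (r * r ^ S n)%R.
    replace (C0 * r ^ S n * (M * S0 / (r * r ^ S n)))%R with (C0 * M * S0 / r)%R by (field; lra).
    apply (Rmult_le_reg_r r); [lra|]. replace (C0 * M * S0 / r * r)%R with (C0 * M * S0)%R by (field; lra).
    assert (2 * C0 * M * S0 <= r * S0)%R by (apply Rmult_le_compat_r; lra). lra. }
  apply Rle_trans with S0; [now apply US|]. lra.
Qed.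

(** * Order below 1/n excludes rational quotients *)

(** Telescoping with 1/k^2 <= 1/(k-1) - 1/k. *)
Lemma rsum_tail_inv_square (u : nat -> R) (X : R) (N m : nat) : (2 <= N)%nat ->
  (forall k, (N <= k < N + m)%nat -> (INR k ^ 2 * u k <= X)%R) -> (0 <= X)%R ->
  (rsum u (N + m) <= rsum u N + X * (/ (INR N - 1) - / (INR (N + m) - 1)))%R.
Proof.
  intros HN H HX. assert (HN2 : (2 <= INR N)%R) by (apply (le_INR 2); exact HN).
  induction m as [|m IH].
  - rewrite Nat.add_0_r. lra.
  - rewrite Nat.add_succ_r. simpl rsum. specialize (IH ltac:(intros; apply H; lia)).
    specialize (H (N + m)%nat ltac:(lia)). rewrite S_INR. set (x := INR (N + m)) in *.
    assert (Hx : (2 <= x)%R) by (unfold x; rewrite plus_INR; pose proof (pos_INR m); lra).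
    assert (E : (u (N + m)%nat <= X * (/ (x - 1) - / (x + 1 - 1)))%R).
    { apply (Rmult_le_reg_l (x ^ 2)); [nra|]. apply Rle_trans with (1 := H).
      replace (x ^ 2 * (X * (/ (x - 1) - / (x + 1 - 1))))%R with (X * (1 + / (x - 1)))%R by (field; lra).
      assert (0 < / (x - 1))%R by (apply Rinv_0_lt_compat; lra). nra. }
    lra.
Qed.

Lemma rsum_le_split (u : nat -> R) (X : R) (N K : nat) : (2 <= N)%nat -> (0 <= X)%R ->
  (forall k, 0 <= u k)%R -> (forall k, (k < K)%nat -> (INR k ^ 2 * u k <= X)%R) ->
  (rsum u K <= rsum u N + X * / (INR N - 1))%R.
Proof.
  intros HN HX Hu H. assert (HN2 : (2 <= INR N)%R) by (apply (le_INR 2); exact HN).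
  assert (Hi : (0 < / (INR N - 1))%R) by (apply Rinv_0_lt_compat; lra).
  assert (P : (0 <= X * / (INR N - 1))%R) by (apply Rmult_le_pos; lra).
  destruct (Nat.le_gt_cases K N) as [h|h].
  - assert (T : (rsum u K <= rsum u N)%R).
    { replace N with (K + (N - K))%nat by lia. induction (N - K)%nat as [|m IH].
      - rewrite Nat.add_0_r. lra.
      - rewrite Nat.add_succ_r. simpl. specialize (Hu (K + m)%nat). lra. }
    lra.
  - pose proof (rsum_tail_inv_square u X N (K - N) HN) as T.
    replace (N + (K - N))%nat with K in T by lia. specialize (T ltac:(intros; apply H; lia) HX).
    assert (HK2 : (2 <= INR K)%R) by (apply (le_INR 2); lia).
    assert (Hi2 : (0 < / (INR K - 1))%R) by (apply Rinv_0_lt_compat; lra).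
    assert (X * (/ (INR N - 1) - / (INR K - 1)) <= X * / (INR N - 1))%R by (apply Rmult_le_compat_l; lra).
    lra.
Qed.

(* With n >= 2 the bound forces |a_k| r^k = O(M(r)/k^2), and since the sum of 1/k^2 converges
   boundedly many terms of the Taylor series carry half of M(r). *)
Lemma Delta_n_not_small (f : C -> C) (sig : R) (m : nat) (M r0 : R) : transcendental_entire f ->
  (0 < sig < 1 / 2)%R -> growth f sig -> (0 <= M)%R ->
  (forall z, r0 <= Cmod z -> Cmod z ^ S (S m) * Cmod (Delta_n (S (S m)) f z) <= M * Cmod (f z))%R ->
  False.
Proof.
  intros Htr Hsig Hg HM H. pose proof (proj1 Htr) as Hf. set (n := S (S m)) in *.
  destruct (entire_taylor f Hf) as [a Ha].
  destruct (coefs_from_Delta_n f a sig n Hf Ha Hsig Hg) as (C0 & r1 & HC0 & Hr1 & HD).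
  assert (P3 : (1 <= 3 ^ n)%R) by (apply Rle_1_pow; lra).
  set (A1 := (2 * 3 ^ n)%R).
  assert (HA1M : (0 <= A1 * M)%R) by (unfold A1; apply Rmult_le_pos; lra).
  assert (HA1C : (0 <= A1 * C0)%R) by (unfold A1; apply Rmult_le_pos; lra).
  (* The terms from N on contribute at most A1 (M S0 + C0 r^n) / (N - 1), and this N makes the part
     with S0 at most S0 / 2. N depends on M and n but not on r, so the head is bounded by a fixed
     power of r. *)
  destruct (nat_above (2 * (A1 * M) + 2)%R) as [N [HN1 _]]; [lra|].
  assert (HN : (2 <= N)%nat) by (apply INR_le; simpl (INR 2); lra).
  set (T0 := rsum (fun k => Cmod (a k)) N).
  assert (PT0 : (0 <= T0)%R) by (apply rsum_nonneg; intros; apply Cmod_ge_0).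
  apply (transcendental_growth f (N + n) (2 * (T0 + A1 * C0 + 2))%R Htr). intros r2.
  set (r := Rmax (Rmax r0 r1) r2).
  destruct (Rmax_Rle_l _ _ r (Rle_refl r)) as [Q1 Q2]. destruct (Rmax_Rle_l _ _ _ Q1).
  exists r. split; [lra|]. intros z Hz.
  destruct (circle_sup f r Hf ltac:(lra)) as (S0 & PS & US & LS).
  pose proof (pow_lt r n ltac:(lra)) as Hrn.
  set (B := (M * S0 / r ^ n)%R).
  assert (PB : (0 <= B)%R) by (apply Rdiv_le_0_compat; [now apply Rmult_le_pos|exact Hrn]).
  destruct (HD r B ltac:(lra) PB) as (K & HKr & Hfz & _ & Hk2).
  { intros w Hw. unfold B. apply (Rmult_le_reg_l (r ^ n)); [exact Hrn|].
    replace (r ^ n * (M * S0 / r ^ n))%R with (M * S0)%R by (field; lra).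
    rewrite <- Hw at 1. apply Rle_trans with (1 := H w ltac:(lra)). apply Rmult_le_compat_l; auto. }
  specialize (Hk2 m).
  set (X := (A1 * (M * S0 + C0 * r ^ n))%R).
  assert (PX : (0 <= X)%R).
  { unfold X. apply Rmult_le_pos; [unfold A1; lra|]. apply Rplus_le_le_0_compat; apply Rmult_le_pos; lra. }
  assert (HX : (2 * ((2 * r + 1) ^ n * (B + C0)) <= X)%R).
  { assert (T : ((2 * r + 1) ^ n <= 3 ^ n * r ^ n)%R) by (rewrite <- Rpow_mult_distr; apply pow_incr; lra).
    replace X with (2 * (3 ^ n * r ^ n * (B + C0)))%R by (unfold X, A1, B; field; lra).
    apply Rmult_le_compat_l; [lra|]. apply Rmult_le_compat_r; lra. }
  assert (HSS : (S0 <= rsum (fun k => Cmod (a k) * r ^ k) K + 2)%R) by (apply LS; exact Hfz).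
  assert (Hsplit : (rsum (fun k => Cmod (a k) * r ^ k) K <=
     rsum (fun k => Cmod (a k) * r ^ k) N + X * / (INR N - 1))%R).
  { apply rsum_le_split; auto.
    - intros k. apply Rmult_le_pos; [apply Cmod_ge_0|apply pow_le; lra].
    - intros k Hk. apply Rle_trans with (2 := HX). now apply Hk2. }
  assert (Hhead : (rsum (fun k => Cmod (a k) * r ^ k) N <= T0 * r ^ N)%R).
  { unfold T0. rewrite Rmult_comm, <- rsum_scal. apply rsum_le. intros k Hk. rewrite Rmult_comm.
    apply Rmult_le_compat_r; [apply Cmod_ge_0|]. apply Rle_pow; [lra|lia]. }
  assert (Htail : (X * / (INR N - 1) <= S0 / 2 + A1 * C0 * r ^ n)%R).
  { apply (Rmult_le_reg_r (INR N - 1)); [lra|]. rewrite Rmult_assoc, Rinv_l, Rmult_1_r by lra.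
    assert (U1 : (A1 * M * S0 <= S0 / 2 * (INR N - 1))%R).
    { apply Rle_trans with (S0 / 2 * (2 * (A1 * M)))%R; [right; field|]. apply Rmult_le_compat_l; lra. }
    assert (U2 : (A1 * C0 * r ^ n * 1 <= A1 * C0 * r ^ n * (INR N - 1))%R).
    { apply Rmult_le_compat_l; [apply Rmult_le_pos; lra|lra]. }
    unfold X. lra. }
  assert (HN0 : (1 <= r ^ N)%R) by (apply Rle_1_pow; lra).
  assert (Hn0 : (1 <= r ^ n)%R) by (apply Rle_1_pow; lra).
  assert (V : (T0 * r ^ N + A1 * C0 * r ^ n + 2 <= (T0 + A1 * C0 + 2) * (r ^ N * r ^ n))%R).
  { assert (V1 : (r ^ N * 1 <= r ^ N * r ^ n)%R) by (apply Rmult_le_compat_l; lra).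
    assert (V2 : (1 * r ^ n <= r ^ N * r ^ n)%R) by (apply Rmult_le_compat_r; lra).
    assert (T0 * r ^ N <= T0 * (r ^ N * r ^ n))%R by (apply Rmult_le_compat_l; lra).
    assert (A1 * C0 * r ^ n <= A1 * C0 * (r ^ N * r ^ n))%R by (apply Rmult_le_compat_l; lra).
    lra. }
  rewrite pow_add. apply Rle_trans with S0; [now apply US|]. lra.
Qed.

(** Delta f z is the Taylor remainder of f around z after the constant term, evaluated at distance
    1. On a disc of radius t it is at most B / (t - 1), and t >= 2 gives 2 B / t. *)
Lemma Delta_cauchy_bound (f : C -> C) (z : C) (t B : R) : entire f -> (2 <= t)%R ->
  (forall w, Cmod (w - z) <= t -> Cmod (f w) <= B)%R -> (Cmod (Delta f z) <= 2 / t * B)%R.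
Proof.
  intros Hf Ht HB. set (F := fun w => f (z + w)).
  assert (HF : entire F) by now apply entire_translate.
  destruct (entire_taylor F HF) as [b Hb].
  destruct (Hb t B ltac:(lra)) as [_ T].
  { intros w Hw. apply HB. replace (z + w - z) with w by ring. lra. }
  pose proof (T 0 1%nat) as T0. rewrite Cmod_0 in T0. specialize (T0 ltac:(lra)).
  pose proof (T 1 1%nat) as T1. rewrite Cmod_1 in T1. specialize (T1 ltac:(lra)).
  simpl csum in T0, T1.
  assert (E : F 0 = b 0%nat).
  { rewrite <- (Cplus_0_l (b 0%nat)), <- (Cmult_1_r (b 0%nat)). apply Cminus_eq_0, Cmod_le_0.
    apply Rle_trans with (1 := T0). unfold Rdiv. rewrite Rmult_0_l. simpl. lra. }
  replace (Delta f z) with (F 1 - (0 + b 0%nat * 1)).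
  2:{ rewrite <- E. unfold F, Delta. replace (z + 0) with z by ring. ring. }
  apply Rle_trans with (1 := T1). rewrite pow_1.
  assert (PB : (0 <= B)%R).
  { eapply Rle_trans; [apply Cmod_ge_0|]. apply (HB z). replace (z - z) with (RtoC 0) by ring.
    rewrite Cmod_0. lra. }
  replace (B * (t / (t - 1)) * (1 / t))%R with (B * / (t - 1))%R by (field; lra).
  rewrite Rmult_comm. apply Rmult_le_compat_r; [exact PB|].
  apply (Rmult_le_reg_r (t * (t - 1))); [nra|].
  replace (/ (t - 1) * (t * (t - 1)))%R with t by (field; lra).
  replace (2 / t * (t * (t - 1)))%R with (2 * (t - 1))%R by (field; lra). lra.
Qed.

Lemma Delta_n_cauchy_bound (f : C -> C) (n : nat) (z : C) (t B : R) : entire f -> (2 <= t)%R ->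
  (forall w, Cmod (w - z) <= INR n * t -> Cmod (f w) <= B)%R ->
  (Cmod (Delta_n n f z) <= (2 / t) ^ n * B)%R.
Proof.
  intros Hf Ht. revert z. induction n as [|n IH]; intros z HB.
  - simpl. rewrite Rmult_1_l. apply HB. replace (z - z) with (RtoC 0) by ring. rewrite Cmod_0. simpl. lra.
  - simpl Delta_n. change ((2 / t) ^ S n)%R with (2 / t * (2 / t) ^ n)%R. rewrite Rmult_assoc.
    apply Delta_cauchy_bound; [now apply entire_Delta_n|exact Ht|]. intros w Hw. apply IH.
    intros v Hv. apply HB. rewrite S_INR.
    pose proof (Cmod_triangle (v - w) (w - z)) as T. replace (v - w + (w - z)) with (v - z) in T by ring. lra.
Qed.

(* Otherwise M(r + n t) > e M(r) for t = r^(1-e) and large r; iterating r^e times from R to 2R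
   makes M(2R) larger than the growth hypothesis allows. *)
Lemma Delta_n_not_large (f : C -> C) (sig : R) (n : nat) (M r0 : R) : transcendental_entire f ->
  (1 <= n)%nat -> (0 < sig < / INR n)%R -> growth f sig -> (0 <= M)%R -> (1 <= r0)%R ->
  (forall z, r0 <= Cmod z -> Cmod (f z) <= M * Cmod z ^ pred n * Cmod (Delta_n n f z))%R ->
  False.
Proof.
  intros Htr Hn Hsig [rg Hg] HM Hr0 H. pose proof (proj1 Htr) as Hf.
  assert (Hn1 : (1 <= INR n)%R) by (apply (le_INR 1); exact Hn).
  (* ep < 1/n makes X^(n-1) t^(-n) = X^(n ep - 1) tend to 0 for t = X^(1-ep), so that each step
     multiplies |f| by at least e. ep > sig makes the number of steps, of order X^ep, exceed
     X^sig. *)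
  set (ep := ((sig + / INR n) / 2)%R).
  assert (Hep : (sig < ep < / INR n)%R) by (unfold ep; lra).
  assert (Hnep : (INR n * ep < 1)%R).
  { apply Rlt_le_trans with (INR n * / INR n)%R; [apply Rmult_lt_compat_l; lra|]. rewrite Rinv_r; lra. }
  assert (Hep1 : (ep < 1)%R) by nra.
  destruct (entire_bounded_on_disc f r0 Hf) as [B0 [HB0 KB0]].
  destruct (Rpower_unbounded (1 - INR n * ep) (3 * (M * 2 ^ n) + 1)) as [x1 [Hx1 K1]]; [lra|].
  destruct (Rpower_unbounded (1 - ep) 2) as [x2 [Hx2 K2]]; [lra|].
  (* After J steps (J + 1) n t > R0 = X/2, and X = X^ep t. The factor 4n therefore gives J + 1 >= 2
     X^sig, against J <= X^sig and X^sig > 1. *)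
  destruct (Rpower_dominates sig ep (4 * INR n)) as [x3 [Hx3 K3]]; [lra|].
  (* Starting above B0, the maximum over |z| <= r0 up to a constant, keeps all later points, where
     |f| is larger still, outside that disc, so the hypothesis [H] applies at each of them. *)
  assert (Hbig : exists z0, (Rmax (Rmax x1 x2) (Rmax x3 (Rmax rg 2)) <= Cmod z0)%R /\ (B0 + 1 < Cmod (f z0))%R).
  { apply NNPP. intros Hnb. apply (transcendental_growth f 0 (B0 + 1)%R Htr).
    intros r1. set (y := Rmax (Rmax x1 x2) (Rmax x3 (Rmax rg 2))) in *.
    exists (Rmax y r1). split; [apply Rmax_r|]. intros z Hz. simpl. rewrite Rmult_1_r.
    apply Rnot_lt_le. intros h. apply Hnb. exists z. split; [rewrite Hz; apply Rmax_l|exact h]. }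
  destruct Hbig as [z0 [Hz0 Hfz0]].
  destruct (Rmax_Rle_l _ _ _ Hz0) as [Y1 Y2]. destruct (Rmax_Rle_l _ _ _ Y1).
  destruct (Rmax_Rle_l _ _ _ Y2) as [Y3 Y4]. destruct (Rmax_Rle_l _ _ _ Y4).
  set (R0 := Cmod z0) in *. set (X := (2 * R0)%R).
  assert (HX : (4 <= X)%R) by (unfold X; lra).
  set (t := Rpower X (1 - ep)).
  assert (Ht : (2 <= t)%R) by (apply K2; unfold X; lra).
  set (m0 := Cmod (f z0)) in *.
  assert (Hq : (M * X ^ pred n * (2 / t) ^ n * exp 1 < 1)%R).
  { assert (E : (X ^ pred n * (/ t) ^ n = / Rpower X (1 - INR n * ep))%R).
    { rewrite <- Rpower_pow by lra. rewrite pow_inv. rewrite <- (Rpower_pow n t) by lra.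
      unfold t. rewrite Rpower_mult, <- !Rpower_Ropp, <- Rpower_plus. f_equal.
      replace (INR (pred n)) with (INR n - 1)%R; [ring|]. destruct n; [lia|]. simpl pred. rewrite S_INR. ring. }
    specialize (K1 X ltac:(unfold X; lra)). set (Y := Rpower X (1 - INR n * ep)) in *.
    assert (P2 : (1 <= 2 ^ n)%R) by (apply Rle_1_pow; lra).
    assert (PM : (0 <= M * 2 ^ n)%R) by (apply Rmult_le_pos; lra).
    replace (M * X ^ pred n * (2 / t) ^ n * exp 1)%R with (M * 2 ^ n * exp 1 * / Y)%R.
    2:{ rewrite <- E. unfold Rdiv. rewrite Rpow_mult_distr. ring. }
    apply (Rmult_lt_reg_r Y); [lra|]. rewrite Rmult_assoc, Rinv_l by lra.
    pose proof exp_le_3. pose proof (exp_pos 1).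
    assert (M * 2 ^ n * exp 1 <= M * 2 ^ n * 3)%R by (apply Rmult_le_compat_l; lra). lra. }
  assert (Hm0 : (0 < m0)%R) by lra.
  assert (Hiter : forall j : nat, (INR j * (INR n * t) <= R0)%R ->
     exists w, (Cmod w <= R0 + INR j * (INR n * t) /\ exp (INR j) * m0 <= Cmod (f w))%R).
  { induction j as [|j IH]; intros Hj.
    - exists z0. simpl. rewrite exp_0. unfold R0 at 1, m0. lra.
    - rewrite S_INR in *. assert (Hnt : (0 < INR n * t)%R) by (apply Rmult_lt_0_compat; lra).
      destruct (IH ltac:(lra)) as [w [Hw1 Hw2]].
      assert (Hej : (1 <= exp (INR j))%R) by (rewrite <- exp_0; apply exp_mono, pos_INR).
      assert (Hw0 : (r0 <= Cmod w)%R).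
      { apply Rnot_lt_le. intros h. pose proof (KB0 w ltac:(lra)) as T. nra. }
      apply NNPP. intros Hno.
      assert (Hall : forall v, (Cmod (v - w) <= INR n * t -> Cmod (f v) <= exp (INR j + 1) * m0)%R).
      { intros v Hv. apply Rnot_lt_le. intros h. apply Hno. exists v.
        pose proof (Cmod_triangle (v - w) w) as T. replace (v - w + w) with v in T by ring. lra. }
      pose proof (Delta_n_cauchy_bound f n w t _ Hf Ht Hall) as HD.
      pose proof (H w Hw0) as Hfw.
      assert (HwX : (Cmod w ^ pred n <= X ^ pred n)%R).
      { apply pow_incr. split; [apply Cmod_ge_0|]. unfold X. lra. }
      assert (Hfw2 : (Cmod (f w) <= M * X ^ pred n * ((2 / t) ^ n * (exp (INR j + 1) * m0)))%R).
      { apply Rle_trans with (1 := Hfw). apply Rmult_le_compat; auto using Cmod_ge_0.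
        - apply Rmult_le_pos; [exact HM|apply pow_le, Cmod_ge_0].
        - apply Rmult_le_compat_l; assumption. }
      rewrite exp_plus in Hfw2.
      assert (Pe : (0 < exp (INR j) * m0)%R) by (apply Rmult_lt_0_compat; lra).
      apply (Rmult_lt_compat_r (exp (INR j) * m0)) in Hq; [|exact Pe]. lra. }
  assert (Hnt : (0 < INR n * t)%R) by (apply Rmult_lt_0_compat; lra).
  assert (HJ : exists J : nat, (INR J * (INR n * t) <= R0 < (INR J + 1) * (INR n * t))%R).
  { destruct (nat_above (R0 / (INR n * t))) as [J0 [HJ1 HJ2]].
    { apply Rdiv_le_0_compat; lra. }
    assert (HR0 : (R0 = R0 / (INR n * t) * (INR n * t))%R) by (field; lra).
    set (q := (R0 / (INR n * t))%R) in *.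
    assert (Hq0 : (0 < q)%R) by (apply Rdiv_lt_0_compat; lra).
    destruct (Rle_lt_dec (INR J0) q) as [h|h].
    - exists J0. rewrite HR0. split; [apply Rmult_le_compat_r; lra|].
      apply Rmult_lt_compat_r; lra.
    - destruct J0 as [|J1]; [simpl in h; lra|]. rewrite S_INR in *. exists J1. rewrite HR0.
      split; [apply Rmult_le_compat_r; lra|]. apply Rmult_lt_compat_r; lra. }
  destruct HJ as [J [HJ1 HJ2]]. destruct (Hiter J HJ1) as [w [Hw1 Hw2]].
  pose proof (Hg X ltac:(unfold X; lra) w ltac:(unfold X; lra)) as Hup.
  assert (Hs1 : (1 < Rpower X sig)%R).
  { rewrite <- (Rpower_O X) by lra. apply Rpower_lt; lra. }
  assert (HJs : (INR J <= Rpower X sig)%R).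
  { apply Rnot_lt_le. intros h. apply exp_increasing in h.
    assert (exp (INR J) * 1 <= exp (INR J) * m0)%R
      by (apply Rmult_le_compat_l; [left; apply exp_pos|lra]). lra. }
  specialize (K3 X ltac:(unfold X; lra)).
  assert (HXt : (X = Rpower X ep * t)%R).
  { unfold t. rewrite <- Rpower_plus. replace (ep + (1 - ep))%R with 1%R by ring. rewrite Rpower_1 by lra.
    reflexivity. }
  assert (E1 : (4 * INR n * Rpower X sig * t <= 2 * ((INR J + 1) * (INR n * t)))%R).
  { apply Rle_trans with X; [|unfold X; lra]. rewrite HXt at 2. apply Rmult_le_compat_r; lra. }
  assert (E2 : (INR n * t * (2 * Rpower X sig) <= INR n * t * (INR J + 1))%R) by lra.
  apply Rmult_le_reg_l in E2; [|exact Hnt]. lra.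
Qed.

(* If Delta f = R f then Delta^2 f = (R(z+1) R(z) + Delta R(z)) f, which lowers the exponent from
   n = 1, where Delta_n_not_small does not apply, to n = 2. *)
Lemma rational_first_difference (f : C -> C) (P Q : list C) (mp mq : nat) (M c r0 : R) :
  (0 < c)%R -> (0 <= M)%R -> (1 <= r0)%R -> (S mp <= mq)%nat ->
  (forall z, poly_eval Q z * Delta f z = poly_eval P z * f z) ->
  (forall z, r0 <= Cmod z -> Cmod (poly_eval P z) <= M * Cmod z ^ mp /\
     Cmod (poly_eval P (z + 1)%C - poly_eval P z) * Cmod z <= M * Cmod z ^ mp)%R ->
  (forall z, r0 <= Cmod z -> c * Cmod z ^ mq <= Cmod (poly_eval Q z) <= M * Cmod z ^ mq /\
     Cmod (poly_eval Q (z + 1)%C - poly_eval Q z) * Cmod z <= M * Cmod z ^ mq)%R ->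
  exists M', (0 <= M')%R /\ forall z, (r0 + 2 <= Cmod z ->
    Cmod z ^ 2 * Cmod (Delta_n 2 f z) <= M' * Cmod (f z))%R.
Proof.
  intros Hc HM Hr0 Hm HE HP HQ.
  assert (P2 : (0 < 2 ^ mq)%R) by (apply pow_lt; lra).
  assert (P2p : (0 < 2 ^ mp)%R) by (apply pow_lt; lra).
  set (M1 := (2 * M * M + M * M * 2 ^ mp)%R).
  assert (PMM : (0 <= M * M)%R) by (apply Rmult_le_pos; lra).
  assert (PM1 : (0 <= M1)%R) by (unfold M1; pose proof (Rmult_le_pos _ _ PMM (Rlt_le _ _ P2p)); lra).
  exists (M1 * 2 ^ mq / (c * c))%R. split.
  { apply Rdiv_le_0_compat; [apply Rmult_le_pos; lra|nra]. }
  intros z Hz. set (x := Cmod z) in *.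
  destruct (HP z ltac:(unfold x in *; lra)) as [HPz HdP]. destruct (HQ z ltac:(unfold x in *; lra)) as [[HQz1 HQz2] HdQ].
  (* The shift r0 + 2 in the conclusion provides both the range of the estimates at z + 1 and the
     comparison of |z + 1| with |z|. *)
  assert (Hz1 : (x / 2 <= Cmod (z + 1) <= 2 * x /\ r0 <= Cmod (z + 1))%R).
  { pose proof (Cmod_triangle z 1) as T. rewrite Cmod_1 in T.
    pose proof (Cmod_reverse_triangle z (- (1))) as T'. rewrite Cmod_opp, Cmod_1 in T'.
    replace (z - - (1)) with (z + 1) in T' by ring. unfold x in *. lra. }
  destruct (HP (z + 1)%C ltac:(lra)) as [HPz' _]. destruct (HQ (z + 1)%C ltac:(lra)) as [[HQz1' _] _].
  fold x in HPz, HdP, HQz1, HQz2, HdQ.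
  set (p0 := poly_eval P z) in *. set (p1 := poly_eval P (z + 1)) in *.
  set (q0 := poly_eval Q z) in *. set (q1 := poly_eval Q (z + 1)) in *.
  (* The identity for the second difference with denominators cleared: the first two terms form the
     numerator of Delta (P/Q), and p1 p0 comes from the product of the two shifts. Each is O(b^2 /
     x^2). *)
  assert (Id : q0 * q1 * Delta_n 2 f z = (q0 * (p1 - p0) - p0 * (q1 - q0) + p1 * p0) * f z).
  { pose proof (HE z) as e0. pose proof (HE (z + 1)) as e1. fold p0 q0 in e0. fold p1 q1 in e1.
    change (Delta_n 2 f z) with (Delta f (z + 1) - Delta f z).
    replace (q0 * q1 * (Delta f (z + 1) - Delta f z))
      with (q0 * (q1 * Delta f (z + 1)) - q1 * (q0 * Delta f z)) by ring.
    rewrite e0, e1. replace (f (z + 1)) with (f z + Delta f z) by (unfold Delta; ring).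
    replace (q0 * (p1 * (f z + Delta f z)) - q1 * (p0 * f z))
      with (q0 * p1 * f z + p1 * (q0 * Delta f z) - q1 * (p0 * f z)) by ring.
    rewrite e0. ring. }
  set (a := (x ^ mp)%R) in *. set (b := (x ^ mq)%R) in *.
  assert (Hx1 : (1 <= x)%R) by lra.
  assert (Ha : (1 <= a)%R) by (apply Rle_1_pow; exact Hx1).
  assert (Hb : (1 <= b)%R) by (apply Rle_1_pow; exact Hx1).
  assert (Hab : (x * a <= b)%R).
  { unfold a, b. change (x * x ^ mp)%R with (x ^ S mp)%R. apply Rle_pow; assumption. }
  assert (Up : (Cmod p1 <= M * 2 ^ mp * a)%R).
  { apply Rle_trans with (1 := HPz'). rewrite Rmult_assoc. apply Rmult_le_compat_l; [exact HM|].
    unfold a. rewrite <- Rpow_mult_distr. apply pow_incr. pose proof (Cmod_ge_0 (z + 1)). lra. }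
  assert (Lq : (c * (b / 2 ^ mq) <= Cmod q1)%R).
  { apply Rle_trans with (2 := HQz1'). apply Rmult_le_compat_l; [lra|].
    unfold b. replace (x ^ mq / 2 ^ mq)%R with ((x / 2) ^ mq)%R
      by (unfold Rdiv; rewrite Rpow_mult_distr, pow_inv; reflexivity).
    apply pow_incr. lra. }
  assert (Eq : (Cmod q0 * Cmod q1 * Cmod (Delta_n 2 f z) =
     Cmod (q0 * (p1 - p0) - p0 * (q1 - q0) + p1 * p0) * Cmod (f z))%R)
    by (rewrite <- !Cmod_mult; now rewrite Id).
  assert (Br : (x ^ 2 * Cmod (q0 * (p1 - p0) - p0 * (q1 - q0) + p1 * p0) <= M1 * (b * b))%R).
  { apply Rle_trans with (x ^ 2 * (Cmod q0 * Cmod (p1 - p0) + Cmod p0 * Cmod (q1 - q0) + Cmod p1 * Cmod p0))%R.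
    - apply Rmult_le_compat_l; [apply pow2_ge_0|]. eapply Rle_trans; [apply Cmod_triangle|].
      rewrite (Cmod_mult p1). apply Rplus_le_compat_r.
      eapply Rle_trans; [apply Cmod_triangle_minus|]. rewrite !Cmod_mult. lra.
    - assert (Hxx : (0 <= x)%R) by lra.
      assert (I1 : (Cmod q0 * (Cmod (p1 - p0) * x) <= M * b * (M * a))%R).
      { apply Rmult_le_compat; auto using Cmod_ge_0. apply Rmult_le_pos; [apply Cmod_ge_0|lra]. }
      assert (I2 : (Cmod p0 * (Cmod (q1 - q0) * x) <= M * a * (M * b))%R).
      { apply Rmult_le_compat; auto using Cmod_ge_0. apply Rmult_le_pos; [apply Cmod_ge_0|lra]. }
      assert (I3 : (Cmod p1 * Cmod p0 <= M * 2 ^ mp * a * (M * a))%R)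
        by (apply Rmult_le_compat; auto using Cmod_ge_0).
      apply (Rmult_le_compat_l x) in I1; [|exact Hxx]. apply (Rmult_le_compat_l x) in I2; [|exact Hxx].
      apply (Rmult_le_compat_l (x ^ 2)) in I3; [|apply pow2_ge_0].
      assert (J1 : (M * M * (b * (x * a)) <= M * M * (b * b))%R).
      { apply Rmult_le_compat_l; [exact PMM|]. apply Rmult_le_compat_l; lra. }
      assert (J2 : (M * M * 2 ^ mp * ((x * a) * (x * a)) <= M * M * 2 ^ mp * (b * b))%R).
      { apply Rmult_le_compat_l; [apply Rmult_le_pos; lra|].
        assert (0 <= x * a)%R by (apply Rmult_le_pos; lra). apply Rmult_le_compat; lra. }
      unfold M1. simpl in I3 |- *. lra. }
  assert (Lqq : (c * c / 2 ^ mq * (b * b) <= Cmod q0 * Cmod q1)%R).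
  { replace (c * c / 2 ^ mq * (b * b))%R with (c * b * (c * (b / 2 ^ mq)))%R by (field; lra).
    assert (0 <= b / 2 ^ mq)%R by (apply Rdiv_le_0_compat; lra).
    apply Rmult_le_compat; try assumption; apply Rmult_le_pos; lra. }
  set (D := Cmod (Delta_n 2 f z)) in *. assert (PD : (0 <= D)%R) by apply Cmod_ge_0.
  pose proof (Cmod_ge_0 (f z)) as Pf.
  assert (Px : (0 <= x ^ 2)%R) by apply pow2_ge_0.
  assert (F1 : (c * c / 2 ^ mq * (b * b) * (x ^ 2 * D) <= M1 * (b * b) * Cmod (f z))%R).
  { apply Rle_trans with (Cmod q0 * Cmod q1 * (x ^ 2 * D))%R.
    - apply Rmult_le_compat_r; [now apply Rmult_le_pos|exact Lqq].
    - replace (Cmod q0 * Cmod q1 * (x ^ 2 * D))%R with (x ^ 2 * (Cmod q0 * Cmod q1 * D))%R by ring.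
      rewrite Eq, <- Rmult_assoc. apply Rmult_le_compat_r; assumption. }
  assert (Pbb : (0 < b * b)%R) by (apply Rmult_lt_0_compat; lra).
  assert (Pcc : (0 < c * c / 2 ^ mq)%R) by (apply Rdiv_lt_0_compat; [apply Rmult_lt_0_compat; lra|lra]).
  apply (Rmult_le_reg_l (c * c / 2 ^ mq * (b * b))); [now apply Rmult_lt_0_compat|].
  apply Rle_trans with (1 := F1). right. field. lra.
Qed.

Lemma quotient_not_rational (f : C -> C) (sig : R) (n : nat) : transcendental_entire f ->
  (1 <= n)%nat -> (0 < sig < 1 / 2)%R -> (sig < / INR n)%R -> growth f sig ->
  ~ rational_on (fun z => f z <> RtoC 0) (fun z => Delta_n n f z / f z).
Proof.
  intros Htr Hn Hsig Hsn Hg (P & Q & HQn & HPQ).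
  pose proof (proj1 Htr) as Hf. pose proof (transcendental_nonzero f Htr) as Hfn.
  (* The identity is given only where neither f nor Q vanishes. Multiplying by f makes it hold
     trivially at the zeros of f, which removes the exception for Q; then the factor f is cancelled
     and the exception for f removed. *)
  assert (HE : forall z, poly_eval Q z * Delta_n n f z = poly_eval P z * f z).
  { assert (HDe : entire (fun z => poly_eval Q z * Delta_n n f z - poly_eval P z * f z)).
    { apply entire_minus; apply entire_mult; auto using entire_poly_eval, entire_Delta_n. }
    assert (E1 : forall z, f z <> 0 -> poly_eval Q z * Delta_n n f z - poly_eval P z * f z = 0).
    { intros z Hz. set (D := fun w => f w * (poly_eval Q w * Delta_n n f w - poly_eval P w * f w)).
      assert (HD : D z = 0).
      { apply (entire_zero_off_zeros (poly_eval Q) D); auto using entire_poly_eval.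
        - now apply entire_mult.
        - intros w Hw. unfold D. destruct (classic (f w = 0)) as [E|E]; [rewrite E; ring|].
          specialize (HPQ w E Hw).
          replace (Delta_n n f w) with (Delta_n n f w / f w * f w) by (field; exact E).
          rewrite HPQ. field. exact Hw. }
      unfold D in HD.
      replace (poly_eval Q z * Delta_n n f z - poly_eval P z * f z)
        with (/ f z * (f z * (poly_eval Q z * Delta_n n f z - poly_eval P z * f z))) by (field; exact Hz).
      rewrite HD. ring. }
    intros z. apply Cminus_eq_0. exact (entire_zero_off_zeros f _ Hf Hfn HDe E1 z). }
  clear HPQ.
  destruct (poly_asymptotics Q HQn) as (mq & cq & Mq & rq & Hcq & HMq & Hrq & HQ).
  destruct (classic (exists z, poly_eval P z <> 0)) as [HPn|HPn].
  2:{ apply (Delta_n_not_polynomial f sig n Htr Hsig Hg). exists nil. simpl.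
      apply (entire_zero_off_zeros (poly_eval Q)); auto using entire_poly_eval, entire_Delta_n.
      intros z Hz. replace (Delta_n n f z) with (/ poly_eval Q z * (poly_eval Q z * Delta_n n f z))
        by (field; exact Hz).
      rewrite HE, (zero_of_not_nonzero _ HPn z). ring. }
  destruct (poly_asymptotics P HPn) as (mp & cp & Mp & rp & Hcp & HMp & Hrp & HP).
  set (r0 := Rmax rp rq).
  assert (Rp : (rp <= r0)%R) by apply Rmax_l. assert (Rq : (rq <= r0)%R) by apply Rmax_r.
  assert (Eq : forall z, (Cmod (poly_eval Q z) * Cmod (Delta_n n f z) = Cmod (poly_eval P z) * Cmod (f z))%R)
    by (intros z; rewrite <- !Cmod_mult; now rewrite HE).
  (* The quotient grows like |z|^(mp - mq). Degrees being integers, the alternative to decay of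
     order at least n is mq - mp <= n - 1, the exponent [pred n] in [Delta_n_not_large]. *)
  destruct (Nat.le_gt_cases (mp + n) mq) as [hm|hm].
  - destruct n as [|[|m]]; [lia| |].
    + destruct (rational_first_difference f P Q mp mq (Rmax Mp Mq) cq r0) as [M' [HM' K]]; auto; try lra.
      * pose proof (Rmax_l Mp Mq). lra.
      * lia.
      * intros z Hz. destruct (HP z ltac:(lra)) as [[_ K1] K2].
        assert (Mp * Cmod z ^ mp <= Rmax Mp Mq * Cmod z ^ mp)%R
          by (apply Rmult_le_compat_r; [apply pow_le, Cmod_ge_0|apply Rmax_l]). lra.
      * intros z Hz. destruct (HQ z ltac:(lra)) as [[K0 K1] K2].
        assert (Mq * Cmod z ^ mq <= Rmax Mp Mq * Cmod z ^ mq)%R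
          by (apply Rmult_le_compat_r; [apply pow_le, Cmod_ge_0|apply Rmax_r]). lra.
      * exact (Delta_n_not_small f sig 0 M' (r0 + 2)%R Htr Hsig Hg HM' K).
    + apply (Delta_n_not_small f sig m (Mp / cq)%R r0 Htr Hsig Hg).
      { apply Rdiv_le_0_compat; lra. }
      intros z Hz. destruct (HP z ltac:(lra)) as [[_ K1] _]. destruct (HQ z ltac:(lra)) as [[K2 _] _].
      set (n := S (S m)) in *. set (x := Cmod z) in *. set (g := Cmod (Delta_n n f z)) in *.
      assert (Pg : (0 <= g)%R) by apply Cmod_ge_0.
      assert (Px : (0 < x ^ mp)%R) by (apply pow_lt; lra).
      assert (E1 : (cq * x ^ mq * g <= Mp * x ^ mp * Cmod (f z))%R).
      { apply Rle_trans with (Cmod (poly_eval Q z) * g)%R; [now apply Rmult_le_compat_r|].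
        unfold g. rewrite Eq. apply Rmult_le_compat_r; [apply Cmod_ge_0|exact K1]. }
      assert (E2 : (x ^ mp * x ^ n <= x ^ mq)%R) by (rewrite <- pow_add; apply Rle_pow; [lra|exact hm]).
      assert (E3 : (cq * g * (x ^ mp * x ^ n) <= cq * g * x ^ mq)%R)
        by (apply Rmult_le_compat_l; [apply Rmult_le_pos; lra|exact E2]).
      apply (Rmult_le_reg_l (cq * x ^ mp)); [now apply Rmult_lt_0_compat|].
      replace (cq * x ^ mp * (Mp / cq * Cmod (f z)))%R with (Mp * x ^ mp * Cmod (f z))%R by (field; lra).
      lra.
  - apply (Delta_n_not_large f sig n (Mq / cp)%R r0 Htr Hn); auto; try lra.
    { apply Rdiv_le_0_compat; lra. }
    intros z Hz. destruct (HP z ltac:(lra)) as [[K1 _] _]. destruct (HQ z ltac:(lra)) as [[_ K2] _].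
    set (x := Cmod z) in *. set (g := Cmod (Delta_n n f z)) in *.
    assert (Pg : (0 <= g)%R) by apply Cmod_ge_0.
    assert (Px : (0 < x ^ mp)%R) by (apply pow_lt; lra).
    assert (E1 : (cp * x ^ mp * Cmod (f z) <= Mq * x ^ mq * g)%R).
    { apply Rle_trans with (Cmod (poly_eval P z) * Cmod (f z))%R.
      - apply Rmult_le_compat_r; [apply Cmod_ge_0|exact K1].
      - rewrite <- Eq. now apply Rmult_le_compat_r. }
    assert (E2 : (x ^ mq <= x ^ mp * x ^ pred n)%R) by (rewrite <- pow_add; apply Rle_pow; [lra|lia]).
    assert (E3 : (Mq * g * x ^ mq <= Mq * g * (x ^ mp * x ^ pred n))%R)
      by (apply Rmult_le_compat_l; [apply Rmult_le_pos; lra|exact E2]).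
    apply (Rmult_le_reg_l (cp * x ^ mp)); [now apply Rmult_lt_0_compat|].
    replace (cp * x ^ mp * (Mq / cp * x ^ pred n * g))%R with (Mq * g * (x ^ mp * x ^ pred n))%R by (field; lra).
    lra.
Qed.

Close Scope C_scope.

Theorem theorem1p2 :
  (forall (n : nat) (f : C -> C),
     transcendental_entire f ->
     Rbar_lt (order f) (Finite (1/2)) ->
     let G := fun z => Cdiv (Delta_n n f z) (f z) in
     ~ rational_on (fun z => f z <> RtoC 0) G ->
     infinitely_many (mero_zero G))
  /\
  (forall (n : nat) (f : C -> C),
     (1 <= n)%nat ->
     transcendental_entire f ->
     Rbar_lt (order f) (Finite (Rmin (1 / INR n) (1/2))) ->
     let G := fun z => Cdiv (Delta_n n f z) (f z) in
     ~ rational_on (fun z => f z <> RtoC 0) G /\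
     infinitely_many (mero_zero G)).
Proof.
  split.
  - intros n f Htr Ho G HG.
    destruct (order_lt_growth f (1 / 2)%R (proj1 Htr) ltac:(lra) Ho) as [sig [Hsig Hg]].
    now apply infinitely_many_zeros with sig.
  - intros n f Hn Htr Ho G.
    assert (Hn1 : (1 <= INR n)%R) by (apply (le_INR 1); exact Hn).
    assert (Hi : (0 < / INR n)%R) by (apply Rinv_0_lt_compat; lra).
    unfold Rdiv at 1 in Ho. rewrite Rmult_1_l in Ho.
    destruct (order_lt_growth f (Rmin (/ INR n) (1 / 2)) (proj1 Htr)) as [sig [Hsig Hg]].
    { apply Rmin_glb_lt; lra. }
    { exact Ho. }
    pose proof (Rmin_l (/ INR n) (1 / 2)). pose proof (Rmin_r (/ INR n) (1 / 2)).
    assert (HG : ~ rational_on (fun z => f z <> RtoC 0) G) by (apply quotient_not_rational with sig; auto; lra).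
    split; [exact HG|]. apply infinitely_many_zeros with sig; auto; lra.
Qed.
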